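(* Let $(\mathcal E,\mathcal F)$ be a regular symmetric Dirichlet form on $L^2(E;m)$ whose associated Hunt process $X=(\mathbf P_x,X_t,\zeta)$ is irreducible (I) and strong Feller (SF). Then $X$ is stochastically complete at infinity (SCI) if and only if $\mathbf P_x(\zeta=\zeta^p<\infty)=0$ for all $x\in E$.
   Context: $E$ is a locally compact separable metric space, $m$ a positive Radon measure on $E$ with full topological support; $\zeta$ is the lifetime of $X$; $p_tf(x)=\mathbf E_x(f(X_t);t<\zeta)$. (I): any Borel set $A$ with $p_t(1_Af)=1_Ap_tf$ $m$-a.e. for all bounded Borel $f\in L^2(E;m)$, $t>0$, satisfies $m(A)=0$ or $m(E\setminus A)=0$. (SF): $p_t$ maps bounded Borel functions to bounded continuous functions for each $t>0$. Resurrected process: let $k$ be the killing measure in the Beurling–Deny formula of $(\mathcal E,\mathcal F)$. The resurrected form $(\mathcal E^{\mathrm{res}},\mathcal F^{\mathrm{res}})$ is the regular Dirichlet form on $L^2(E;m)$ obtained by removing the killing part: $\mathcal F=\mathcal F^{\mathrm{res}}\cap L^2(E;k)$, $\mathcal F^{\mathrm{res}}\cap C_0(E)=\mathcal F\cap C_0(E)$ and $\mathcal E(u,v)=\mathcal E^{\mathrm{res}}(u,v)+\int_Euv\,dk$ for $u,v\in\mathcal F$. $X^{\mathrm{res}}=(\mathbf P^{\mathrm{res}}_x,X_t,\zeta)$ is the Hunt process generated by it and $A^k_t$ its positive continuous additive functional in Revuz correspondence with $k$. $X$ is the subprocess of $X^{\mathrm{res}}$ by the multiplicative functional $\exp(-A^k_t)$;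 in particular $p_tf(x)=\mathbf E^{\mathrm{res}}_x(e^{-A^k_t}f(X_t);t<\zeta)$. Predictable part of the lifetime: let $\{K_n\}$ be compact sets with $K_n\subset\mathring K_{n+1}$, $K_n\uparrow E$, and $\tau_n=\inf\{t>0:X_t\notin K_n\}$. Put $\Omega^p=\bigcap_n\{\tau_n<\zeta<\infty\}$; $\zeta^p$ equals $\zeta$ on $\Omega^p$ and $\infty$ on the complement of $\Omega^p$. (SCI): for all $x\in E$ and $t>0$, $\ 1=\mathbf E^{\mathrm{res}}_x\big(e^{-A^k_t};t<\zeta\big)+\mathbf E^{\mathrm{res}}_x\Big(\int_0^{\zeta\wedge t}e^{-A^k_s}dA^k_s\Big).$ *)

(* Defs.v *)
From HB Require Import structures.
From mathcomp Require Import all_boot all_order all_algebra.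
From mathcomp Require Import all_classical all_reals all_analysis measurable_realfun.

(* Conventions follow Fukushima-Oshima-Takeda, "Dirichlet Forms and Symmetric
   Markov Processes", and Chen-Fukushima, "Symmetric Markov Processes, Time
   Change, and Boundary Theory". *)

Set Implicit Arguments.
Unset Strict Implicit.
Unset Printing Implicit Defensive.
Import Order.TTheory GRing.Theory Num.Theory.
Import numFieldNormedType.Exports.

Local Open Scope classical_set_scope.
Local Open Scope ring_scope.

(* Measurable types are pointed in the library, so the state space has to be
   inhabited. *)
#[short(type="pmetricType")]
HB.structure Definition PointedMetric (R : numDomainType) :=
  { M of Metric R M & isPointed M }.

Definition separable (T : topologicalType) :=
  exists2 D : set T, countable D & dense D.

Definition borel (T : topologicalType) := g_sigma_algebraType (@open T).

(* E_Delta: the cemetery Delta is [None]; it is isolated when E is compact. *)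
Notation opc := one_point_compactification.

Section StateSpace.
Context {R : realType} {E : pmetricType R}.
Implicit Types (mu : {measure set (borel E) -> \bar R}) (u v f : E -> R).

(* On a locally compact separable metric space a Borel measure that is finite
   on compact sets is automatically inner and outer regular. *)
Definition radon mu := forall K : set E, compact K -> (mu K < +oo)%E.

Definition full_support mu :=
  forall U : set E, open U -> U !=set0 -> (0 < mu U)%E.

Definition borel_fun f := measurable_fun [set: borel E] (f : borel E -> R).

Definition bounded_borel f := borel_fun f /\ exists c, forall x, `|f x| <= c.

Definition L2 mu u : Prop := (u : borel E -> R) \in Lfun mu 2%:E.

Definition inner mu u v : R := \int[mu]_x (u x * v x).

Definition suppf u : set E := closure [set x | u x != 0].

(* compact support, not merely vanishing at infinity *)
Definition C0 u := continuous u /\ compact (suppf u).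

End StateSpace.

(* Elements of L^2(E; m) are represented by Borel functions; compatibility
   with m-a.e. equality is part of [dirichlet_form]. *)
Record dform (R : realType) (E : pmetricType R) := DForm {
  dom : set (E -> R);
  energy : (E -> R) -> (E -> R) -> R }.

Section DirichletForms.
Context {R : realType} {E : pmetricType R}.
Variable m : {measure set (borel E) -> \bar R}.
Implicit Types (e : dform E) (u v w f g : E -> R) (c s t eps : R).

Record sym_form (D : set (E -> R)) (a : (E -> R) -> (E -> R) -> R) :
    Prop := {
  sf_zero : D (fun=> 0);
  sf_closed : forall c u v, D u -> D v -> D (fun x => c * u x + v x);
  sf_linear : forall c u v w, D u -> D v -> D w ->
    a (fun x => c * u x + v x) w = c * a u w + a v w;
  sf_sym : forall u v, D u -> D v -> a u v = a v u;
  sf_ge0 : forall u, D u -> 0 <= a u u }.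

Definition energy1 e u v : R := energy e u v + inner m u v.

Record dirichlet_form e : Prop := {
  df_L2 : forall u, dom e u -> L2 m u;
  df_ae : forall u v, dom e u -> L2 m v -> (u = v %[ae m]) ->
    dom e v /\ forall w, dom e w -> energy e u w = energy e v w;
  df_form : sym_form (dom e) (energy e);
  df_dense : forall f, L2 m f -> forall eps, 0 < eps ->
    exists2 u, dom e u & inner m (f \- u) (f \- u) < eps;
  df_closed : forall u_ : nat -> E -> R, (forall n, dom e (u_ n)) ->
    (forall eps, 0 < eps -> exists N, forall i j, (N <= i)%N -> (N <= j)%N ->
      energy1 e (u_ i \- u_ j) (u_ i \- u_ j) < eps) ->
    exists2 u, dom e u &
      energy1 e (u_ n \- u) (u_ n \- u) @[n --> \oo] --> (0 : R);
  df_markov : forall u, dom e u ->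
    let v := fun x => Num.min (Num.max (u x) 0) 1 in
    dom e v /\ energy e v v <= energy e u u }.

Definition regular_form e :=
  (forall u, dom e u -> forall eps, 0 < eps ->
    exists2 v, dom e v /\ C0 v & energy1 e (u \- v) (u \- v) < eps) /\
  (forall u, C0 u -> forall eps, 0 < eps ->
    exists2 v, dom e v /\ C0 v & forall x, `|u x - v x| < eps).

Definition capacity e (G : set E) : \bar R :=
  ereal_inf [set (energy1 e u u)%:E | u in
    [set u | dom e u /\ {ae m, forall x, G x -> 1 <= u x}]].

(* Quasi-continuity only involves the capacity of open sets, for which the
   formula above is the definition. *)
Definition quasi_continuous e u := forall eps : R, 0 < eps ->
  exists G : set E,
    [/\ open G, (capacity e G < eps%:E)%E & {within ~` G, continuous u}].

Definition qc_version e u u' :=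
  [/\ borel_fun u', quasi_continuous e u' & u = u' %[ae m]].

Definition strongly_local (D : set (E -> R)) (a : (E -> R) -> (E -> R) -> R) :=
  forall u v, D u -> D v ->
    (exists c (U : set E),
      [/\ open U, suppf u `<=` U & forall x, U x -> v x = c]) ->
    a u v = 0.

Definition jumping_measure
    (J : {measure set (borel E * borel E)%type -> \bar R}) :=
  [/\ forall A B : set (borel E), measurable A -> measurable B ->
        J (A `*` B) = J (B `*` A),
      J [set z | z.1 = z.2] = 0%E &
      forall K : set (E * E), compact K -> (forall z, K z -> z.1 <> z.2) ->
        (J K < +oo)%E].

(* k is the killing measure of the Beurling-Deny formula of e. Taking u = v
   shows that the J- and k-integrals converge absolutely. *)
Definition killing_measure e (k : {measure set (borel E) -> \bar R}) :=
  radon k /\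
  exists (ec : (E -> R) -> (E -> R) -> R)
         (J : {measure set (borel E * borel E)%type -> \bar R}),
    let core := [set u | dom e u /\ C0 u] in
    [/\ sym_form core ec, strongly_local core ec, jumping_measure J &
      forall u v, core u -> core v ->
        (energy e u v)%:E =
          ((ec u v)%:E
          + \int[J]_z ((u z.1 - u z.2) * (v z.1 - v z.2))%:E
          + \int[k]_x (u x * v x)%:E)%E].

(* The elements of F^res enter L^2(E; k) and the k-integral through their
   quasi-continuous versions, k being possibly singular with respect to m. *)
Record resurrected_form (k : {measure set (borel E) -> \bar R}) e er : Prop := {
  rf_dirichlet : dirichlet_form er;
  rf_regular : regular_form er;
  rf_dom : forall u, dom e u <->
    dom er u /\ exists2 u', qc_version er u u' & L2 k u';
  rf_core : forall u, dom er u /\ C0 u <-> dom e u /\ C0 u;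
  rf_energy : forall u v u' v', dom e u -> dom e v ->
    qc_version er u u' -> qc_version er v v' ->
    energy e u v = energy er u v + inner k u' v' }.

Record L2_semigroup (T : R -> (E -> R) -> E -> R) : Prop := {
  sg_L2 : forall t f, 0 < t -> L2 m f -> L2 m (T t f);
  sg_ae : forall t f g, 0 < t -> L2 m f -> L2 m g -> (f = g %[ae m]) ->
    T t f = T t g %[ae m];
  sg_linear : forall t c f g, 0 < t -> L2 m f -> L2 m g ->
    T t (fun x => c * f x + g x) = (fun x => c * T t f x + T t g x) %[ae m];
  sg_sym : forall t f g, 0 < t -> L2 m f -> L2 m g ->
    inner m (T t f) g = inner m f (T t g);
  sg_contraction : forall t f, 0 < t -> L2 m f ->
    inner m (T t f) (T t f) <= inner m f f;
  sg_add : forall s t f, 0 < s -> 0 < t -> L2 m f ->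
    T (s + t) f = T s (T t f) %[ae m];
  sg_cont : forall f, L2 m f ->
    inner m (T t f \- f) (T t f \- f) @[t --> 0^'+] --> (0 : R) }.

(* e is the form of T: F consists of the u in L^2 for which
   t^-1 (u - T_t u, u) has a finite limit as t -> 0+, and
   E(u, v) = lim t^-1 (u - T_t u, v) on F. *)
Definition form_of_semigroup (T : R -> (E -> R) -> E -> R) e :=
  (forall u, dom e u <-> L2 m u /\
    exists l : R, t^-1 * inner m (u \- T t u) u @[t --> 0^'+] --> l) /\
  (forall u v, dom e u -> dom e v ->
    t^-1 * inner m (u \- T t u) v @[t --> 0^'+] --> energy e u v).

End DirichletForms.

(* Time is [0, +oo[: only the values of [traj] and [time_shift] at t >= 0
   matter. *)
Record process (R : realType) (E : pmetricType R) := Process {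
  odisp : measure_display;
  Omega : measurableType odisp;
  traj : R -> Omega -> opc E;
  time_shift : R -> Omega -> Omega;
  Pr : opc E -> probability Omega R }.
Arguments traj {R E} p.
Arguments time_shift {R E} p.
Arguments Pr {R E} p.

Section Processes.
Context {R : realType} {E : pmetricType R}.
Variable M : process E.
Local Notation Om := (Omega M).
Local Notation X := (traj M).
Local Notation P := (Pr M).
Local Notation theta := (time_shift M).
Implicit Types (s t r : R) (w : Om) (sigma : Om -> \bar R).

Definition zeta w : \bar R :=
  ereal_inf [set t%:E | t in [set t | 0 <= t /\ X t w = None]].

(* F^0_t for t finite, F^0_infty for t = +oo *)
Definition natural_filtration (t : \bar R) : set (set Om) :=
  <<s [set A | exists s (B : set (borel (opc E))),
    [/\ 0 <= s, (s%:E <= t)%E, measurable B & A = X s @^-1` B]] >>.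

(* Minimum completed admissible filtration: F_t is the intersection over all
   initial laws mu of the P_mu-completions, in the P_mu-completion of
   F^0_infty, of F^0_t. *)
Definition filtration (t : \bar R) : set (set Om) :=
  [set A | forall mu : probability (borel (opc E)) R,
    exists A' N, [/\ natural_filtration t A', natural_filtration +oo%E N,
      (A `\` A') `|` (A' `\` A) `<=` N & (\int[mu]_x P x N = 0)%E]].

Definition stopping_time sigma :=
  (forall w, 0 <= sigma w)%E /\
  forall t, 0 <= t -> filtration t%:E [set w | (sigma w <= t%:E)%E].

Definition filtration_at sigma : set (set Om) :=
  [set A | filtration +oo%E A /\
    forall t, 0 <= t -> filtration t%:E (A `&` [set w | (sigma w <= t%:E)%E])].

(* X_sigma, with X_infty = Delta *)
Definition path_at sigma w : opc E :=
  if sigma w is t%:E then X t w else None.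

Record hunt : Prop := {
  (* The underlying sigma-field contains F_infty, which is always possible
     since the P_x extend uniquely to it. *)
  hunt_measurable : filtration +oo%E `<=` measurable;
  hunt_path_measurable : forall t, 0 <= t ->
    measurable_fun setT (X t : Om -> borel (opc E));
  hunt_Pr_measurable : forall t (B : set (borel (opc E))), 0 <= t ->
    measurable B ->
    measurable_fun [set: borel E]
      (fun x : borel E => P (Some x) (X t @^-1` B));
  hunt_normal : forall x : opc E, P x [set w | X 0 w = x] = 1%E;
  hunt_cemetery : forall w t, 0 <= t -> (zeta w <= t%:E)%E -> X t w = None;
  hunt_shift : forall s t w, 0 <= s -> 0 <= t ->
    X s (theta t w) = X (s + t) w;
  hunt_right_cont : forall w t, 0 <= t -> X s w @[s --> t^'+] --> X t w;
  hunt_left_lim : forall w t, 0 < t ->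
    exists l : opc E, X s w @[s --> t^'-] --> l;
  hunt_filtration_right_cont : forall t, 0 <= t ->
    \bigcap_(s in [set s | t < s]) filtration s%:E `<=` filtration t%:E;
  hunt_strong_markov : forall sigma, stopping_time sigma ->
    forall (x : opc E) s (B : set (borel (opc E))) (A : set Om), 0 <= s ->
    measurable B -> filtration_at sigma A ->
    P x (A `&` [set w | B (path_at (fun w => sigma w + s%:E)%E w)]) =
    (\int[P x]_(w in A) P (path_at sigma w) (X s @^-1` B))%E;
  hunt_quasi_left_cont : forall (sigma_ : nat -> Om -> \bar R) sigma,
    (forall n, stopping_time (sigma_ n)) ->
    (forall n w, sigma_ n w <= sigma_ n.+1 w)%E ->
    (forall w, sigma w = ereal_sup (range (sigma_ ^~ w))) ->
    forall x : opc E, {ae P x, forall w, (sigma w < +oo)%E ->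
      path_at (sigma_ n) w @[n --> \oo] --> path_at sigma w} }.

(* Functions on E are extended by 0 at Delta. *)
Definition ext0 (f : E -> R) (y : opc E) : R := if y is Some x then f x else 0.
Definition eext0 (f : E -> \bar R) (y : opc E) : \bar R :=
  if y is Some x then f x else 0%E.

(* p_t f(x) = E_x(f(X_t); t < zeta) *)
Definition transition (t : R) (f : E -> R) (x : E) : R :=
  \int[P (Some x)]_(w in [set w | (t%:E < zeta w)%E]) ext0 f (X t w).

(* only meant for nonnegative f *)
Definition etransition (t : R) (f : E -> \bar R) (x : E) : \bar R :=
  (\int[P (Some x)]_(w in [set w | (t%:E < zeta w)%E]) eext0 f (X t w))%E.

Definition associated (m : {measure set (borel E) -> \bar R}) (e : dform E) :=
  L2_semigroup m transition /\ form_of_semigroup m transition e.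

Definition irreducible (m : {measure set (borel E) -> \bar R}) :=
  forall A : set (borel E), measurable A ->
    (forall t f, 0 < t -> bounded_borel f -> L2 m f ->
      transition t (fun x => \1_A x * f x) = (fun x => \1_A x * transition t f x)
        %[ae m]) ->
    m A = 0%E \/ m (~` A) = 0%E.

Definition strong_feller := forall t f, 0 < t -> bounded_borel f ->
  continuous (transition t f) /\ exists c, forall x, `|transition t f x| <= c.

(* A PCAF in the strict sense, i.e. without exceptional set. *)
Record pcaf (A : R -> Om -> \bar R) : Prop := {
  pcaf_adapted : forall t (B : set (\bar R)), 0 <= t -> measurable B ->
    filtration t%:E (A t @^-1` B);
  pcaf_defining_set : exists Lam : set Om,
    [/\ filtration +oo%E Lam,
        forall x : E, P (Some x) Lam = 1%E,
        forall t w, 0 <= t -> Lam w -> Lam (theta t w) &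
        forall w, Lam w ->
          [/\ A 0 w = 0%E /\ (forall t, 0 <= t -> (0 <= A t w)%E),
              forall t, 0 <= t -> (t%:E < zeta w)%E -> (A t w < +oo)%E,
              {within `[0, +oo[, continuous (A ^~ w)},
              forall t z, zeta w = z%:E -> z <= t -> A t w = A z w &
              forall s t, 0 <= s -> 0 <= t ->
                A (t + s) w = (A s w + A t (theta s w))%E]] }.

(* The measure dF of a nondecreasing right-continuous F; junk value 0
   otherwise. *)
Definition stieltjes (F : R -> R) :
    {measure set (measurableTypeR R) -> \bar R} :=
  if pselect ({homo F : x y / x <= y} /\ right_continuous F) is left h
  then lebesgue_stieltjes_measure
    (HB.pack_for (cumulative R R) F (isCumulative.Build R _ R F h.1 h.2))
  else mzero.

Definition stopped (a : R -> \bar R) (r s : R) : R :=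
  fine (a (Num.min (Num.max s 0) r)).

(* The integral of g >= 0 against da over ]0, t] `&` [0, z[, for a path a that
   is nondecreasing, continuous and finite on [0, z[ (a may tend to +oo at z);
   below, z is the lifetime. The measure da is that of a stopped at r < z. *)
Definition path_integral (a : R -> \bar R) (z : \bar R) (g : R -> \bar R)
    (t : R) : \bar R :=
  maxe 0%E (ereal_sup
    [set (\int[stieltjes (stopped a r)]_(s in `]0%R, r]) g s)%E
      | r in [set r | [/\ 0 <= r, r <= t & (r%:E < z)%E]]]).

Definition excessive (gamma : R) (h : E -> \bar R) :=
  [/\ measurable_fun [set: borel E] (h : borel E -> \bar R),
      (forall x, 0 <= h x)%E,
      forall (x : E) s t, 0 < s -> s <= t ->
        ((expR (- (gamma * t)))%:E * etransition t h x <=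
         (expR (- (gamma * s)))%:E * etransition s h x)%E &
      forall x, ((expR (- (gamma * t)))%:E * etransition t h x)%E @[t --> 0^'+]
        --> h x].

(* Revuz correspondence: for f >= 0 Borel and h gamma-excessive (gamma >= 0),
   lim_(t -> 0+) t^-1 E_(h m)[\int_0^t f(X_s) dA_s] = \int f h dk *)
Definition revuz (m k : {measure set (borel E) -> \bar R})
    (A : R -> Om -> \bar R) :=
  forall (gamma : R) (f h : E -> \bar R), 0 <= gamma ->
    measurable_fun [set: borel E] (f : borel E -> \bar R) ->
    (forall x, 0 <= f x)%E -> excessive gamma h ->
    ((t^-1)%:E * \int[m]_x (h x *
        \int[P (Some x)]_w
          path_integral (A ^~ w) (zeta w) (fun s => eext0 f (X s w)) t))%E
      @[t --> 0^'+] --> (\int[k]_x (f x * h x))%E.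

(* Here M is the resurrected process and A its functional A^k. *)
Definition stoch_complete_at_infinity (A : R -> Om -> \bar R) :=
  forall (x : E) t, 0 < t ->
    (1 = \int[P (Some x)]_(w in [set w | (t%:E < zeta w)%E]) expeR (- A t w)
       + \int[P (Some x)]_w
           path_integral (A ^~ w) (zeta w) (fun s => expeR (- A s w)) t)%E.

Definition exhaustion (K : nat -> set E) :=
  [/\ forall n, compact (K n), forall n, K n `<=` interior (K n.+1) &
      \bigcup_n K n = setT].

Definition exit_time (K : set E) w : \bar R :=
  ereal_inf [set t%:E | t in [set t | 0 < t /\ ~ (Some @` K) (X t w)]].

Definition Omega_p (K : nat -> set E) : set Om :=
  \bigcap_n [set w | exit_time (K n) w < zeta w /\ zeta w < +oo]%E.

Definition zeta_p (K : nat -> set E) w : \bar R :=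
  if pselect (Omega_p K w) then zeta w else +oo%E.

End Processes.

(* M is the subprocess of Mr by exp(-A): a process with transition function
   E^res_x(exp(-A_t) f(X_t); t < zeta), which determines its law. *)
Definition subprocess (R : realType) (E : pmetricType R) (M Mr : process E)
    (A : R -> Omega Mr -> \bar R) :=
  forall t f (x : E), 0 < t -> bounded_borel f ->
    transition M t f x =
    \int[Pr Mr (Some x)]_(w in [set w | (t%:E < zeta w)%E])
      (fine (expeR (- A t w)%E) * ext0 f (traj Mr t w)).

(* Main.v *)
Require Import Defs.
From mathcomp Require Import all_boot all_order all_algebra.
From mathcomp Require Import all_classical all_reals all_analysis measurable_realfun.
From mathcomp Require Import ring lra.
Set Implicit Arguments.
Unset Strict Implicit.
Unset Printing Implicit Defensive.
Import Order.TTheory GRing.Theory Num.Theory.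
Import numFieldNormedType.Exports.
Local Open Scope classical_set_scope.
Local Open Scope ring_scope.

(* The sums sum_i phi(X_{t_i}) (1_{t_i < zeta} - 1_{t_{i+1} < zeta}) over finer
   and finer subdivisions of [0, t] converge in mean to
   E_z(phi(X_{zeta-}); zeta <= t).  By the Markov property the subprocess
   relation also determines the two-time marginals of X, and expresses the mean
   of such a sum under X^res with 1_{t_i < zeta} replaced by
   exp(- A_{t_i}) 1_{t_i < zeta}.  X^res is not killed inside E: the energy of
   phi against cutoffs psi_n increasing to 1 tends to 0, because its form has no
   killing part, and this gives E_x(phi(X_{zeta-}); zeta <= t) = 0 for m-almost
   every x, hence for every x by the absolute continuity that (SF) entails.
   With phi increasing to 1, the mass P_z(X_{zeta-} in E, zeta <= t) is therefore
   E^res_z int_0^{zeta /\ t} exp(- A_s) dA_s, and (SCI) says exactly that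
   P_z(X_{zeta-} = Delta, zeta < oo) = 0.  By quasi-left-continuity the event
   {X_{zeta-} = Delta, zeta < oo} coincides with Omega^p up to a null set. *)

(** * Expectations of bounded functions *)

(** [X] and [Xres] live on different probability spaces and are linked only by their transition
    functions, so the killed mass cannot be computed path by path. The sums are chosen because the
    mean of each term involves two times only. On the side of [Xres] they are then bracketed
    pathwise. Over an interval that the path survives, the decrement of exp(- A) 1_{. < zeta} is one
    of exp(- A), and these telescope to at most the integral of exp(- A) dA. The one interval in
    which the path dies contributes at most the same term with exp(- A) replaced by 1; its mean
    vanishes in the limit because [Xres] is not killed inside E. From below, phi = 1 on [K n] lets
    the sum telescope until the path leaves [K n]. The energy of phi against a cutoff equal to 1
    near the support of phi has no local part, by strong locality; its jump part tends to 0 by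
    dominated convergence. A second obstacle is that A is adapted only to the completed filtration:
    the Markov property, given for single-time events, is extended to F^0_infty, then to functionals
    measurable for the completion. *)

Section Expectation.
Context d (T : measurableType d) (R : realType) (P : probability T R).
Implicit Types (f g : T -> R) (B : set T).

Definition bounded_mfun f :=
  measurable_fun setT f /\ exists c, forall x, `|f x| <= c.

Lemma bounded_mfun_integrable f B : measurable B -> bounded_mfun f ->
  P.-integrable B (EFin \o f).
Proof.
move=> mB [mf [c fc]]; apply: (@measurable_bounded_integrable _ _ _ P) => //.
- by rewrite (le_lt_trans (probability_le1 P mB)) // ltry.
- exact: measurable_funS mf.
- exists c; split => [|M cM x _]; first exact: num_real.
  exact: le_trans (fc x) (ltW cM).
Qed.

Lemma bounded_mfun_cst c : bounded_mfun (fun=> c).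
Proof. by split; [exact: measurable_cst | exists `|c|]. Qed.

Lemma bounded_mfunD f g : bounded_mfun f -> bounded_mfun g ->
  bounded_mfun (fun x => f x + g x).
Proof.
move=> [mf [a fa]] [mg [b gb]]; split; first exact: measurable_funD.
by exists (a + b) => x; rewrite (le_trans (ler_normD _ _)) // lerD.
Qed.

Lemma bounded_mfunM f g : bounded_mfun f -> bounded_mfun g ->
  bounded_mfun (fun x => f x * g x).
Proof.
move=> [mf [a fa]] [mg [b gb]]; split; first exact: measurable_funM.
by exists (a * b) => x; rewrite normrM ler_pM.
Qed.

Lemma bounded_mfunB f g : bounded_mfun f -> bounded_mfun g ->
  bounded_mfun (fun x => f x - g x).
Proof.
move=> [mf [a fa]] [mg [b gb]]; split; first exact: measurable_funB.
by exists (a + b) => x; rewrite (le_trans (ler_normB _ _)) // lerD.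
Qed.

Lemma bounded_mfun_sum (F : nat -> T -> R) n :
  (forall i, bounded_mfun (F i)) -> bounded_mfun (fun x => \sum_(i < n) F i x).
Proof.
move=> bF; elim: n => [|n IH].
  by under eq_fun do rewrite big_ord0; exact: bounded_mfun_cst.
by under eq_fun do rewrite big_ord_recr; exact: bounded_mfunD.
Qed.

Lemma bounded_mfun_indic B : measurable B -> bounded_mfun (\1_B : T -> R).
Proof.
move=> mB; split; first exact: measurable_indic.
by exists 1 => x; rewrite indicE; case: (_ \in _); rewrite ?normr1 ?normr0.
Qed.

Lemma Rintegral_sum (F : nat -> T -> R) n B : measurable B ->
  (forall i, bounded_mfun (F i)) ->
  \int[P]_(x in B) (\sum_(i < n) F i x) = \sum_(i < n) \int[P]_(x in B) F i x.
Proof.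
move=> mB bF; elim: n => [|n IH].
  by under eq_Rintegral do rewrite big_ord0; rewrite big_ord0 Rintegral_cst // mul0r.
under eq_Rintegral do rewrite big_ord_recr /=.
rewrite RintegralD //; first by rewrite big_ord_recr /= IH.
- exact/bounded_mfun_integrable/bounded_mfun_sum.
- exact: bounded_mfun_integrable.
Qed.

Lemma ae_eq_Rintegral f g B : measurable B ->
  measurable_fun B f -> measurable_fun B g ->
  {ae P, forall x, B x -> f x = g x} ->
  \int[P]_(x in B) f x = \int[P]_(x in B) g x.
Proof.
move=> mB mf mg fg; congr fine; apply: ae_eq_integral => //.
- exact/measurable_EFinP.
- exact/measurable_EFinP.
- by apply: filterS fg => x h /h ->.
Qed.

Lemma Rintegral_dist_le f g B c : measurable B ->
  bounded_mfun f -> bounded_mfun g -> 0 <= c ->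
  {ae P, forall x, B x -> `|f x - g x| <= c} ->
  `|\int[P]_(x in B) f x - \int[P]_(x in B) g x| <= c.
Proof.
move=> mB bf bg c0 fgc.
have bh := bounded_mfunB bf bg.
rewrite -RintegralB //; [|exact: bounded_mfun_integrable..].
rewrite (le_trans (le_normr_Rintegral _ _)) //; first exact: bounded_mfun_integrable.
rewrite -lee_fin /Rintegral fineK; last first.
  apply: integrable_fin_num => //.
  exact: (integrable_norm (bounded_mfun_integrable mB bh)).
apply: (@le_trans _ _ (\int[P]_(x in B) (cst c%:E x))%E).
  apply: ae_ge0_le_integral => //.
    apply/measurable_EFinP/measurableT_comp => //.
    by case: bh => mh _; apply: measurable_funS mh.
rewrite integral_cst // -[leRHS]mule1 lee_pmul //.
exact: probability_le1.
Qed.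

Lemma ler_Rintegral_ae f g : bounded_mfun f -> bounded_mfun g ->
  {ae P, forall x, f x <= g x} -> \int[P]_x f x <= \int[P]_x g x.
Proof.
move=> bf bg fg.
(* The comparison of integrals asks for an inequality at every point; min(f, g) lies below g
   everywhere and equals f almost everywhere. *)
have bm : bounded_mfun (fun x => Num.min (f x) (g x)).
  case: bf => mf [a fa]; case: bg => mg [b gb]; split; first exact: measurable_minr.
  exists (a + b) => x; have [_|_] := leP (f x) (g x).
    by rewrite (le_trans (fa x)) // lerDl (le_trans _ (gb x)).
  by rewrite (le_trans (gb x)) // lerDr (le_trans _ (fa x)).
rewrite (@ae_eq_Rintegral f (fun x => Num.min (f x) (g x))) //.
- apply: le_Rintegral => //; [exact: bounded_mfun_integrable..|].
  by move=> x _; rewrite ge_min lexx orbT.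
- by case: bf.
- by case: bm.
- by apply: filterS fg => x h _; rewrite min_l.
Qed.

Lemma cvg_Rintegral_bounded (F : nat -> T -> R) f c :
  (forall n, measurable_fun setT (F n)) -> measurable_fun setT f ->
  (forall n x, `|F n x| <= c) ->
  {ae P, forall x, F n x @[n --> \oo] --> f x} ->
  \int[P]_x F n x @[n --> \oo] --> \int[P]_x f x.
Proof.
move=> mF mf Fc Ff.
have [|||||fi _ h] := @dominated_convergence _ _ _ P setT measurableT
   (fun n x => (F n x)%:E) (EFin \o f) (cst c%:E).
- by move=> n; exact/measurable_EFinP.
- exact/measurable_EFinP.
- by apply: filterS Ff => x h _; apply: cvg_EFin => //; apply: nearW.
- by apply: bounded_mfun_integrable => //; exact: bounded_mfun_cst.
- by apply: aeW => x n _ /=; rewrite lee_fin.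
rewrite /Rintegral; apply: fine_cvg.
rewrite fineK; last exact: integrable_fin_num.
exact: h.
Qed.

Lemma Rintegral_indic B A : measurable B -> measurable A ->
  \int[P]_(x in B) (\1_A x : R) = fine (P (A `&` B)).
Proof. by move=> mB mA; rewrite /Rintegral integral_indic. Qed.

Lemma Rintegral_probability1 c : \int[P]_x c = c.
Proof. by rewrite Rintegral_cst //= [X in fine X]probability_setT mulr1. Qed.

Lemma probability1_ae (A : set T) : measurable A -> P A = 1%E ->
  {ae P, forall x, A x}.
Proof.
move=> mA A1; exists (~` A); split; [exact: measurableC| |by []].
by rewrite probability_setC // A1 subee.
Qed.

Lemma Rintegral_eq0_ae f : bounded_mfun f -> (forall x, 0 <= f x) ->
  \int[P]_x f x = 0 -> {ae P, forall x, f x = 0}.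
Proof.
move=> bf f0 I0; have mf : measurable_fun setT f by case: bf.
have fin := integrable_fin_num measurableT (bounded_mfun_integrable measurableT bf).
have /ae_eq_integral_abs : measurable_fun setT (EFin \o f) by exact/measurable_EFinP.
move=> /(_ P measurableT) [h _]; have : (\int[P]_x `|(EFin \o f) x| = 0)%E.
  rewrite -[RHS]/(0%:E) -I0 /Rintegral fineK //.
  by apply: eq_integral => x _; rewrite gee0_abs // lee_fin.
by move=> /h; apply: filterS => x /(_ I) [].
Qed.

End Expectation.

(** * Layer-cake approximation of functions with values in [0, 1] *)

Section Layer.
Context {R : realType}.

(** The levels start at 1/(n+1) and not at 0, so that only superlevel sets of positive height occur;
    for functions vanishing at the cemetery these contain surviving paths only. [layer n F] is a
    Riemann sum of F over [0, 1]. *)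
Definition level n k : R := k.+1%:R / n.+1%:R.

Definition layer n (F : R -> R) : R := n.+1%:R^-1 * \sum_(k < n.+1) F (level n k).

Lemma level_gt0 n k : 0 < level n k.
Proof. by rewrite divr_gt0 // ltr0n. Qed.

(** The sum counts the integers 1, ..., n that are at most y: it is the integer part of y. *)
Lemma count_le_nat n (y : R) : 0 <= y <= n%:R ->
  \sum_(k < n) (k.+1%:R <= y)%R%:R <= y <= \sum_(k < n) (k.+1%:R <= y)%R%:R + 1.
Proof.
elim: n y => [|n IH] y /andP[y0 yn].
  by rewrite big_ord0 add0r y0 /= (le_trans yn).
rewrite big_ord_recr /=; have [yn'|yn'] := leP y n%:R.
  have := IH y; rewrite y0 yn' => /(_ isT).
  have [ny|_] := leP n.+1%:R y; last by rewrite addr0.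
  by move: (le_trans ny yn'); rewrite ler_nat ltnn.
have -> : \sum_(i < n) (i.+1%:R <= y)%R%:R = n%:R :> R.
  rewrite (eq_bigr (fun=> 1)) ?sumr_const ?card_ord // => i _.
  by rewrite (le_trans _ (ltW yn')) // ler_nat.
have [ny|ny] := leP n.+1%:R y; rewrite /= -?(natrD R n 1) ?addn1 ?addr0.
  by rewrite ny (le_trans yn) // lerDl.
by rewrite (ltW yn') -(natrD R n 1) addn1.
Qed.

Lemma layer_bound n (y : R) : 0 <= y <= 1 ->
  `|y - layer n (fun c => (c <= y)%R%:R)| <= n.+1%:R^-1.
Proof.
move=> /andP[y0 y1];
have ny : 0 <= n.+1%:R * y <= n.+1%:R.
  by apply/andP; split; [rewrite mulr_ge0 | rewrite ler_piMr].
have /andP[l u] := count_le_nat ny.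
rewrite /layer; under eq_bigr do rewrite /level ler_pdivrMr // mulrC.
set S := \sum_(i < _) _ in l u *.
have -> : y - n.+1%:R^-1 * S = n.+1%:R^-1 * (n.+1%:R * y - S).
  by rewrite mulrBr mulrA mulVf ?mul1r // gt_eqF.
rewrite normrM gtr0_norm ?invr_gt0 //.
apply: ler_piMr; first by rewrite invr_ge0 ltW.
by rewrite ler_norml; apply/andP; split; lra.
Qed.

Lemma le_of_invS (a b : R) : 0 <= b -> (forall n : nat, a <= b * n.+1%:R^-1) -> a <= 0.
Proof.
move=> b0 h; apply/ler_addgt0Pl => e e0; rewrite addr0.
have hn := archi_boundP (divr_ge0 b0 (ltW e0)).
apply: le_trans (h (Num.bound (b / e))) _.
by rewrite ler_pdivrMr ?ltr0n // mulrC -ler_pdivrMr // (le_trans (ltW hn)) // ler_nat.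
Qed.

Context d (T : measurableType d) (P : probability T R).
Implicit Types (f g W h Y U V : T -> R) (B : set T).

Lemma measurable_superlevel f c : measurable_fun setT f -> measurable [set w | c <= f w].
Proof.
move=> mf; rewrite -[X in measurable X]setTI.
rewrite (_ : [set _ | _] = f @^-1` `[c, +oo[); first exact: mf.
by apply/seteqP; split => w /=; rewrite in_itv /= andbT.
Qed.

Lemma layer_superlevelE f w n :
  layer n (fun c => (c <= f w)%R%:R) = layer n (fun c => \1_[set w | c <= f w] w).
Proof.
congr (_ * _); apply: eq_bigr => k _; rewrite indicE; congr (nat_of_bool _)%:R.
by apply/idP/idP => [h|/set_mem //]; exact/mem_set.
Qed.

Lemma bounded_mfun_layer (F : R -> T -> R) n :
  (forall c, 0 < c -> bounded_mfun (F c)) -> bounded_mfun (fun w => layer n (F^~ w)).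
Proof.
move=> bF; apply: bounded_mfunM; first exact: bounded_mfun_cst.
by apply: (@bounded_mfun_sum _ _ _ (fun k w => F (level n k) w)) => k; exact/bF/level_gt0.
Qed.

Lemma Rintegral_layer (F : R -> T -> R) n B : measurable B ->
  (forall c, 0 < c -> bounded_mfun (F c)) ->
  \int[P]_(w in B) layer n (F^~ w) = layer n (fun c => \int[P]_(w in B) F c w).
Proof.
move=> mB bF; rewrite RintegralZl //.
  congr (_ * _).
  by rewrite (@Rintegral_sum _ _ _ _ (fun k w => F (level n k) w)) // => k; exact/bF/level_gt0.
apply: bounded_mfun_integrable => //.
by apply: (@bounded_mfun_sum _ _ _ (fun k w => F (level n k) w)) => k; exact/bF/level_gt0.
Qed.

(* A [0, 1]-valued function is a uniform limit of averages of indicators of its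
   superlevel sets, so its integral is determined by their measures. *)
Lemma Rintegral_eq_layer B W h (g : R -> T -> R) :
  measurable B -> measurable_fun setT W -> (forall w, 0 <= W w <= 1) ->
  bounded_mfun h -> (forall c, 0 < c -> bounded_mfun (g c)) ->
  (forall c, 0 < c -> \int[P]_(w in B) g c w = fine (P (B `&` [set w | c <= W w]))) ->
  (forall n, {ae P, forall w, B w -> `|h w - layer n (g^~ w)| <= n.+1%:R^-1}) ->
  \int[P]_(w in B) W w = \int[P]_(w in B) h w.
Proof.
move=> mB mW W01 bh bg gB hg.
have bW : bounded_mfun W.
  by split => //; exists 1 => w; case/andP: (W01 w) => a b; rewrite ger0_norm.
apply/eqP; rewrite -subr_eq0 -normr_le0.
apply: (@le_of_invS _ 2) => // n; rewrite mulr_natl mulr2n.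
have -> : \int[P]_(w in B) W w - \int[P]_(w in B) h w =
  (\int[P]_(w in B) W w - layer n (fun c => \int[P]_(w in B) g c w)) -
  (\int[P]_(w in B) h w - \int[P]_(w in B) layer n (g^~ w)).
  by rewrite Rintegral_layer //; lra.
have b1 c : bounded_mfun (\1_[set w | c <= W w] : T -> R).
  exact/bounded_mfun_indic/measurable_superlevel.
rewrite (le_trans (ler_normB _ _)) // lerD //.
  have -> : layer n (fun c => \int[P]_(w in B) g c w) =
      \int[P]_(w in B) layer n (fun c => \1_[set w | c <= W w] w).
    rewrite Rintegral_layer //; congr (_ * _); apply: eq_bigr => k _.
    rewrite gB; last exact: level_gt0.
    by rewrite Rintegral_indic; [rewrite setIC | exact: mB | exact: measurable_superlevel].
  apply: Rintegral_dist_le => //; first exact: bounded_mfun_layer.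
  by apply: aeW => w _; rewrite -layer_superlevelE layer_bound.
apply: Rintegral_dist_le => //; exact: bounded_mfun_layer.
Qed.

(** The weight Y is a uniform limit of averages of the indicators of its superlevel sets. This turns
    an identity on events of the past into one against weights determined by the past, such as
    phi(X_s) or exp(- A_s). *)
Lemma Rintegral_weight_eq Y U V :
  measurable_fun setT Y -> (forall w, 0 <= Y w <= 1) ->
  measurable_fun setT U -> (forall w, 0 <= U w <= 1) ->
  measurable_fun setT V -> (forall w, 0 <= V w <= 1) ->
  (forall c, 0 < c -> \int[P]_(w in [set w | c <= Y w]) U w =
                      \int[P]_(w in [set w | c <= Y w]) V w) ->
  \int[P]_w (Y w * U w) = \int[P]_w (Y w * V w).
Proof.
move=> mY Y01 mU U01 mV V01 UV.
have b01 f : measurable_fun setT f -> (forall w, 0 <= f w <= 1) -> bounded_mfun f.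
  by move=> mf f01; split => //; exists 1 => w; case/andP: (f01 w) => a b; rewrite ger0_norm.
have bY := b01 Y mY Y01; have bU := b01 U mU U01; have bV := b01 V mV V01.
have b1 c : bounded_mfun (\1_[set w | c <= Y w] : T -> R).
  exact/bounded_mfun_indic/measurable_superlevel.
have key f n : bounded_mfun f -> (forall w, 0 <= f w <= 1) ->
   `|\int[P]_w (Y w * f w) -
     layer n (fun c => \int[P]_(w in [set w | c <= Y w]) f w)| <= n.+1%:R^-1.
  move=> bf f01.
  have -> : layer n (fun c => \int[P]_(w in [set w | c <= Y w]) f w) =
      \int[P]_w layer n (fun c => \1_[set w | c <= Y w] w * f w).
    rewrite Rintegral_layer //; last by move=> c _; exact: bounded_mfunM.
    congr (_ * _); apply: eq_bigr => k _.
    rewrite Rintegral_mkcond; apply: eq_Rintegral => w _.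
    by rewrite patchE indicE; case: (_ \in _); rewrite ?mul1r ?mul0r.
  apply: Rintegral_dist_le => //; first exact: bounded_mfunM.
    by apply: bounded_mfun_layer => c _; exact: bounded_mfunM.
  apply: aeW => w _.
  have -> : layer n (fun c => \1_[set w | c <= Y w] w * f w) =
      layer n (fun c => (c <= Y w)%R%:R) * f w.
    by rewrite layer_superlevelE /layer -mulrA mulr_suml.
  rewrite -mulrBl normrM; case/andP: (f01 w) => f0 f1.
  by rewrite -[leRHS]mulr1 ler_pM // ?layer_bound // ger0_norm.
apply/eqP; rewrite -subr_eq0 -normr_le0.
apply: (@le_of_invS _ 2) => // n; rewrite mulr_natl mulr2n.
rewrite (_ : _ - _ = (\int[P]_w (Y w * U w) -
     layer n (fun c => \int[P]_(w in [set w | c <= Y w]) U w)) -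
     (\int[P]_w (Y w * V w) -
     layer n (fun c => \int[P]_(w in [set w | c <= Y w]) V w))).
  by rewrite (le_trans (ler_normB _ _)) // lerD // key.
have -> : layer n (fun c => \int[P]_(w in [set w | c <= Y w]) U w) =
          layer n (fun c => \int[P]_(w in [set w | c <= Y w]) V w).
  by congr (_ * _); apply: eq_bigr => k _; rewrite UV //; exact: level_gt0.
by lra.
Qed.

End Layer.

(** * The Markov property *)

Section Cemetery.
Context {R : realType} {E : pmetricType R}.

Lemma measurable_image_Some (B : set (borel E)) :
  measurable B -> measurable (Some @` B : set (borel (opc E))).
Proof.
pose H := [set B : set E | (@measurable _ (borel (opc E))) (Some @` B)].
suff : <<s @open E >> `<=` H by move=> h /h.
apply: smallest_sub; last first.
  move=> U oU; apply: sub_sigma_algebra.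
  exact: one_point_compactification_open_some.
split.
- by rewrite /H /= image_set0; exact: measurable0.
- move=> A; rewrite /H /= => mA.
  have mT : (@measurable _ (borel (opc E))) (Some @` [set: E]).
    apply: sub_sigma_algebra; apply: one_point_compactification_open_some; exact: openT.
  rewrite (_ : Some @` _ = Some @` [set: E] `\` Some @` A); first exact: measurableD.
  apply/seteqP; split => [_ [x [_ Ax]] <-|_ [[x _] <-] /= nA].
    by split; [exists x | move=> [y Ay [yx]]; apply: Ax; rewrite -yx].
  by exists x => //; split => // Ax; apply: nA; exists x.
- by move=> F mF; rewrite /H /= image_bigcup; exact: bigcupT_measurable.
Qed.

Lemma measurable_None : measurable ([set None] : set (borel (opc E))).
Proof.
rewrite (_ : [set None] = ~` (Some @` [set: E])).
  by apply: measurableC; exact: measurable_image_Some.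
apply/seteqP; split => [_ -> [] //|[x|//] h]; by case: h; exists x.
Qed.

(** The cemetery is a Borel point and images of Borel sets of E are Borel, so the value at the
    cemetery is irrelevant. This matters because [hunt_Pr_measurable] only speaks of starting points
    in E. *)
Lemma measurable_fun_opc d' (T : measurableType d') (f : opc E -> T) :
  measurable_fun [set: borel E] (f \o Some : borel E -> T) ->
  measurable_fun [set: borel (opc E)] (f : borel (opc E) -> T).
Proof.
move=> mf _ Y mY; rewrite setTI.
have mfY : measurable ((f \o Some : borel E -> T) @^-1` Y).
  by rewrite -[X in measurable X]setTI; exact: mf.
have [fN|fN] := pselect (Y (f None)).
  rewrite (_ : _ @^-1` _ = Some @` ((f \o Some) @^-1` Y) `|` [set None]).
    by apply: measurableU; [exact: measurable_image_Some | exact: measurable_None].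
  apply/seteqP; split => [[x fx|_]|y [[x fx <-]|->]] //; last by right.
  by left; exists x.
rewrite (_ : _ @^-1` _ = Some @` ((f \o Some) @^-1` Y)).
  exact: measurable_image_Some.
by apply/seteqP; split => [[x fx|//]|y [x fx <-]] //; exists x.
Qed.

Lemma measurable_ext0 (f : E -> R) : borel_fun f ->
  measurable_fun [set: borel (opc E)] (ext0 f : borel (opc E) -> R).
Proof. exact: measurable_fun_opc. Qed.

End Cemetery.

Section Process.
Context {R : realType} {E : pmetricType R}.
Variables (M : process E) (hM : hunt M).
Local Notation Om := (Omega M).
Local Notation X := (traj M).
Local Notation P := (Pr M).
Local Notation theta := (time_shift M).
Local Notation F0 := (@natural_filtration R E M).
Local Notation FF := (@filtration R E M).
Implicit Types (s t r u : R) (w : Om) (x y : opc E) (B Lam : set Om).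

Lemma natural_filtration_le (s t : \bar R) : (s <= t)%E ->
  F0 s `<=` F0 t.
Proof.
move=> st; apply: sub_sigma_algebra2 => _ [u [C [u0 us mC ->]]].
by exists u, C; split => //; exact: le_trans st.
Qed.

Lemma natural_filtration_sub (t : \bar R) :
  F0 t `<=` FF t.
Proof.
move=> A FA mu; exists A, set0; split => //.
- exact: sigma_algebra0.
- by rewrite setDv setU0.
- by under eq_integral do rewrite measure0; rewrite integral0.
Qed.

Lemma filtration_le (s t : \bar R) : (s <= t)%E ->
  FF s `<=` FF t.
Proof.
move=> st A FA mu; have [A' [N [FA' FN AN N0]]] := FA mu.
by exists A', N; split => //; exact: natural_filtration_le FA'.
Qed.

Lemma filtration_measurable (t : \bar R) B : FF t B -> measurable B.
Proof.
by move=> FB; apply: (hunt_measurable hM); apply: filtration_le FB; rewrite leey.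
Qed.

Lemma natural_measurable (t : \bar R) B : F0 t B -> measurable B.
Proof. by move=> /natural_filtration_sub; exact: filtration_measurable. Qed.

Lemma natural_traj s (t : \bar R) (C : set (borel (opc E))) : 0 <= s ->
  (s%:E <= t)%E -> measurable C -> F0 t (X s @^-1` C).
Proof. by move=> s0 st mC; apply: sub_sigma_algebra; exists s, C. Qed.

Lemma measurable_traj t : 0 <= t ->
  measurable_fun setT (X t : Om -> borel (opc E)).
Proof. exact: hunt_path_measurable. Qed.

Lemma natural_shift t Lam : 0 <= t -> F0 +oo%E Lam ->
  F0 +oo%E (theta t @^-1` Lam).
Proof.
move=> t0; pose H := [set A : set Om | F0 +oo%E (theta t @^-1` A)].
suff : F0 +oo%E `<=` H by move=> h /h.
apply: smallest_sub; last first.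
  move=> _ [s [C [s0 _ mC ->]]]; rewrite /H /=.
  rewrite (_ : _ @^-1` _ = X (s + t) @^-1` C).
    by apply: natural_traj; rewrite ?addr_ge0 ?leey.
  by apply/seteqP; split => w; rewrite /preimage /= hunt_shift.
split; rewrite /H /=.
- by rewrite preimage_set0; exact: sigma_algebra0.
- move=> A FA; rewrite setTD preimage_setC -setTD; exact: sigma_algebraCD.
- by move=> F hF; rewrite preimage_bigcup; exact: sigma_algebra_bigcup.
Qed.

(* [theta s \o theta t] and [theta (t + s)] may be different maps, but they
   have the same trajectories. *)
Lemma natural_path_eq Lam w w' : F0 +oo%E Lam ->
  (forall s, 0 <= s -> X s w = X s w') -> Lam w -> Lam w'.
Proof.
move=> FL ww'; suff h : Lam w <-> Lam w' by apply h.
move: Lam FL; pose H := [set A : set Om | A w <-> A w'].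
suff : F0 +oo%E `<=` H by move=> h Lam FL; exact: (h Lam FL).
apply: smallest_sub; last first.
  by move=> _ [s [C [s0 _ mC ->]]]; rewrite /H /preimage /= ww'.
split; rewrite /H /= //.
- by move=> A AA; split => -[_ nA]; split => // /AA.
- by move=> F hF; split => -[n _ /hF Fn]; exists n.
Qed.

Lemma measurable_Pr_traj s (C : set (borel (opc E))) : 0 <= s -> measurable C ->
  measurable_fun [set: borel (opc E)] (fun y : borel (opc E) => P y (X s @^-1` C)).
Proof. by move=> s0 mC; apply: measurable_fun_opc; exact: hunt_Pr_measurable. Qed.

Lemma measurable_Rint_Pr (g : opc E -> R) s : 0 <= s ->
  measurable_fun [set: borel (opc E)] (g : borel (opc E) -> R) ->
  (forall y, 0 <= g y) ->
  measurable_fun [set: borel (opc E)]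
    (fun y : borel (opc E) => \int[P y]_v g (X s v)).
Proof.
move=> s0 mg g0.
pose Xs : {mfun Om >-> borel (opc E)} := mfun_Sub (mem_set (measurable_traj s0)).
apply: measurableT_comp => //.
rewrite (_ : (fun y => _) = fun y : borel (opc E) =>
  (\int[distribution (P y) Xs]_z (g z)%:E)%E).
  apply: measurable_fun_integral_kernel.
  - by move=> C mC; exact: measurable_Pr_traj.
  - by move=> z; rewrite lee_fin.
  - exact/measurable_EFinP.
apply/funext => y; rewrite ge0_integral_distribution //.
exact/measurable_EFinP.
Qed.

Lemma filtration_at_cst t B : FF t%:E B -> filtration_at (fun=> t%:E) B.
Proof.
move=> FB; split; first by apply: filtration_le FB; rewrite leey.
move=> u u0; have [tu|tu] := leP t u.
  rewrite (_ : [set w | _] = setT) ?setIT; first exact: filtration_le FB.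
  by apply/seteqP; split => // w _ /=; rewrite ?lee_fin.
rewrite (_ : _ `&` _ = set0).
  by apply: natural_filtration_sub; exact: sigma_algebra0.
by apply/seteqP; split => // w [_] /=; rewrite ?lee_fin leNgt tu.
Qed.

Lemma stopping_time_cst t : 0 <= t -> stopping_time (fun _ : Om => t%:E).
Proof.
move=> t0; split => [w|u u0]; first by rewrite lee_fin.
apply: natural_filtration_sub; have [tu|tu] := leP t u.
  rewrite (_ : [set w | _] = ~` set0).
    by rewrite -setTD; apply: sigma_algebraCD; exact: sigma_algebra0.
  by apply/seteqP; split => // w _ /=; rewrite ?lee_fin.
rewrite (_ : [set w | _] = set0); first exact: sigma_algebra0.
by apply/seteqP; split => // w /=; rewrite ?lee_fin leNgt tu.
Qed.

Lemma markov_traj x s t (C : set (borel (opc E))) B : 0 <= s -> 0 <= t ->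
  measurable C -> FF t%:E B ->
  P x (B `&` X (t + s) @^-1` C) = (\int[P x]_(w in B) P (X t w) (X s @^-1` C))%E.
Proof.
move=> s0 t0 mC FB.
exact: (hunt_strong_markov hM (stopping_time_cst t0) x s0 mC (filtration_at_cst FB)).
Qed.

Definition prob x Lam : R := fine (P x Lam).

Lemma probK x Lam : measurable Lam -> P x Lam = (prob x Lam)%:E.
Proof. by move=> mL; rewrite fineK // fin_num_measure. Qed.

Lemma prob_ge0 x Lam : measurable Lam -> 0 <= prob x Lam <= 1.
Proof.
by move=> mL; rewrite -!lee_fin -probK // measure_ge0 probability_le1.
Qed.

(** [markov_traj] is the case of indicators; it is applied to the superlevel sets of g, and the
    layers give g itself. *)
Lemma markov_fun x (g : opc E -> R) s t B : 0 <= s -> 0 <= t -> FF t%:E B ->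
  measurable_fun [set: borel (opc E)] (g : borel (opc E) -> R) ->
  (forall y, 0 <= g y <= 1) ->
  \int[P x]_(w in B) g (X (t + s) w) =
  \int[P x]_(w in B) (\int[P (X t w)]_v g (X s v)).
Proof.
move=> s0 t0 FB mg g01; have mB := filtration_measurable FB.
have g0 y : 0 <= g y by case/andP: (g01 y).
have bgX y u : 0 <= u -> bounded_mfun (fun v => g (X u v)).
  move=> u0; split.
    exact: (measurableT_comp mg (measurable_traj u0)).
  by exists 1 => v; case/andP: (g01 (X u v)) => a b; rewrite ger0_norm.
have mC c : measurable ([set z | c <= g z] : set (borel (opc E))).
  exact: measurable_superlevel.
apply: (@Rintegral_eq_layer _ _ _ _ _ _ _
   (fun c w => prob (X t w) (X s @^-1` [set z | c <= g z]))) => //.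
- by case: (bgX x (t + s)); rewrite ?addr_ge0.
- split.
    exact: (measurableT_comp (measurable_Rint_Pr s0 mg g0) (measurable_traj t0)).
  exists 1 => w; rewrite ger0_norm; last by apply: Rintegral_ge0.
  rewrite -[leRHS](Rintegral_probability1 (P (X t w))).
  apply: ler_Rintegral_ae; [exact: bgX | exact: bounded_mfun_cst |].
  by apply: aeW => v; case/andP: (g01 (X s v)).
- move=> c c0; split.
    apply: measurableT_comp => //.
    exact: (measurableT_comp (measurable_Pr_traj s0 (mC c)) (measurable_traj t0)).
  exists 1 => w; have /andP[a b] := prob_ge0 (X t w)
    (measurable_traj s0 measurableT (mC c)).
  rewrite setTI in a b; by rewrite ger0_norm.
- move=> c c0; rewrite -/(X (t + s) @^-1` [set z | c <= g z]).
  rewrite markov_traj // /Rintegral; congr fine.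
  apply: eq_integral => w _; rewrite -probK //.
  by rewrite -[X in measurable X]setTI; exact: measurable_traj.
- move=> n; apply: aeW => w _.
  have -> : layer n (fun c => prob (X t w) (X s @^-1` [set z | c <= g z])) =
     \int[P (X t w)]_v layer n (fun c => \1_[set v | c <= g (X s v)] v).
    rewrite Rintegral_layer //.
      congr (_ * _); apply: eq_bigr => k _; rewrite Rintegral_indic ?setIT //.
      by apply: measurable_superlevel; case: (bgX x s).
    by move=> c _; apply: bounded_mfun_indic; apply: measurable_superlevel; case: (bgX x s).
  apply: Rintegral_dist_le => //; first exact: bgX.
    apply: bounded_mfun_layer => c _.
    by apply: bounded_mfun_indic; apply: measurable_superlevel; case: (bgX x s).
  by apply: aeW => v _; rewrite -(@layer_superlevelE _ _ _ (fun v => g (X s v))) layer_bound.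
Qed.

(** [hunt_strong_markov] concerns events that depend on one time only. These are the events for
    which the simple Markov property holds; measurability in the starting point is carried along,
    since the right-hand integral needs it. *)
Definition markov_set Lam :=
  measurable_fun [set: borel (opc E)] (fun y : borel (opc E) => P y Lam) /\
  forall x t B, 0 <= t -> FF t%:E B ->
    P x (B `&` theta t @^-1` Lam) = (\int[P x]_(w in B) P (X t w) Lam)%E.

Definition cylinder (l : seq R) (C : R -> set (opc E)) : set Om :=
  [set w | forall s, s \in l -> C s (X s w)].

Lemma filtrationT (t : \bar R) : FF t setT.
Proof.
by apply: natural_filtration_sub; rewrite -setC0 -setTD; apply: sigma_algebraCD; exact: sigma_algebra0.
Qed.

Lemma natural_cylinder (l : seq R) (C : R -> set (borel (opc E))) :
  (forall s, s \in l -> 0 <= s) -> (forall s, measurable (C s)) ->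
  F0 +oo%E (cylinder l C).
Proof.
move=> l0 mC.
rewrite (_ : cylinder _ _ = ~` \bigcup_n (if (n < size l)%N then ~` (X l`_n @^-1` C l`_n) else set0)).
  rewrite -setTD; apply: sigma_algebraCD; apply: sigma_algebra_bigcup => n.
  case: ifPn => nl; last exact: sigma_algebra0.
  rewrite -setTD; apply: sigma_algebraCD; apply: natural_traj; rewrite ?leey //.
  by apply: l0; rewrite mem_nth.
apply/seteqP; split => w /=.
  by move=> h [n _]; case: ifPn => // nl; apply; apply: h; rewrite mem_nth.
move=> h s sl; apply: contrapT => nC; apply: h; exists (index s l) => //.
by rewrite index_mem sl nth_index.
Qed.

Lemma markov_setT : markov_set setT.
Proof.
split.
  by under eq_fun do rewrite probability_setT; exact: measurable_cst.
move=> x t B t0 FB; rewrite preimage_setT setIT.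
under eq_integral do rewrite probability_setT.
by rewrite integral_cst ?mul1e //; exact: filtration_measurable FB.
Qed.

End Process.

Section Process.
Context {R : realType} {E : pmetricType R}.
Variables (M : process E) (hM : hunt M).
Local Notation Om := (Omega M).
Local Notation X := (traj M).
Local Notation P := (Pr M).
Local Notation theta := (time_shift M).
Local Notation F0 := (@natural_filtration R E M).
Local Notation FF := (@filtration R E M).
Implicit Types (s t r u : R) (w : Om) (x y : opc E) (B Lam : set Om).

(** Intersecting with an uncompleted set enlarges no exceptional set: the same N works for every
    initial law. *)
Lemma filtration_setI_natural t B Lam : FF t%:E B -> F0 t%:E Lam -> FF t%:E (B `&` Lam).
Proof.
move=> FB FL mu; have [A' [N [FA' FN AN N0]]] := FB mu.
exists (A' `&` Lam), N; split => //.
  rewrite -[_ `&` _]setCK setCI -setTD; apply: sigma_algebraCD.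
  rewrite -bigcup2E; apply: sigma_algebra_bigcup => -[|[|n]] /=; last exact: sigma_algebra0.
    by rewrite -setTD; exact: sigma_algebraCD.
  by rewrite -setTD; exact: sigma_algebraCD.
apply: subset_trans AN => w [[[Bw Lw] nA]|[[Aw Lw] nB]].
  by left; split => // Aw; apply: nA.
by right; split => // Bw; apply: nB.
Qed.

Lemma measurable_prob t Lam : 0 <= t ->
  measurable_fun [set: borel (opc E)] (fun y : borel (opc E) => P y Lam) ->
  measurable_fun setT (fun w => P (X t w) Lam).
Proof. by move=> t0 mP; exact: (measurableT_comp mP (measurable_traj hM t0)). Qed.

Lemma bounded_mfun_prob t Lam : 0 <= t -> measurable Lam ->
  measurable_fun [set: borel (opc E)] (fun y : borel (opc E) => P y Lam) ->
  bounded_mfun (fun w => prob (X t w) Lam).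
Proof.
move=> t0 mL mP; split.
  by apply: measurableT_comp => //; exact: measurable_prob.
by exists 1 => w; have /andP[a b] := prob_ge0 (X t w) mL; rewrite ger0_norm.
Qed.

Lemma integral_prob x t B Lam : 0 <= t -> measurable B -> measurable Lam ->
  measurable_fun [set: borel (opc E)] (fun y : borel (opc E) => P y Lam) ->
  (\int[P x]_(w in B) P (X t w) Lam)%E = (\int[P x]_(w in B) prob (X t w) Lam)%:E.
Proof.
move=> t0 mB mL mP; rewrite /Rintegral fineK.
  by apply: eq_integral => w _; rewrite probK.
apply: integrable_fin_num => //.
by apply: bounded_mfun_integrable => //; exact: bounded_mfun_prob.
Qed.

Lemma markov_setC Lam : measurable Lam ->
  (forall t, 0 <= t -> measurable (theta t @^-1` Lam)) ->
  @markov_set R E M Lam -> markov_set (~` Lam).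
Proof.
move=> mL mtL [mP mk]; split.
  rewrite (_ : (fun y => _) = fun y : borel (opc E) => (1 - P y Lam)%E).
    by apply: emeasurable_funB => //; exact: measurable_cst.
  by apply/funext => y; rewrite probability_setC.
move=> x t B t0 FB; have mB := filtration_measurable hM FB.
have mC : measurable_fun [set: borel (opc E)] (fun y : borel (opc E) => P y (~` Lam)).
  rewrite (_ : (fun y => _) = fun y : borel (opc E) => (1 - P y Lam)%E).
    by apply: emeasurable_funB => //; exact: measurable_cst.
  by apply/funext => y; rewrite probability_setC.
rewrite integral_prob //; last exact: measurableC.
rewrite (_ : Rintegral _ _ _ = \int[P x]_(w in B) (1 - prob (X t w) Lam)); last first.
  apply: eq_Rintegral => w _; rewrite /prob probability_setC // fineB //.
  exact: fin_num_measure.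
rewrite RintegralB //; first last.
- by apply: bounded_mfun_integrable => //; exact: bounded_mfun_prob.
- by apply: bounded_mfun_integrable => //; exact: bounded_mfun_cst.
rewrite EFinB -integral_prob // -mk // Rintegral_cst // mul1r fineK ?fin_num_measure //.
rewrite preimage_setC -setDE measureD //; first exact: mtL.
by rewrite -ge0_fin_numE ?fin_num_measure.
Qed.

Lemma markov_set_bigcup (L : (set Om)^nat) : (forall n, measurable (L n)) ->
  (forall n t, 0 <= t -> measurable (theta t @^-1` L n)) -> trivIset setT L ->
  (forall n, @markov_set R E M (L n)) -> markov_set (\bigcup_n L n).
Proof.
move=> mL mtL tL mk.
have PE (y : opc E) : P y (\bigcup_n L n) = (\sum_(n <oo) P y (L n))%E.
  by rewrite measure_semi_bigcup //; exact: bigcupT_measurable.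
split.
  under eq_fun do rewrite PE.
  by apply: ge0_emeasurable_sum => // n _; case: (mk n).
move=> x t B t0 FB; have mB := filtration_measurable hM FB.
rewrite preimage_bigcup setI_bigcupr measure_semi_bigcup; first last.
- by apply: bigcupT_measurable => n; apply: measurableI => //; exact: mtL.
- apply/trivIsetP => i j _ _ ij; move/trivIsetP: tL => /(_ i j I I ij) Lij.
  by rewrite setIACA setIid -preimage_setI Lij preimage_set0 setI0.
- by move=> n; apply: measurableI => //; exact: mtL.
under [RHS]eq_integral do rewrite PE.
rewrite integral_nneseries //.
  by apply: eq_eseriesr => n _; have [_ e] := mk n; exact: e.
by move=> n; apply: measurable_funTS; apply: measurable_prob => //; case: (mk n).
Qed.

Lemma preimage_shift t s Lam : 0 <= t -> 0 <= s -> F0 +oo%E Lam ->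
  theta t @^-1` (theta s @^-1` Lam) = theta (t + s) @^-1` Lam.
Proof.
move=> t0 s0 FL.
have e w u : 0 <= u -> X u (theta s (theta t w)) = X u (theta (t + s) w).
  by move=> u0; rewrite !(hunt_shift hM) ?addr_ge0 // -addrA (addrC s).
apply/seteqP; split => w; rewrite /preimage /=.
  by apply: natural_path_eq => // u u0; rewrite e.
by apply: natural_path_eq => // u u0; rewrite e.
Qed.

Lemma preimage_shift_traj t s (C : set (opc E)) : 0 <= t -> 0 <= s ->
  theta t @^-1` (X s @^-1` C) = X (t + s) @^-1` C.
Proof.
by move=> t0 s0; apply/seteqP; split => w; rewrite /preimage /= (hunt_shift hM) // addrC.
Qed.

(** Conditioning first at time t + s, then at time t: given X_s, the event has probability g(X_s)
    with g = 1_C P_.(Lam), so [markov_fun] applied to g finishes. *)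
Lemma markov_set_step s (C : set (borel (opc E))) Lam : 0 <= s -> measurable C ->
  F0 +oo%E Lam -> @markov_set R E M Lam ->
  markov_set (X s @^-1` C `&` theta s @^-1` Lam).
Proof.
move=> s0 mC FL [mP mk].
have mL := natural_measurable hM FL.
have mXC u : 0 <= u -> measurable (X u @^-1` C).
  by move=> u0; rewrite -[X in measurable X]setTI; exact: measurable_traj.
pose g (y : opc E) : R := \1_C y * prob y Lam.
have g01 y : 0 <= g y <= 1.
  have /andP[a b] := prob_ge0 y mL.
  by rewrite /g indicE; case: (_ \in _); rewrite ?mul1r ?mul0r ?a ?b ?lexx ?ler01.
have mg : measurable_fun [set: borel (opc E)] (g : borel (opc E) -> R).
  apply: measurable_funM; first exact: measurable_indic.
  exact: measurableT_comp.
have gE x u B : 0 <= u -> measurable B -> (\int[P x]_(w in B `&` X u @^-1` C) P (X u w) Lam)%E =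
    (\int[P x]_(w in B) g (X u w))%:E.
  move=> u0 mB; rewrite integral_prob //; last by apply: measurableI => //; exact: mXC.
  congr EFin; rewrite Rintegral_mkcondr; apply: eq_Rintegral => w _.
  rewrite patchE /g indicE; have [h|h] := boolP (w \in X u @^-1` C).
    by rewrite mem_set ?mul1r //; exact: set_mem h.
  by rewrite memNset ?mul0r // => Cx; move/negP: h; apply; exact: mem_set.
have PE (y : opc E) : P y (X s @^-1` C `&` theta s @^-1` Lam) =
    (\int[P y]_v g (X s v))%:E.
  rewrite mk //; first by rewrite -[X s @^-1` C]setTI gE.
  by apply: natural_filtration_sub; apply: natural_traj; rewrite ?lexx.
have mPE : measurable_fun [set: borel (opc E)] (fun y : borel (opc E) =>
    P y (X s @^-1` C `&` theta s @^-1` Lam)).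
  under eq_fun do rewrite PE.
  apply/measurable_EFinP; apply: measurable_Rint_Pr => // y.
  by case/andP: (g01 y).
split => // x t B t0 FB; have mB := filtration_measurable hM FB.
rewrite preimage_setI preimage_shift_traj // preimage_shift // setIA.
rewrite mk ?addr_ge0 //; last first.
  apply: filtration_setI_natural.
    by apply: filtration_le FB; rewrite lee_fin lerDl.
  by apply: natural_traj; rewrite ?addr_ge0 ?lexx.
rewrite gE ?addr_ge0 // (markov_fun hM x s0 t0 FB mg g01) integral_prob //.
  congr EFin; apply: eq_Rintegral => w _; rewrite /prob PE //.
apply: measurableI; first exact: mXC.
by apply: (natural_measurable hM); exact: (natural_shift hM).
Qed.

Lemma markov_cylinder (l : seq R) (C : R -> set (borel (opc E))) :
  (forall s, s \in l -> 0 <= s) -> (forall s, measurable (C s)) ->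
  @markov_set R E M (cylinder l C).
Proof.
move=> l0 mC.
wlog sl : l l0 / sorted <=%R l.
  move=> H; rewrite (_ : cylinder l C = cylinder (sort <=%R l) C).
    apply: H; last exact: sort_le_sorted.
    by move=> s; rewrite mem_sort; exact: l0.
  by apply/seteqP; split => w h s sl; apply: h; rewrite mem_sort in sl *.
have [n nl] := ubnP (size l).
elim: n l C nl l0 mC sl => // n IH [|s l] C /= nl l0 mC sl.
  rewrite (_ : cylinder _ _ = setT); first exact: markov_setT.
  by apply/seteqP; split => // w _ s.
have s0 : 0 <= s by apply: l0; rewrite mem_head.
have sall u : u \in l -> s <= u by have := order_path_min le_trans sl => /allP; apply.
(* The remaining times counted from the smallest one, s; sorting keeps them nonnegative, and the
   remaining conditions become an event of the path shifted by s. *)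
pose l' := [seq u - s | u <- l].
have l'0 u : u \in l' -> 0 <= u by move=> /mapP[v vl ->]; rewrite subr_ge0 sall.
rewrite (_ : cylinder _ _ = X s @^-1` C s `&`
    theta s @^-1` cylinder l' (fun u => C (u + s))).
  apply: markov_set_step => //; first exact: natural_cylinder.
  apply: IH => //; first by rewrite size_map.
  rewrite sorted_map; move: (path_sorted sl); apply: sub_sorted => a b ab /=.
  by rewrite lerB.
apply/seteqP; split => w /=.
  move=> h; split; first by apply: h; rewrite mem_head.
  move=> u ul'; have u0 := l'0 u ul'; rewrite (hunt_shift hM) //=; apply: (h (u + s)).
  by move: ul' => /mapP[v vl ->]; rewrite subrK in_cons vl orbT.
move=> [Cs h] u; rewrite in_cons => /orP[/eqP -> //|ul].
have /= := h (u - s) (map_f _ ul); rewrite (hunt_shift hM) ?subr_ge0 ?sall //.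
by rewrite subrK.
Qed.

(** Dynkin's pi-lambda theorem: cylinders generate F^0_infty, and two of them intersect in the
    cylinder over the concatenated times, where a time absent from one list carries the trivial
    condition there. *)
Lemma markov_natural Lam : F0 +oo%E Lam -> markov_set Lam.
Proof.
pose G := [set L : set Om | exists (l : seq R) (C : R -> set (borel (opc E))),
  [/\ forall s, s \in l -> 0 <= s, forall s, measurable (C s) & L = cylinder l C]].
have GF : <<s G >> `<=` F0 +oo%E.
  apply: smallest_sub; first exact: smallest_sigma_algebra.
  by move=> _ [l [C [l0 mC ->]]]; exact: natural_cylinder.
have FG : F0 +oo%E `<=` <<s G >>.
  apply: sub_sigma_algebra2 => _ [s [C [s0 _ mC ->]]].
  exists [:: s], (fun=> C); split => //.
    by move=> u; rewrite inE => /eqP ->.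
  apply/seteqP; split => w /= h; first by move=> u; rewrite inE => /eqP ->.
  by apply: h; rewrite mem_head.
have mth S t : 0 <= t -> <<s G >> S -> measurable (theta t @^-1` S).
  by move=> t0 /GF FS; apply: (natural_measurable hM); exact: (natural_shift hM).
have mG S : <<s G >> S -> measurable S by move=> /GF; exact: (natural_measurable hM).
move=> /FG; move: Lam.
apply: (@dynkin_induction _ (g_sigma_algebraType G) G (@markov_set R E M)) => //.
- move=> _ _ [l [C [l0 mC ->]]] [l' [C' [l'0 mC' ->]]].
  exists (l ++ l'), (fun s => (if s \in l then C s else setT) `&` (if s \in l' then C' s else setT)).
  split.
  + by move=> s; rewrite mem_cat => /orP[/l0|/l'0].
  + by move=> s; apply: measurableI; case: ifPn.
  + apply/seteqP; split => w.
      by move=> [h h'] s _; split; case: ifPn => // sl; [exact: h|exact: h'].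
    move=> h; split => s sl.
      by have := h s; rewrite mem_cat sl => /(_ isT)[].
    by have := h s; rewrite mem_cat sl orbT => /(_ isT)[].
- exact: markov_setT.
- by move=> _ [l [C [l0 mC ->]]]; exact: markov_cylinder.
- by move=> S mS; apply: markov_setC; [exact: mG | move=> t t0; exact: mth].
- move=> L mL tL; apply: markov_set_bigcup => //.
    by move=> n; apply: mG; exact: mL.
  by move=> n t t0; apply: mth => //; exact: mL.
Qed.

End Process.

Lemma eq_measure_ae d (T : measurableType d) (R : realType) (Q : probability T R) (A1 A2 : set T) :
  measurable A1 -> measurable A2 -> {ae Q, forall w, A1 w <-> A2 w} -> Q A1 = Q A2.
Proof.
move=> m1 m2 h; rewrite -[A1]setIT -[A2]setIT -!integral_indic //.
apply: ae_eq_integral => //.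
- exact/measurable_EFinP/measurable_indic.
- exact/measurable_EFinP/measurable_indic.
apply: filterS h => w h _; rewrite !indicE.
by have -> : (w \in A1) = (w \in A2) by apply/idP/idP => /set_mem /h /mem_set.
Qed.

Section Process.
Context {R : realType} {E : pmetricType R}.
Variables (M : process E) (hM : hunt M).
Local Notation Om := (Omega M).
Local Notation X := (traj M).
Local Notation P := (Pr M).
Local Notation theta := (time_shift M).
Local Notation F0 := (@natural_filtration R E M).
Local Notation FF := (@filtration R E M).
Implicit Types (s t r u : R) (w : Om) (x y : opc E) (B Lam : set Om).

(** Z is measurable for the completed sigma-field only, while the shift is known to be measurable
    for the uncompleted one. Each superlevel set of Z is therefore replaced by a set of F^0_infty,
    and W stands for a measurable version of Z composed with the shift. *)
Lemma markov_functional x t B (Z W : Om -> R) (h : opc E -> R) :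
  0 <= t -> FF t%:E B -> (forall w, 0 <= Z w <= 1) -> measurable_fun setT Z ->
  (forall c, 0 < c -> FF +oo%E [set w | c <= Z w]) ->
  (forall w, 0 <= W w <= 1) -> measurable_fun setT W ->
  {ae P x, forall w, W w = Z (theta t w)} ->
  measurable_fun [set: borel (opc E)] (h : borel (opc E) -> R) ->
  (forall y, h y = \int[P y]_w Z w) ->
  \int[P x]_(w in B) W w = \int[P x]_(w in B) h (X t w).
Proof.
move=> t0 FB Z01 mZ FZ W01 mW WZ mh hE.
have mB := filtration_measurable hM FB.
have mXt := measurable_traj hM t0.
pose Xt : {mfun Om >-> borel (opc E)} := mfun_Sub (mem_set mXt).
(* The completion is taken for the law of X_t as initial law: an exceptional set N is then null for
   P_(X_t) almost surely, and its preimage under the shift by t is null for P_x. *)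
pose mu : probability (borel (opc E)) R := distribution (P x) Xt.
have /choice[LN HLN] : forall c : R, exists LN : set Om * set Om, 0 < c ->
    [/\ F0 +oo%E LN.1, F0 +oo%E LN.2,
        ([set w | c <= Z w] `\` LN.1) `|` (LN.1 `\` [set w | c <= Z w]) `<=` LN.2
      & (\int[mu]_y P y LN.2 = 0)%E].
  move=> c; have [c0|c0] := ltP 0 c; last by exists (set0, set0).
  have [L [N hLN]] := FZ c c0 mu; exists (L, N) => _.
  by case: hLN.
have mPN c : 0 < c -> measurable_fun [set: borel (opc E)] (fun y : borel (opc E) => P y (LN c).2).
  by move=> c0; have [_ FN _ _] := HLN c c0; case: (markov_natural hM FN).
have mPL c : 0 < c -> measurable_fun [set: borel (opc E)] (fun y : borel (opc E) => P y (LN c).1).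
  by move=> c0; have [FL _ _ _] := HLN c c0; case: (markov_natural hM FL).
have mN c : 0 < c -> measurable (LN c).2.
  by move=> c0; have [_ FN _ _] := HLN c c0; exact: natural_measurable FN.
have mL c : 0 < c -> measurable (LN c).1.
  by move=> c0; have [FL _ _ _] := HLN c c0; exact: natural_measurable FL.
have mtheta A : F0 +oo%E A -> measurable (theta t @^-1` A).
  by move=> FA; apply: (natural_measurable hM); exact: (natural_shift hM).
have intN c : 0 < c -> (\int[P x]_w P (X t w) (LN c).2 = 0)%E.
  move=> c0; have [_ _ _] := HLN c c0.
  rewrite ge0_integral_distribution //; exact: mPN.
have aeN c : 0 < c -> {ae P x, forall w, prob (X t w) (LN c).2 = 0}.
  move=> c0; apply: Rintegral_eq0_ae; first by apply: bounded_mfun_prob => //; [exact: mN|exact: mPN].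
    by move=> w; have /andP[] := prob_ge0 (X t w) (mN c c0).
  by have := intN c c0; rewrite integral_prob //; [case|exact: mN|exact: mPN].
have aetN c : 0 < c -> {ae P x, forall w, ~ (LN c).2 (theta t w)}.
  move=> c0; have [_ FN _ _] := HLN c c0; exists (theta t @^-1` (LN c).2); split.
  - exact: mtheta.
  - have [_ mk] := markov_natural hM FN.
    by rewrite -[theta t @^-1` _]setTI mk ?intN //; exact: filtrationT.
  - by move=> w /= /contrapT.
have mZc c : measurable [set w | c <= Z w] by exact: measurable_superlevel.
apply: (@Rintegral_eq_layer _ _ _ _ _ _ _ (fun c w => prob (X t w) (LN c).1)) => //.
- split; first exact: (measurableT_comp mh mXt).
  exists 1 => w; rewrite hE ger0_norm; last by apply: Rintegral_ge0 => v _; case/andP: (Z01 v).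
  rewrite -[leRHS](Rintegral_probability1 (P (X t w))).
  apply: ler_Rintegral_ae; last by apply: aeW => v; case/andP: (Z01 v).
    by split => //; exists 1 => v; case/andP: (Z01 v) => a b; rewrite ger0_norm.
  exact: bounded_mfun_cst.
- by move=> c c0; apply: bounded_mfun_prob => //; [exact: mL|exact: mPL].
- move=> c c0; have [FL FN LNZ _] := HLN c c0.
  have [_ mk] := markov_natural hM FL.
  rewrite (@eq_measure_ae _ _ _ _ _ (B `&` theta t @^-1` (LN c).1)).
  + by rewrite mk // integral_prob //; [exact: mL|exact: mPL].
  + by apply: measurableI => //; exact: measurable_superlevel.
  + by apply: measurableI => //; exact: mtheta.
  + apply: filterS2 WZ (aetN c c0) => w /= -> nN; split=> -[Bw h']; split=> //.
      by apply: contrapT => nL; apply: nN; apply: LNZ; left.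
    by apply: contrapT => nL; apply: nN; apply: LNZ; right.
- move=> n.
  have : {ae P x, forall w, forall k, prob (X t w) (LN (level n k)).2 = 0}.
    by apply: ae_foralln => k; apply: aeN; exact: level_gt0.
  apply: filterS => w Nw _.
  have -> : layer n (fun c => prob (X t w) (LN c).1) =
     \int[P (X t w)]_v layer n (fun c => \1_[set v | c <= Z v] v).
    rewrite Rintegral_layer //; last by move=> c c0; apply: bounded_mfun_indic.
    congr (_ * _); apply: eq_bigr => k _; rewrite Rintegral_indic // setIT /prob.
    have c0 := @level_gt0 R n k; set c := level n k in c0 *.
    have [_ _ LNZ _] := HLN c c0.
    congr fine; apply: eq_measure_ae => //; first exact: mL.
    have PN0 : P (X t w) (LN c).2 = 0%E by rewrite probK ?Nw //; exact: mN.
    exists (LN c).2; split => //; first exact: mN.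
    move=> v /= nv; apply: contrapT => nN; apply: nv; split => h'.
      by apply: contrapT => nL; apply: nN; apply: LNZ; right.
    by apply: contrapT => nL; apply: nN; apply: LNZ; left.
  rewrite hE; apply: Rintegral_dist_le => //.
  + by split => //; exists 1 => v; case/andP: (Z01 v) => a b; rewrite ger0_norm.
  + by apply: bounded_mfun_layer => c _; apply: bounded_mfun_indic.
  + by apply: aeW => v _; rewrite -layer_superlevelE layer_bound.
Qed.

End Process.

(** * Survival and the two-time marginals of the subprocess *)

Section NonmeasurableIntegrand.
Local Open Scope ereal_scope.
Context d (T : measurableType d) (R : realType) (mu : {measure set T -> \bar R}).

Lemma ge0_le_integral_nonmeasurable (f g : T -> \bar R) :
  (forall x, 0 <= f x) -> (forall x, f x <= g x) -> \int[mu]_x f x <= \int[mu]_x g x.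
Proof.
move=> f0 fg; rewrite !ge0_integralTE //; last by move=> x; exact: le_trans (fg x).
rewrite ge_ereal_sup// => _ [h/= hf] <-.
apply: ereal_sup_ubound; exists h => // x; exact: le_trans (fg x).
Qed.

(* The integral of a nonnegative function is a lower integral, hence it is
   insensitive to null sets even when the function is not measurable. *)
Lemma ge0_ae_eq_integral_nonmeasurable (f g : T -> \bar R) :
  (forall x, 0 <= f x) -> (forall x, 0 <= g x) -> measurable_fun setT g ->
  {ae mu, forall x, f x = g x} -> \int[mu]_x f x = \int[mu]_x g x.
Proof.
move=> f0 g0 mg [N [mN N0 fgN]].
(* Changing g to 0, respectively to +oo, on the null set keeps it measurable and brackets f at every
   point. *)
pose g1 x := if x \in N then 0 else g x.
pose g2 x := if x \in N then +oo else g x.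
have mB : measurable_fun setT (fun x => x \in N).
  apply: (measurable_fun_bool true); rewrite setTI.
  rewrite (_ : _ @^-1` _ = N) //.
  by apply/seteqP; split => x /= => [/set_mem|/mem_set].
have m1 : measurable_fun setT g1 by apply: measurable_fun_ifT => //; exact: measurable_cst.
have m2 : measurable_fun setT g2 by apply: measurable_fun_ifT => //; exact: measurable_cst.
have g10 x : 0 <= g1 x by rewrite /g1; case: ifP.
have g20 x : 0 <= g2 x by rewrite /g2; case: ifP.
have e1 : \int[mu]_x g1 x = \int[mu]_x g x.
  apply: ge0_ae_eq_integral => //; exists N; split => // x /= h.
  by apply: contrapT => nN; apply: h => _; rewrite /g1 memNset.
have e2 : \int[mu]_x g2 x = \int[mu]_x g x.
  apply: ge0_ae_eq_integral => //; exists N; split => // x /= h.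
  by apply: contrapT => nN; apply: h => _; rewrite /g2 memNset.
have fg x : x \notin N -> f x = g x.
  by move=> /negP xN; apply: contrapT => h; apply: xN; apply/mem_set/fgN.
apply/eqP; rewrite eq_le; apply/andP; split.
  rewrite -e2; apply: ge0_le_integral_nonmeasurable => // x.
  by rewrite /g2; case: ifPn; [rewrite leey | move=> /fg ->].
rewrite -e1; apply: ge0_le_integral_nonmeasurable => // x.
by rewrite /g1; case: ifPn => // /fg ->.
Qed.

End NonmeasurableIntegrand.

Section ExpOpp.
Context {R : realType}.

(* [exp (- a)] for [a] in [0, +oo], cut off so that it takes values in [0, 1]
   for every extended real. *)
Definition expN (a : \bar R) : R :=
  if a == +oo%E then 0 else expR (- Num.max 0 (fine a)).

Lemma expN_ge0_le1 a : 0 <= expN a <= 1.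
Proof.
rewrite /expN; case: ifP => _; first by rewrite lexx ler01.
by rewrite expR_ge0 /= -[leRHS]expR0 ler_expR oppr_le0 le_max lexx.
Qed.

Lemma expN_fin (r : R) : 0 <= r -> expN r%:E = expR (- r).
Proof. by move=> r0; rewrite /expN /= max_r. Qed.

Lemma expNE a : (0 <= a)%E -> (expN a)%:E = expeR (- a)%E.
Proof.
case: a => [r r0| _|] //; first by rewrite expN_fin.
Qed.

Lemma measurable_expN : measurable_fun setT expN.
Proof.
apply: measurable_fun_ifT.
- apply: (measurable_fun_bool true); rewrite setTI.
  rewrite (_ : _ @^-1` _ = [set +oo%E]); first exact: emeasurable_set1.
  by apply/seteqP; split => a /= => [/eqP|->] //; rewrite eqxx.
- exact: measurable_cst.
- apply: measurableT_comp; first exact: measurable_expR.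
  apply: measurableT_comp => //; apply: measurable_maxr => //.
Qed.

Lemma expN_le (a b : \bar R) : (0 <= a)%E -> (a <= b)%E -> expN b <= expN a.
Proof.
move=> a0 ab; rewrite -lee_fin !expNE ?lee_expeR ?leeN2 //; exact: le_trans ab.
Qed.

Lemma expND (a b : R) : 0 <= a -> 0 <= b -> expN (a + b)%:E = expN a%:E * expN b%:E.
Proof. by move=> a0 b0; rewrite !expN_fin ?addr_ge0 // opprD expRD. Qed.

End ExpOpp.

Section Process.
Context {R : realType} {E : pmetricType R}.
Variables (M : process E) (hM : hunt M).
Local Notation Om := (Omega M).
Local Notation X := (traj M).
Local Notation P := (Pr M).
Local Notation F0 := (@natural_filtration R E M).
Implicit Types (s t r u : R) (w : Om) (x y : opc E) (B Lam : set Om).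

(** This is 1_{u < zeta}, read off X_u alone so that the Markov property for functions of the
    position applies to it. *)
Definition alive u w : R := ext0 (fun=> 1) (X u w).

Lemma alive_traj u w : alive u w = if X u w is Some _ then 1 else 0.
Proof. by rewrite /alive /ext0; case: (X u w). Qed.

Lemma zeta_gtP t w : 0 <= t -> (t%:E < zeta w)%E <-> X t w <> None.
Proof.
move=> t0; split => [tz XN|XN].
  by move: tz; rewrite ltNge; apply/negP; rewrite negbK; apply: ereal_inf_lbound; exists t.
by rewrite ltNge; apply/negP => /(hunt_cemetery hM t0).
Qed.

Lemma zeta_leP t w : 0 <= t -> (zeta w <= t%:E)%E <-> X t w = None.
Proof.
move=> t0; split; first exact: hunt_cemetery.
by move=> XN; rewrite leNgt; apply/negP => /(zeta_gtP w t0).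
Qed.

Lemma traj_None_le u v w : 0 <= u -> u <= v -> X u w = None -> X v w = None.
Proof.
move=> u0 uv /zeta_leP h; apply/zeta_leP; first exact: le_trans uv.
by apply: le_trans (h u0) _; rewrite lee_fin.
Qed.

Lemma alive_ge0_le1 u w : 0 <= alive u w <= 1.
Proof. by rewrite alive_traj; case: (X u w) => [_|]; rewrite ?lexx ler01. Qed.

Lemma alive_le u v w : 0 <= u -> u <= v -> alive v w <= alive u w.
Proof.
move=> u0 uv; rewrite !alive_traj; case eu : (X u w) => [a|].
  by case: (X v w) => // _; exact: ler01.
by rewrite (traj_None_le u0 uv eu).
Qed.

Lemma measurable_ext0_traj f u : 0 <= u -> borel_fun f ->
  measurable_fun setT (fun w => ext0 f (X u w)).
Proof.
move=> u0 mf; exact: (measurableT_comp (measurable_ext0 mf) (measurable_traj hM u0)).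
Qed.

Lemma measurable_alive u : 0 <= u -> measurable_fun setT (alive u).
Proof. by move=> u0; apply: measurable_ext0_traj => //; exact: measurable_cst. Qed.

Lemma transitionE t (f : E -> R) (z : E) : 0 <= t ->
  transition M t f z = \int[P (Some z)]_w ext0 f (X t w).
Proof.
move=> t0; rewrite /transition Rintegral_mkcond; apply: eq_Rintegral => w _.
rewrite patchE; case: ifPn => // /negP h.
rewrite /ext0; case e : (X t w) => [a|] //.
by exfalso; apply: h; apply/mem_set/zeta_gtP => //; rewrite e.
Qed.

Lemma transition_alive t (z : E) : 0 <= t ->
  transition M t (fun=> 1) z = \int[P (Some z)]_w alive t w.
Proof. exact: transitionE. Qed.

Lemma ae_start (z : opc E) : {ae P z, forall w, X 0 w = z}.
Proof.
have mz : measurable [set w | X 0 w = z].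
  case: z => [z|].
    rewrite -[X in measurable X]setTI.
    have -> : [set w | X 0 w = Some z] = X 0 @^-1` (Some @` [set z]).
      by apply/seteqP; split => w /= => [->|[a -> <-]] //; exists z.
    apply: (measurable_traj hM) => //; apply: measurable_image_Some.
    rewrite -[X in measurable X]setCK; apply: measurableC; apply: sub_sigma_algebra.
    by rewrite openC; apply: accessible_closed_set1; apply: hausdorff_accessible; exact: metric_hausdorff.
  rewrite -[X in measurable X]setTI.
  exact: (measurable_traj hM (lexx 0) measurableT measurable_None).
by apply: probability1_ae => //; exact: hunt_normal.
Qed.

Lemma natural_superlevel_traj t (g : opc E -> R) c : 0 <= t ->
  measurable_fun [set: borel (opc E)] (g : borel (opc E) -> R) ->
  F0 t%:E [set w | c <= g (X t w)].
Proof.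
move=> t0 mg; rewrite -[X in F0 _ X]/(X t @^-1` [set y | c <= g y]).
by apply: natural_traj => //; exact: measurable_superlevel.
Qed.

Lemma markov_alive (z : E) (phi : E -> R) s t : 0 <= s -> 0 <= t ->
  borel_fun phi -> (forall a, 0 <= phi a <= 1) ->
  borel_fun (transition M t (fun=> 1)) ->
  \int[P (Some z)]_w (ext0 phi (X s w) * alive (s + t) w) =
  \int[P (Some z)]_w ext0 (fun a => phi a * transition M t (fun=> 1) a) (X s w).
Proof.
move=> s0 t0 mphi phi01 mtr.
have e01 y : 0 <= ext0 phi y <= 1 by case: y => [a|] /=; rewrite ?lexx ?ler01 //; exact: phi01.
have mone : measurable_fun [set: borel (opc E)] (ext0 (fun=> 1) : borel (opc E) -> R).
  by apply: measurable_ext0; exact: measurable_cst.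
have one01 (y : opc E) : 0 <= ext0 (fun=> 1 : R) y <= 1 by case: y => [a|] /=; rewrite ?lexx ?ler01.
have bal : bounded_mfun (fun w => alive t w : R).
  by split; [exact: measurable_alive | exists 1 => w; case/andP: (alive_ge0_le1 t w) => a b; rewrite ger0_norm].
pose h (y : opc E) := \int[P y]_v alive t v.
have mh : measurable_fun [set: borel (opc E)] (h : borel (opc E) -> R).
  by apply: measurable_Rint_Pr => // y; case/andP: (one01 y).
have h01 y : 0 <= h y <= 1.
  rewrite /h Rintegral_ge0 /=; last by move=> w _; case/andP: (alive_ge0_le1 t w).
  rewrite -[leRHS](Rintegral_probability1 (P y)).
  apply: ler_Rintegral_ae; [exact: bal|exact: bounded_mfun_cst|].
  by apply: aeW => w; case/andP: (alive_ge0_le1 t w).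
transitivity (\int[P (Some z)]_w (ext0 phi (X s w) * h (X s w))).
  apply: Rintegral_weight_eq => //.
  - exact: measurable_ext0_traj.
  - by apply: measurable_alive; rewrite addr_ge0.
  - by move=> w; exact: alive_ge0_le1.
  - exact: (measurableT_comp mh (measurable_traj hM s0)).
  - move=> c c0; apply: (markov_fun hM (Some z) t0 s0 _ mone one01).
    apply: natural_filtration_sub; apply: natural_superlevel_traj => //.
    exact: measurable_ext0.
apply: eq_Rintegral => w _; case: (X s w) => [a|] /=; last by rewrite mul0r.
by rewrite /h transition_alive.
Qed.

End Process.

Lemma bounded_mfun01 (R : realType) d (T : measurableType d) (f : T -> R) :
  measurable_fun setT f -> (forall x, 0 <= f x <= 1) -> bounded_mfun f.
Proof.
by move=> mf f01; split => //; exists 1 => w'; case/andP: (f01 w') => a b; rewrite ger0_norm.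
Qed.

Lemma ge0_le1M (R : realType) (a b : R) : 0 <= a <= 1 -> 0 <= b <= 1 -> 0 <= a * b <= 1.
Proof.
by move=> /andP[a0 a1] /andP[b0 b1]; rewrite mulr_ge0 //= -[leRHS]mulr1 ler_pM.
Qed.

Lemma Rintegral_ge0_le1 (R : realType) d (T : measurableType d) (Q : probability T R) (f : T -> R) :
  measurable_fun setT f -> (forall x, 0 <= f x <= 1) -> 0 <= \int[Q]_x f x <= 1.
Proof.
move=> mf f01; rewrite Rintegral_ge0 /=; last by move=> w' _; case/andP: (f01 w').
rewrite -[leRHS](Rintegral_probability1 Q).
apply: ler_Rintegral_ae; [exact: bounded_mfun01|exact: bounded_mfun_cst|].
by apply: aeW => w'; case/andP: (f01 w').
Qed.


Section Killing.
Context {R : realType} {E : pmetricType R}.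
Variables (M : process E) (hM : hunt M).
Local Notation Om := (Omega M).
Local Notation X := (traj M).
Local Notation P := (Pr M).
Local Notation theta := (time_shift M).
Local Notation F0 := (@natural_filtration R E M).
Local Notation FF := (@filtration R E M).
Implicit Types (s t r u : R) (w : Om) (x y : opc E) (B Lam : set Om).
Variables (A : R -> Om -> \bar R) (pA : pcaf A).

(** The multiplicative functional M_u = exp(- A_u) 1_{u < zeta} that defines the subprocess. *)
Definition survival u w : R := expN (A u w) * alive u w.

(** What the defining set of the additive functional provides for a single path. That set is stable
    under shifts, so A is nonnegative along shifted paths, and additivity then makes it
    nondecreasing. *)
Record regular_path w : Prop := {
  rp_0 : A 0 w = 0%E;
  rp_le : forall s t, 0 <= s -> s <= t -> (A s w <= A t w)%E;
  rp_fin : forall t, 0 <= t -> (t%:E < zeta w)%E -> (A t w < +oo)%E;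
  rp_cont : {within `[0, +oo[, continuous (A ^~ w)};
  rp_ge0_shift : forall s t, 0 <= s -> 0 <= t -> (0 <= A t (theta s w))%E;
  rp_add : forall s t, 0 <= s -> 0 <= t ->
    A (s + t) w = (A s w + A t (theta s w))%E }.

Lemma regular_path_ge0 w t : regular_path w -> 0 <= t -> (0 <= A t w)%E.
Proof. by move=> rw t0; rewrite -(rp_0 rw); exact: rp_le. Qed.

Lemma regular_path_ae (z : E) : {ae P (Some z), forall w, regular_path w}.
Proof.
have [Lam [FL PL thL HL]] := pcaf_defining_set pA.
have mL := filtration_measurable hM FL.
apply: filterS (probability1_ae mL (PL z)) => w Lw.
have [[A0 Age0] Afin Acont _ Aadd] := HL w Lw.
have th0 s t : 0 <= s -> 0 <= t -> (0 <= A t (theta s w))%E.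
  by move=> s0 t0; have [[_ h] _ _ _ _] := HL _ (thL s w s0 Lw); exact: h.
have add s t : 0 <= s -> 0 <= t -> A (s + t) w = (A s w + A t (theta s w))%E.
  by move=> s0 t0; rewrite addrC Aadd.
split => // s t s0 st; rewrite -[t](subrK s) addrC add ?subr_ge0 //.
by rewrite leeDl // th0 // subr_ge0.
Qed.

Lemma measurable_pcaf t : 0 <= t -> measurable_fun setT (A t).
Proof.
by move=> t0 _ B mB; rewrite setTI; apply: (filtration_measurable hM); exact: pcaf_adapted.
Qed.

Lemma filtration_superlevel_expN t c : 0 <= t -> FF t%:E [set w | c <= expN (A t w)].
Proof.
move=> t0; rewrite -[X in FF _ X]/(A t @^-1` [set a | c <= expN a]).
by apply: pcaf_adapted => //; apply: measurable_superlevel; exact: measurable_expN.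
Qed.

Lemma survival_ge0_le1 u w : 0 <= survival u w <= 1.
Proof.
have /andP[a b] := expN_ge0_le1 (A u w); have /andP[c d] := alive_ge0_le1 u w.
by rewrite /survival mulr_ge0 //= -[leRHS]mulr1 ler_pM.
Qed.

Lemma measurable_survival u : 0 <= u -> measurable_fun setT (survival u).
Proof.
move=> u0; apply: measurable_funM; last exact: measurable_alive.
exact: (measurableT_comp measurable_expN (measurable_pcaf u0)).
Qed.

Lemma filtration_superlevel_survival t c : 0 <= t -> 0 < c ->
  FF t%:E [set w | c <= survival t w].
Proof.
move=> t0 c0.
rewrite (_ : [set w | _] = [set w | c <= expN (A t w)] `&` X t @^-1` (~` [set None])).
  apply: filtration_setI_natural; first exact: filtration_superlevel_expN.
  by apply: natural_traj => //; apply: measurableC; exact: measurable_None.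
apply/seteqP; split => w /=; rewrite /survival alive_traj; case: (X t w) => [a|].
- by rewrite mulr1.
- by rewrite mulr0 leNgt c0.
- by rewrite mulr1 => -[].
- by move=> [_]; case.
Qed.

Lemma survival_le w u v : regular_path w -> 0 <= u -> u <= v ->
  survival v w <= survival u w.
Proof.
move=> rw u0 uv;
have /andP[a b] := expN_ge0_le1 (A v w); have /andP[c d] := alive_ge0_le1 v w.
apply: ler_pM => //; last exact: alive_le.
by apply: expN_le; [exact: regular_path_ge0 | exact: rp_le].
Qed.

(** Multiplicativity gives M_(s+t) = exp(- A_s) times M_t of the shifted path. The weights phi(X_s)
    and exp(- A_s) are reduced to events of F_s by two uses of [Rintegral_weight_eq], after which
    [markov_functional] replaces the last factor by S(X_s). *)
Lemma markov_survival (z : E) (phi S : E -> R) s t : 0 <= s -> 0 <= t ->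
  borel_fun phi -> (forall a, 0 <= phi a <= 1) ->
  borel_fun S -> (forall a, S a = \int[P (Some a)]_w survival t w) ->
  \int[P (Some z)]_w (ext0 phi (X s w) * survival (s + t) w) =
  \int[P (Some z)]_w (ext0 (fun a => phi a * S a) (X s w) * survival s w).
Proof.
move=> s0 t0 mphi phi01 mS SE; have st0 := addr_ge0 s0 t0.
pose h (y : opc E) := \int[P y]_w survival t w.
have mh : measurable_fun [set: borel (opc E)] (h : borel (opc E) -> R).
  apply: measurable_fun_opc; rewrite (_ : _ \o _ = S) //.
  by apply/funext => a; rewrite SE.
have h01 y : 0 <= h y <= 1.
  apply: Rintegral_ge0_le1; [exact: measurable_survival | exact: survival_ge0_le1].
(* A version of M_t of the shifted path whose measurability is visible. While X_(s+t) is in E both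
   values of A are finite, so the difference is a genuine one; otherwise the second factor
   vanishes. *)
pose W w := expN (A (s + t) w - A s w)%E * alive (s + t) w.
have mW : measurable_fun setT W.
  apply: measurable_funM; last exact: measurable_alive.
  apply: (measurableT_comp measurable_expN).
  by apply: emeasurable_funB; exact: measurable_pcaf.
have W01 w : 0 <= W w <= 1.
  by apply: ge0_le1M; [exact: expN_ge0_le1 | exact: alive_ge0_le1].
have aliveS w : alive (s + t) w = alive t (theta s w).
  by rewrite /alive (hunt_shift hM) // addrC.
have finA w u : regular_path w -> 0 <= u -> X u w <> None -> exists2 r, 0 <= r & A u w = r%:E.
  move=> rw u0 /(zeta_gtP hM w u0) uz; have := rp_fin rw u0 uz.
  have := regular_path_ge0 rw u0.
  by case: (A u w) => // r r0 _; exists r.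
have key w : regular_path w -> X (s + t) w <> None ->
    exists a b, [/\ 0 <= a, 0 <= b, A s w = a%:E, A t (theta s w) = b%:E & A (s + t) w = (a + b)%:E].
  move=> rw XN; have [a a0 ea] : exists2 r, 0 <= r & A s w = r%:E.
    apply: finA => // h'; apply: XN.
    by apply: (traj_None_le hM s0 _ h'); rewrite lerDl.
  have [r r0 er] := finA w (s + t) rw st0 XN.
  have := rp_add rw s0 t0; have := rp_ge0_shift rw s0 t0; rewrite er ea.
  by case: (A t (theta s w)) => // b b0 [rab]; exists a, b; rewrite -rab.
have WZ : {ae P (Some z), forall w, W w = survival t (theta s w)}.
  apply: filterS (regular_path_ae z) => w rw.
  rewrite /W /survival -aliveS alive_traj; case e : (X (s + t) w) => [c|]; last by rewrite !mulr0.
  have [|a [b [a0 b0 -> -> ->]]] := key w rw; first by rewrite e.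
  by rewrite -EFinB addrAC subrr add0r.
have MW : {ae P (Some z), forall w, survival (s + t) w = expN (A s w) * W w}.
  apply: filterS (regular_path_ae z) => w rw.
  rewrite /W /survival alive_traj; case e : (X (s + t) w) => [c|]; last by rewrite !mulr0.
  have [|a [b [a0 b0 -> _ ->]]] := key w rw; first by rewrite e.
  by rewrite -EFinB addrAC subrr add0r expND // !mulr1.
have e01 y : 0 <= ext0 phi y <= 1 by case: y => [a|] /=; rewrite ?lexx ?ler01 //; exact: phi01.
have mephi := measurable_ext0_traj hM s0 mphi.
have mexp u : 0 <= u -> measurable_fun setT (fun w => expN (A u w)).
  by move=> u0; exact: (measurableT_comp measurable_expN (measurable_pcaf u0)).
have mhX : measurable_fun setT (fun w => h (X s w)).
  exact: (measurableT_comp mh (measurable_traj hM s0)).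
have prod (f : Om -> R) : measurable_fun setT f -> (forall w, 0 <= f w <= 1) ->
    measurable_fun setT (fun w => expN (A s w) * f w) /\
    (forall w, 0 <= expN (A s w) * f w <= 1).
  move=> mf f01; split; first by apply: measurable_funM => //; exact: mexp.
  by move=> w; apply: ge0_le1M => //; exact: expN_ge0_le1.
have [mEW EW01] := prod W mW W01.
have [mEh Eh01] := prod (fun w => h (X s w)) mhX (fun w => h01 (X s w)).
transitivity (\int[P (Some z)]_w (ext0 phi (X s w) * (expN (A s w) * W w))).
  apply: ae_eq_Rintegral => //.
  - by apply: measurable_funM => //; exact: measurable_survival.
  - exact: measurable_funM.
  - by apply: filterS MW => w -> _.
transitivity (\int[P (Some z)]_w (ext0 phi (X s w) * (expN (A s w) * h (X s w)))).
  apply: Rintegral_weight_eq => // c c0.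
  set B := [set w | c <= ext0 phi (X s w)].
  have FB : F0 s%:E B by apply: natural_superlevel_traj => //; exact: measurable_ext0.
  have mB : measurable B := natural_measurable hM FB.
  have mk (f : Om -> R) : \int[P (Some z)]_(w in B) (expN (A s w) * f w) =
      \int[P (Some z)]_w (expN (A s w) * (\1_B w * f w)).
    rewrite Rintegral_mkcond; apply: eq_Rintegral => w _.
    by rewrite patchE indicE; case: ifPn => _; rewrite ?mul1r ?mul0r ?mulr0.
  have i01 (f : Om -> R) : (forall w, 0 <= f w <= 1) -> forall w, 0 <= \1_B w * f w <= 1.
    by move=> f01 w; rewrite indicE; case: (_ \in _); rewrite ?mul1r ?mul0r ?lexx ?ler01.
  rewrite !mk; apply: Rintegral_weight_eq => //.
  - exact: mexp.
  - by move=> w; exact: expN_ge0_le1.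
  - by apply: measurable_funM => //; exact: measurable_indic.
  - exact: i01.
  - by apply: measurable_funM => //; exact: measurable_indic.
  - by apply: i01 => w; exact: h01.
  move=> c' c'0; set C := [set w | c' <= expN (A s w)].
  have mkI (f : Om -> R) : \int[P (Some z)]_(w in C) (\1_B w * f w) =
      \int[P (Some z)]_(w in C `&` B) f w.
    rewrite Rintegral_mkcondr; apply: eq_Rintegral => w _.
    by rewrite patchE indicE; case: ifPn => _; rewrite ?mul1r ?mul0r.
  rewrite !mkI; apply: (@markov_functional _ _ _ hM (Some z) s _ (survival t)) => //.
  - by apply: filtration_setI_natural => //; exact: filtration_superlevel_expN.
  - by move=> w; exact: survival_ge0_le1.
  - exact: measurable_survival.
  - move=> c1 c10; apply: filtration_le (filtration_superlevel_survival t0 c10).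
    by rewrite leey.
apply: eq_Rintegral => w _; rewrite /survival alive_traj.
case: (X s w) => [a|] /=; last by rewrite !mul0r.
by rewrite /h -SE; ring.
Qed.

Lemma survival_alive0_ae (z : E) : {ae P (Some z), forall w, survival 0 w = 1}.
Proof.
apply: filterS2 (regular_path_ae z) (ae_start hM (Some z)) => w rw X0.
by rewrite /survival alive_traj X0 (rp_0 rw) expN_fin // oppr0 expR0 mulr1.
Qed.

End Killing.

Lemma continuous_borel_fun (R : realType) (E : pmetricType R) (f : E -> R) :
  continuous f -> borel_fun f.
Proof.
move=> /continuousP cf; apply: (measurability _ (RGenOpens.measurableE R)).
move=> _ [_ [a [b ->] <-]]; rewrite setTI; apply: sub_sigma_algebra.
by apply: cf; exact: interval_open.
Qed.

Section Subprocess.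
Context {R : realType} {E : pmetricType R}.
Variables (X Xr : process E) (hX : hunt X) (hXr : hunt Xr).
Variables (A : R -> Omega Xr -> \bar R) (pA : pcaf A).
Hypotheses (subX : subprocess X A) (sfX : strong_feller X).
Implicit Types (s t u : R) (z : E) (phi f : E -> R).

Lemma subprocessE z t f : 0 < t -> bounded_borel f -> (forall a, 0 <= f a) ->
  transition X t f z = \int[Pr Xr (Some z)]_w (ext0 f (traj Xr t w) * survival A t w).
Proof.
move=> t0 bf f0; have [mf _] := bf; have t0' := ltW t0.
rewrite subX // /Rintegral integral_mkcond; congr fine.
have e0 y : 0 <= ext0 f y by case: y.
apply: ge0_ae_eq_integral_nonmeasurable.
- move=> w; rewrite patchE; case: ifP => // _; rewrite lee_fin mulr_ge0 //.
  by apply: fine_ge0; exact: expeR_ge0.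
- by move=> w; rewrite lee_fin mulr_ge0 //; case/andP: (survival_ge0_le1 A t w).
- apply/measurable_EFinP/measurable_funM; first exact: measurable_ext0_traj.
  exact: measurable_survival.
- apply: filterS (regular_path_ae hXr pA z) => w rw.
  rewrite patchE /survival alive_traj; case: ifPn => [/set_mem /= | /negP h].
    move=> tz; have := (zeta_gtP hXr w t0').1 tz.
    case e : (traj Xr t w) => [a|] // _; rewrite mulr1.
    by rewrite -expNE ?(regular_path_ge0 rw) //= mulrC.
  case e : (traj Xr t w) => [a|]; last by rewrite /= mul0r.
  by exfalso; apply: h; apply/mem_set/(zeta_gtP hXr w t0'); rewrite e.
Qed.

Lemma transition1E z t : 0 < t ->
  transition X t (fun=> 1) z = \int[Pr Xr (Some z)]_w survival A t w.
Proof.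
move=> t0; rewrite subprocessE //; last first.
  by split; [exact: measurable_cst | exists 1 => _; rewrite normr1].
apply: eq_Rintegral => w _; rewrite /survival alive_traj.
by case: (traj Xr t w) => [a|] /=; rewrite ?mulr0 ?mul1r.
Qed.

Lemma borel_transition1 t : 0 < t -> borel_fun (transition X t (fun=> 1)).
Proof.
move=> t0; apply: continuous_borel_fun; apply: (sfX t0 _).1.
by split; [exact: measurable_cst | exists 1 => _; rewrite normr1].
Qed.

Lemma one_time_marginal z s phi : 0 <= s -> borel_fun phi -> (forall a, 0 <= phi a <= 1) ->
  \int[Pr X (Some z)]_w ext0 phi (traj X s w) =
  \int[Pr Xr (Some z)]_w (ext0 phi (traj Xr s w) * survival A s w).
Proof.
move=> s0 mphi phi01; move: s0; rewrite le_eqVlt => /predU1P[<-|s0].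
  (* [subprocess] speaks of positive times only. At time 0 both means equal phi(z), since M_0 = 1
     almost surely. *)
  transitivity (\int[Pr X (Some z)]_w (phi z)).
    apply: ae_eq_Rintegral => //; first exact: measurable_ext0_traj.
    by apply: filterS (ae_start hX (Some z)) => w -> _.
  rewrite Rintegral_probability1 -[LHS](Rintegral_probability1 (Pr Xr (Some z))).
  apply: ae_eq_Rintegral => //.
    by apply: measurable_funM; [exact: measurable_ext0_traj|exact: measurable_survival].
  apply: filterS2 (ae_start hXr (Some z)) (survival_alive0_ae hXr pA z) => w -> -> _.
  by rewrite mulr1.
rewrite -transitionE ?ltW // subprocessE //; last by move=> a; case/andP: (phi01 a).
by split => //; exists 1 => a; case/andP: (phi01 a) => ? ?; rewrite ger0_norm.
Qed.

(** Conditioning [X] at time s leaves the one-time function phi p_t 1, which [one_time_marginal]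
    carries over to [Xres]. There p_t 1 is the mean of M_t, and [markov_survival] restores the
    second time. *)
Lemma two_time_marginal z s t phi : 0 <= s -> 0 < t -> borel_fun phi ->
  (forall a, 0 <= phi a <= 1) ->
  \int[Pr X (Some z)]_w (ext0 phi (traj X s w) * alive (s + t) w) =
  \int[Pr Xr (Some z)]_w (ext0 phi (traj Xr s w) * survival A (s + t) w).
Proof.
move=> s0 t0 mphi phi01; have t0' := ltW t0; have mt := borel_transition1 t0.
rewrite markov_alive // one_time_marginal //.
- by rewrite (markov_survival hXr pA z s0 t0' mphi phi01 mt) // => a; exact: transition1E.
- exact: measurable_funM.
- move=> a; apply: ge0_le1M => //; rewrite transition1E //.
  by apply: Rintegral_ge0_le1; [exact: measurable_survival|exact: survival_ge0_le1].
Qed.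

End Subprocess.

(** * Left limit at the lifetime and exit times *)

Section Topology.
Context {R : realType} {E : pmetricType R}.
Hypothesis E_lc : locally_compact [set: E].

Lemma closed_compact (C : set E) : compact C -> closed C.
Proof. by apply: compact_closed; exact: metric_hausdorff. Qed.

Lemma opc_hausdorff : hausdorff_space (opc E).
Proof. by apply: one_point_compactification_hausdorff => //; exact: metric_hausdorff. Qed.

Lemma ext0_continuous (phi : E -> R) : C0 phi -> continuous (ext0 phi : opc E -> R).
Proof.
move=> [cphi Kphi] [a|] U /= UV; first exact: cphi.
exists (suppf phi) => [|y [[a /= na <-]|->]].
- by split => //; exact: closed_closure.
- rewrite /preimage /=; have [a0|a0] := eqVneq (phi a) 0.
    by move: UV => /nbhs_singleton; rewrite a0.
  by exfalso; apply: na; apply: subset_closure.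
- exact: nbhs_singleton.
Qed.

Lemma open_setC_Some (C : set E) : compact C -> open (~` (Some @` C) : set (opc E)).
Proof.
move=> cC; have clC := closed_compact cC; rewrite openE => -[a|] /= h.
  have : nbhs a (~` C).
    by apply: open_nbhs_nbhs; split; [exact: closed_openC | move=> Ca; apply: h; exists a].
  by rewrite /interior /nbhs /=; apply: filterS => b nCb [c Cc [cb]]; apply: nCb; rewrite -cb.
exists C => // y [[b nCb <-]|->] /=; last by case.
by move=> [c Cc [cb]]; apply: nCb; rewrite -cb.
Qed.

Variables (K : nat -> set E) (K_exh : exhaustion K).

Lemma exhaustion_le n m : (n <= m)%N -> K n `<=` K m.
Proof.
case: K_exh => _ Ki _; move=> /subnK <-; elim: (m - n)%N => // d IH.
by apply: subset_trans IH _; rewrite addSn; exact: subset_trans (Ki _) (@interior_subset _ _).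
Qed.

Lemma exhaustion_interior (a : E) : exists n, interior (K n) a.
Proof.
case: K_exh => _ Ki KT; have [n _ Kna] : (\bigcup_n K n) a by rewrite KT.
by exists n.+1; exact: Ki.
Qed.

Lemma exhaustion_compact (C : set E) : compact C ->
  exists n0, forall n, (n0 <= n)%N -> C `<=` interior (K n).
Proof.
move=> /compact_near_coveringP cC.
have [|n0 _ h] := cC nat \oo (fun n a => interior (K n) a) _.
  move=> a _; have [n na] := exhaustion_interior a.
  exists (interior (K n), [set m | (n <= m)%N]).
    split; first by apply: open_nbhs_nbhs; split => //; exact: open_interior.
    by exists n.
  move=> [b m] [/= nb nm]; apply: (interiorS (exhaustion_le nm)); exact: nb.
by exists n0 => n nn a Ca; exact: h.
Qed.

End Topology.

Section Process.
Context {R : realType} {E : pmetricType R}.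
Variables (M : process E) (hM : hunt M).
Local Notation Om := (Omega M).
Local Notation X := (traj M).
Implicit Types (s t r u : R) (w : Om) (x y : opc E) (B Lam : set Om).
Hypothesis E_lc : locally_compact [set: E].

(* Junk value when [zeta w] is 0 or +oo. *)
Definition left_end w : opc E := lim (X u w @[u --> (fine (zeta w))^'-]).

Lemma left_end_cvg w z : zeta w = z%:E -> 0 < z -> X u w @[u --> z^'-] --> left_end w.
Proof.
move=> wz z0; have [l hl] := hunt_left_lim hM w z0.
rewrite /left_end wz /=; have -> // : lim (X u w @[u --> z^'-]) = l.
by apply: cvg_lim => //; exact: opc_hausdorff.
Qed.

Definition grid s t N i : R := s + i%:R * (t / N.+1%:R).

Lemma grid_ge0 s t N i : 0 <= s -> 0 <= t -> 0 <= grid s t N i.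
Proof. by move=> s0 t0; rewrite addr_ge0 // mulr_ge0 // divr_ge0. Qed.

Lemma gridS s t N i : grid s t N i.+1 = grid s t N i + t / N.+1%:R.
Proof. by rewrite /grid -addn1 natrD mulrDl mul1r addrA. Qed.

Lemma grid0 s t N : grid s t N 0 = s.
Proof. by rewrite /grid mul0r addr0. Qed.

Lemma grid_last s t N : grid s t N N.+1 = s + t.
Proof. by rewrite /grid mulrCA divff ?mulr1 // pnatr_eq0. Qed.

Lemma grid_le s t N i j : 0 <= t -> (i <= j)%N -> grid s t N i <= grid s t N j.
Proof.
by move=> t0 ij; rewrite lerD2l ler_wpM2r ?ler_nat // divr_ge0.
Qed.

(** Left-endpoint Stieltjes sum for the integral of phi(X) against - dD over [s, s + t]; D will be
    [alive] or [survival A]. *)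
Definition rsum (D : R -> Om -> R) (phi : E -> R) s t N w : R :=
  \sum_(i < N.+1) ext0 phi (X (grid s t N i) w) *
    (D (grid s t N i) w - D (grid s t N i.+1) w).

Lemma sum_decrements (D : R -> Om -> R) s t N w :
  \sum_(i < N.+1) (D (grid s t N i) w - D (grid s t N i.+1) w) = D s w - D (s + t) w.
Proof.
rewrite -(big_mkord xpredT (fun i => D (grid s t N i) w - D (grid s t N i.+1) w)).
rewrite -[LHS]opprK -sumrN; under eq_bigr do rewrite opprB.
by rewrite telescope_sumr // grid0 grid_last opprB.
Qed.

Lemma rsum_alive_ge0_le (phi : E -> R) s t N w : 0 <= s -> 0 <= t ->
  (forall a, 0 <= phi a <= 1) -> 0 <= rsum (@alive R E M) phi s t N w <= 1.
Proof.
move=> s0 t0 phi01.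
have e01 y : 0 <= ext0 phi y <= 1 by case: y => [a|] /=; rewrite ?lexx ?ler01 //; exact: phi01.
have dec i : 0 <= alive (grid s t N i) w - alive (grid s t N i.+1) w.
  by rewrite subr_ge0 (alive_le hM) ?grid_ge0 ?grid_le.
rewrite /rsum sumr_ge0 /=; last by move=> i _; rewrite mulr_ge0 //; case/andP: (e01 (X (grid s t N i) w)).
apply: (@le_trans _ _ (alive s w - alive (s + t) w)).
  rewrite -(sum_decrements (@alive R E M) s t N) ler_sum // => i _; rewrite ler_piMl //.
  by case/andP: (e01 (X (grid s t N i) w)).
have /andP[a0 a1] := alive_ge0_le1 s w; have /andP[b0 b1] := alive_ge0_le1 (s + t) w.
by rewrite lerBlDr (le_trans a1) // lerDl.
Qed.

Lemma measurable_rsum (D : R -> Om -> R) (phi : E -> R) s t N : 0 <= s -> 0 <= t ->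
  borel_fun phi -> (forall u, 0 <= u -> measurable_fun setT (D u)) ->
  measurable_fun setT (rsum D phi s t N).
Proof.
move=> s0 t0 mphi mD; apply: measurable_sum => i.
apply: measurable_funM; first by apply: measurable_ext0_traj => //; exact: grid_ge0.
by apply: measurable_funB; apply: mD; exact: grid_ge0.
Qed.

(** Only the interval containing the lifetime has a nonzero decrement. Its left endpoint is strictly
    before zeta and within one mesh of it, so the path there tends to the left limit. When
    [left_end] is a junk value all decrements vanish. *)
Lemma rsum_alive_cvg (phi : E -> R) s t w : 0 <= s -> 0 < t ->
  continuous (ext0 phi : opc E -> R) ->
  rsum (@alive R E M) phi s t N w @[N --> \oo] -->
    ext0 phi (left_end w) * (alive s w - alive (s + t) w).
Proof.
move=> s0 t0 cphi; set c := ext0 phi (left_end w).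
apply/cvgrPdist_le => eps eps0.
have tN0 N : 0 <= t / N.+1%:R by rewrite divr_ge0 ?ltW.
have : \forall N \near \oo, forall i, (i < N.+1)%N ->
    alive (grid s t N i) w - alive (grid s t N i.+1) w != 0 ->
    `|c - ext0 phi (X (grid s t N i) w)| <= eps.
  have step N i : alive (grid s t N i) w - alive (grid s t N i.+1) w != 0 ->
     exists z, [/\ zeta w = z%:E, grid s t N i < z & z <= grid s t N i + t / N.+1%:R].
    rewrite !alive_traj -gridS.
    have gi0 := @grid_ge0 s t N i s0 (ltW t0).
    have gi10 := @grid_ge0 s t N i.+1 s0 (ltW t0).
    case e : (X (grid s t N i) w) => [a|]; last first.
      rewrite (traj_None_le hM gi0 _ e) ?subrr ?eqxx // grid_le //; exact: ltW.
    case e' : (X (grid s t N i.+1) w) => [a'|]; first by rewrite subrr eqxx.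
    move=> _; have := (zeta_leP hM w gi10).2 e'.
    have : ((grid s t N i)%:E < zeta w)%E by apply/(zeta_gtP hM) => //; rewrite e.
    by case: (zeta w) => // z; rewrite lte_fin lee_fin => h1 h2; exists z.
  have [[z [wz z0]]|nz] := pselect (exists z, zeta w = z%:E /\ 0 < z); last first.
    apply: nearW => N i _ /step [z [wz zi _]]; exfalso; apply: nz; exists z; split => //.
    by apply: le_lt_trans zi; apply: grid_ge0 => //; exact: ltW.
  have /cvgrPdist_le /(_ eps eps0) : ext0 phi (X u w) @[u --> z^'-] --> c.
    by apply: (cvg_comp _ _ (left_end_cvg wz z0)); exact: cphi.
  move=> [eta /= eta0 heta].
  near=> N => i _ /step [z' [wz' zi zi']].
  have zz' : z = z' by move: wz'; rewrite wz => -[].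
  rewrite -zz' in zi zi'; apply: heta => //=.
  rewrite gtr0_norm ?subr_gt0 // ltrBlDr (le_lt_trans zi') // addrC ltrD2r.
  near: N; have := near_infty_natSinv_lt (PosNum (divr_gt0 eta0 t0)).
  apply: filterS => N /=; rewrite ltr_pdivlMr //; congr (_ < _); exact: mulrC.
apply: filterS => N hN.
have -> : c * (alive s w - alive (s + t) w) - rsum (@alive R E M) phi s t N w =
    \sum_(i < N.+1) (c - ext0 phi (X (grid s t N i) w)) *
      (alive (grid s t N i) w - alive (grid s t N i.+1) w).
  rewrite -(sum_decrements (@alive R E M) s t N) mulr_sumr /rsum -sumrB.
  by apply: eq_bigr => i _; rewrite mulrBl.
have dec i : 0 <= alive (grid s t N i) w - alive (grid s t N i.+1) w.
  by rewrite subr_ge0 (alive_le hM) ?grid_ge0 ?grid_le // ltW.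
apply: (le_trans (ler_norm_sum _ _ _)).
apply: (@le_trans _ _ (\sum_(i < N.+1) eps *
      (alive (grid s t N i) w - alive (grid s t N i.+1) w))).
  apply: ler_sum => i _; rewrite normrM [X in _ * X]ger0_norm //.
  have [->|h] := eqVneq (alive (grid s t N i) w - alive (grid s t N i.+1) w) 0.
    by rewrite !mulr0.
  by rewrite ler_wpM2r // hN.
rewrite -mulr_sumr sum_decrements; apply: ler_piMr; first exact: ltW.
have /andP[a0 a1] := alive_ge0_le1 s w; have /andP[b0 b1] := alive_ge0_le1 (s + t) w.
by rewrite lerBlDr (le_trans a1) // lerDl.
Unshelve. all: by end_near. Qed.

End Process.

Section Process.
Context {R : realType} {E : pmetricType R}.
Variables (M : process E) (hM : hunt M).
Local Notation Om := (Omega M).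
Local Notation X := (traj M).
Local Notation P := (Pr M).
Local Notation F0 := (@natural_filtration R E M).
Implicit Types (s t r u : R) (w : Om) (x y : opc E) (B Lam : set Om).
Hypothesis E_lc : locally_compact [set: E].
Variables (K : nat -> set E) (K_exh : exhaustion K).

Lemma right_cont_open u (U : set (opc E)) w : 0 <= u -> open U -> U (X u w) ->
  exists2 d, 0 < d & forall v, u < v < u + d -> U (X v w).
Proof.
move=> u0 oU Uu; have := @hunt_right_cont _ _ _ hM w u u0.
move=> /(_ U) []; first exact: open_nbhs_nbhs.
move=> d /= d0 hd; exists d => // v /andP[uv vd]; apply: hd => //=.
by rewrite ltr0_norm ?subr_lt0 // opprB ltrBlDl.
Qed.

Definition rational_seq n : R := ratr (odflt 0 (unpickle n : option rat)).

Lemma rational_seq_dense (a b : R) : a < b -> exists n, a < rational_seq n < b.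
Proof.
move=> ab; have [q] := rat_in_itvoo ab; rewrite in_itv /= => qab.
by exists (pickle q); rewrite /rational_seq pickleK.
Qed.

Lemma F0_setC t Lam : F0 t%:E Lam -> F0 t%:E (~` Lam).
Proof. by move=> FL; rewrite -setTD; exact: sigma_algebraCD. Qed.

Lemma exit_time_ge0 (C : set E) w : (0 <= exit_time C w)%E.
Proof. by apply: le_ereal_inf_tmp => _ [t [t0 _] <-]; rewrite lee_fin ltW. Qed.

Lemma exit_time_gtP (C : set E) w u : (u%:E < exit_time C w)%E -> 0 < u -> (Some @` C) (X u w).
Proof.
move=> uC u0; apply: contrapT => h.
have : (exit_time C w <= u%:E)%E by apply: ereal_inf_lbound; exists u.
by rewrite leNgt uC.
Qed.

Lemma exit_time_lt (C : set E) w u : (exit_time C w < u%:E)%E ->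
  exists v, [/\ 0 < v, v < u & ~ (Some @` C) (X v w)].
Proof.
move=> /ereal_inf_lt [_ [v [v0 nC] <-]]; rewrite lte_fin => vu.
by exists v.
Qed.

(** The complement of a compact set is open, so by right continuity an exit before a given time is
    witnessed at a rational time. The event tau <= t depends on the path just after t: it is placed
    in F^0_s for every s > t, through times b_n in ]t, s] decreasing to t, and right continuity of
    the filtration concludes. *)
Lemma exit_time_stopping (C : set E) : compact C -> stopping_time (@exit_time R E M C).
Proof.
move=> cC; split; first exact: exit_time_ge0.
have oC := open_setC_Some cC.
move=> t t0; apply: (hunt_filtration_right_cont hM t0) => s /= ts.
apply: natural_filtration_sub.
pose b n : R := t + (s - t) / n.+1%:R.
have tb n : t < b n by rewrite ltrDl divr_gt0 // subr_gt0.
have bs n : b n <= s.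
  rewrite -lerBrDl ler_pdivrMr ?ltr0n //; apply: ler_peMr; first by rewrite subr_ge0 ltW.
  by rewrite ler1n.
rewrite (_ : [set w | _] = ~` \bigcup_n ~` \bigcup_m
    (if 0 < rational_seq m < b n then X (rational_seq m) @^-1` (~` (Some @` C)) else set0)).
  apply: F0_setC; apply: sigma_algebra_bigcup => n; apply: F0_setC.
  apply: sigma_algebra_bigcup => m; case: ifPn => [/andP[q0 qb]|_]; last exact: sigma_algebra0.
  apply: natural_traj; [exact: ltW| |exact: sub_sigma_algebra].
  by rewrite lee_fin (le_trans (ltW qb)).
apply/seteqP; split => w /=.
  move=> tau [n _]; apply.
  have [v [v0 vb nC]] : exists v, [/\ 0 < v, v < b n & ~ (Some @` C) (X v w)].
    by apply: exit_time_lt; apply: le_lt_trans tau _; rewrite lte_fin.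
  have [d d0 hd] := right_cont_open (ltW v0) oC nC.
  have [|m /andP[vm mb]] := @rational_seq_dense v (Num.min (b n) (v + d)).
    by rewrite lt_min vb ltrDl.
  move: mb; rewrite lt_min => /andP[mb md].
  by exists m => //; rewrite (lt_trans v0 vm) mb; apply: hd; rewrite vm md.
move=> h; apply/lee_addgt0Pr => eps eps0.
have [n hn] : exists n, b n < t + eps.
  have st0 : 0 <= (s - t) / eps by rewrite divr_ge0 // ?subr_ge0 ltW.
  exists (Num.bound ((s - t) / eps)); rewrite ltrD2l ltr_pdivrMr ?ltr0n // mulrC -ltr_pdivrMr //.
  by rewrite (lt_le_trans (archi_boundP st0)) // ler_nat.
have [m _] : (\bigcup_m (if 0 < rational_seq m < b n then
    X (rational_seq m) @^-1` (~` (Some @` C)) else set0)) w.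
  by apply: contrapT => h'; apply: h; exists n.
case: ifPn => [/andP[q0 qb] nC|//].
apply: (@le_trans _ _ (rational_seq m)%:E); first by apply: ereal_inf_lbound; exists (rational_seq m).
by rewrite lee_fin (le_trans (ltW qb)) // ltW.
Qed.

(* Quasi-left-continuity at the supremum of the exit times: the path cannot
   accumulate at the cemetery before the lifetime. *)
Lemma exit_times_exhaust_ae x : {ae P x, forall w, forall r, 0 <= r -> (r%:E < zeta w)%E ->
  exists n, (r%:E < exit_time (K n) w)%E}.
Proof.
have [Kc Ki KT] := K_exh.
have stn n : stopping_time (@exit_time R E M (K n)) by exact: exit_time_stopping.
have mon n w : (exit_time (K n) w <= exit_time (K n.+1) w)%E.
  apply: ereal_inf_le_tmp => _ [t [t0 h] <-]; exists t => //; split => // -[a Ka ea].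
  by apply: h; exists a => //; exact: (exhaustion_le K_exh (leqnSn n)).
have := hunt_quasi_left_cont hM stn mon (fun w => erefl) x.
apply: filterS => w hw r r0 rz; apply: contrapT => hn.
have le n : (exit_time (K n) w <= r%:E)%E by rewrite leNgt; apply/negP => h; apply: hn; exists n.
set sig := ereal_sup (range ((fun n => @exit_time R E M (K n))^~ w)) in hw.
have sr : (sig <= r%:E)%E by apply: ge_ereal_sup => _ [n _ <-].
have s0 : (0 <= sig)%E.
  by apply: le_trans (exit_time_ge0 (K 0) w) _; apply: ereal_sup_ubound; exists 0.
have {}hw := hw (le_lt_trans sr (ltry r)).
(* At its exit time from [K n] a right-continuous path cannot be in the interior of [K n]. If all
   exit times were at most r, these positions would tend to the cemetery, and quasi-left-continuity
   would put the path there at a time at most r < zeta. *)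
have pN : path_at (@exit_time R E M (K n)) w @[n --> \oo] --> (None : opc E).
  move=> V [C [cC _] CV].
  have [n0 hn0] := exhaustion_compact K_exh cC.
  exists n0 => // n /= nn; apply: CV; rewrite /path_at.
  case e : (exit_time (K n) w) (le n) (exit_time_ge0 (K n) w) => [u| |] //.
  rewrite !lee_fin => ur u0; case eX : (X u w) => [a|]; last by right.
  left; exists a => // Ca; have ia := hn0 n nn a Ca.
  have [||d d0 hd] := @right_cont_open u (Some @` (interior (K n))) w u0.
  - by apply: one_point_compactification_open_some; exact: open_interior.
  - by rewrite eX; exists a.
  have [|v [v0 vud nK]] := @exit_time_lt (K n) w (u + d); first by rewrite e lte_fin ltrDl.
  have [vu|uv|vu] := ltgtP v u.
  - suff : (u%:E <= v%:E)%E by rewrite lee_fin leNgt vu.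
    by rewrite -e; apply: ereal_inf_lbound; exists v.
  - apply: nK; have [b ib <-] := hd v ltac:(by rewrite uv vud).
    by exists b => //; exact: interior_subset.
  - by apply: nK; rewrite vu eX; exists a => //; exact: interior_subset.
have pE : path_at (fun w => ereal_sup (range ((fun n => @exit_time R E M (K n))^~ w))) w = None.
  by apply: (cvg_unique _ hw pN); exact: opc_hausdorff.
move: pE; rewrite /path_at -/sig; case: sig s0 sr {hw} => [u| |] //; rewrite !lee_fin => u0 ur XN.
by move: rz; rewrite ltNge; apply/negP; rewrite negbK; apply/(zeta_leP hM) => //; apply: traj_None_le XN.
Qed.

Lemma trapped_in_exhaustion_ae x : {ae P x, forall w, forall r, 0 <= r -> (r%:E < zeta w)%E ->
  exists n0, forall n, (n0 <= n)%N -> forall u, 0 < u -> u <= r ->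
    exists2 a, K n a & X u w = Some a}.
Proof.
apply: filterS (exit_times_exhaust_ae x) => w h r r0 rz.
have [n0 hn0] := h r r0 rz; exists n0 => n nn u u0 ur.
have [|a Ka ea] := @exit_time_gtP (K n0) w u _ u0; first exact: le_lt_trans hn0.
by exists a => //; exact: (exhaustion_le K_exh nn).
Qed.

Lemma zeta_le_measurable t : 0 <= t -> measurable [set w : Om | (zeta w <= t%:E)%E].
Proof.
move=> t0; rewrite (_ : [set w | _] = X t @^-1` [set None]).
  rewrite -[X in measurable X]setTI.
  exact: (measurable_traj hM t0 measurableT measurable_None).
by apply/seteqP; split => w /= /(zeta_leP hM w t0).
Qed.

Lemma Omega_p_measurable : measurable (@Omega_p R E M K).
Proof.
have [Kc _ _] := K_exh.
have mexit n t : 0 <= t -> measurable [set w : Om | (exit_time (K n) w <= t%:E)%E].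
  move=> t0; have [_ /(_ t t0)] := exit_time_stopping (Kc n).
  exact: (filtration_measurable hM).
apply: bigcapT_measurable => n.
rewrite (_ : [set w | _] = (\bigcup_m (if 0 <= rational_seq m then
   [set w : Om | (exit_time (K n) w <= (rational_seq m)%:E)%E] `&`
   ~` [set w : Om | (zeta w <= (rational_seq m)%:E)%E] else set0)) `&`
   \bigcup_m [set w : Om | (zeta w <= m%:R%:E)%E]).
  apply: measurableI; apply: bigcupT_measurable => m; last exact: zeta_le_measurable.
  case: ifPn => // q0; apply: measurableI; first exact: mexit.
  by apply: measurableC; exact: zeta_le_measurable.
apply/seteqP; split => w /=.
  move=> [tz zoo]; split.
    have [u [v [eu]]] : exists u v, [/\ exit_time (K n) w = u%:E, zeta w = v%:E & 0 <= u].
      have := exit_time_ge0 (K n) w; move: tz zoo.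
      case: (exit_time (K n) w) => [u| |] //; case: (zeta w) => [v| |] // _ _ u0.
      by exists u, v.
    move=> ev u0; move: tz; rewrite eu ev lte_fin => uv.
    have [m /andP[um mv]] := rational_seq_dense uv.
    exists m => //; rewrite (le_trans u0 (ltW um)); split => /=.
      by rewrite eu lee_fin ltW.
    by rewrite ev lee_fin; apply/negP; rewrite -ltNge.
  have z0 : (0 <= zeta w)%E by apply: le_ereal_inf_tmp => _ [t [t0 _] <-]; rewrite lee_fin.
  case e : (zeta w) z0 zoo => [z| |] // z0 _.
  exists (Num.bound z) => //=; rewrite e lee_fin ltW //; exact: archi_boundP.
move=> [[m _]]; case: ifPn => // q0 [/= l /negP]; rewrite -ltNge => g [k _ /= zk].
by split; [exact: le_lt_trans l g | apply: le_lt_trans zk _; rewrite ltry].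
Qed.

(** If the left limit is in E, the path is in some [K m] just before zeta, and by
    [trapped_in_exhaustion_ae] it is in some [K n0] on the rest of ]0, zeta[; it then leaves no
    larger [K n] before zeta. If the left limit is the cemetery, each [K n] is left shortly before
    zeta. *)
Lemma Omega_p_left_end_ae (z : E) : {ae P (Some z), forall w,
  Omega_p K w <-> (zeta w < +oo)%E /\ left_end w = None}.
Proof.
have [Kc Ki KT] := K_exh.
apply: filterS2 (ae_start hM (Some z)) (trapped_in_exhaustion_ae (Some z)) => w X0 hw.
have z0 : (0 < zeta w)%E by apply/(zeta_gtP hM) => //; rewrite X0.
split.
  move=> Op; have [_ zoo] := Op 0%N I.
  split => //; case e : (zeta w) z0 zoo => [zz| |] //; rewrite lte_fin => zz0 _.
  case el : (left_end w) => [a|] //; exfalso.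
  have [m ma] := exhaustion_interior K_exh a.
  have := left_end_cvg hM E_lc e zz0; rewrite el => /(_ (Some @` interior (K m))) [].
    apply: open_nbhs_nbhs; split; last by exists a.
    by apply: one_point_compactification_open_some; exact: open_interior.
  move=> d /= d0 hd.
  pose r := Num.max 0 (zz - d / 2).
  have r0 : 0 <= r by rewrite le_max lexx.
  have rz : (r%:E < zeta w)%E by rewrite e lte_fin gt_max zz0 /= ltrBlDr ltrDl divr_gt0.
  have [n0 hn0] := hw r r0 rz.
  pose n := maxn n0 m.
  have : (zeta w <= exit_time (K n) w)%E.
    apply: le_ereal_inf_tmp => _ [u [u0 nK] <-]; rewrite e lee_fin leNgt; apply/negP => uz.
    apply: nK; have [ur|ru] := leP u r.
      by have [b Kb ->] := hn0 n (leq_maxl _ _) u u0 ur; exists b.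
    have [|b ib <-] := hd u _ uz.
      rewrite /= gtr0_norm ?subr_gt0 // ltrBlDr -ltrBlDl (le_lt_trans _ ru) // le_max.
      by apply/orP; right; lra.
    by exists b => //; apply: (exhaustion_le K_exh (leq_maxr n0 m)); exact: interior_subset.
  by have [h _] := Op n I; rewrite leNgt h.
move=> [zoo el] n _; split => //.
case e : (zeta w) z0 zoo => [zz| |] //; rewrite lte_fin => zz0 _.
have := left_end_cvg hM E_lc e zz0; rewrite el => /(_ (~` (Some @` K n))) [].
  by apply: open_nbhs_nbhs; split; [exact: open_setC_Some | case].
move=> d /= d0 hd.
pose u := Num.max (zz / 2) (zz - d / 2).
have u0 : 0 < u by rewrite lt_max divr_gt0.
have uz : u < zz by rewrite gt_max ltr_pdivrMr // ltr_pMr // ltr1n /= ltrBlDr ltrDl divr_gt0.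
apply: (@le_lt_trans _ _ u%:E); last by rewrite lte_fin.
apply: ereal_inf_lbound; exists u => //; split => //.
apply: hd => //=; rewrite gtr0_norm ?subr_gt0 // ltrBlDr -ltrBlDl.
by rewrite lt_max; apply/orP; right; lra.
Qed.

End Process.

(** * Energy and killing *)

Section FiniteSupport.
Context d (T : measurableType d) (R : realType) (mu : {measure set T -> \bar R}).

Lemma bounded_support_integrable (f : T -> R) c (C : set T) : measurable C ->
  (mu C < +oo)%E -> measurable_fun setT f -> (forall x, `|f x| <= c) ->
  (forall x, ~ C x -> f x = 0) -> mu.-integrable setT (EFin \o f).
Proof.
move=> mC Coo mf fc f0.
have fE : EFin \o f = (EFin \o f) \_ C.
  apply/funext => x; rewrite patchE; case: ifPn => // /negP xC.
  by rewrite /= f0 // => Cx; apply: xC; exact/mem_set.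
rewrite fE; apply/(integrable_mkcond _ mC).
apply: (@measurable_bounded_integrable _ _ _ mu) => //.
- exact: measurable_funS mf.
- exists c; split => [|M cM x _]; first exact: num_real.
  exact: le_trans (fc x) (ltW cM).
Qed.

Lemma bounded_support_Lfun2 (f : T -> R) c (C : set T) : measurable C ->
  (mu C < +oo)%E -> measurable_fun setT f -> (forall x, `|f x| <= c) ->
  (forall x, ~ C x -> f x = 0) -> f \in Lfun mu 2%:E.
Proof.
move=> mC Coo mf fc f0; rewrite inE; apply/andP; split; rewrite inE //=.
rewrite /finite_norm unlock; apply: poweR_lty.
have : mu.-integrable setT (EFin \o (fun x => f x ^+ 2)).
  apply: (@bounded_support_integrable _ (c ^+ 2) C) => //.
  - exact: measurable_funX.
  - by move=> x; rewrite normrX ler_sqr ?nnegrE ?fc // (le_trans _ (fc x)).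
  - by move=> x /f0 ->; rewrite expr0n.
move=> /integrableP[_]; apply: le_lt_trans.
rewrite le_eqVlt; apply/orP; left; apply/eqP; apply: eq_integral => x _ /=.
by rewrite normrX powR_mulrn.
Qed.

End FiniteSupport.

Section CoreFunctions.
Context {R : realType} {E : pmetricType R}.
Hypothesis E_lc : locally_compact [set: E].
Variables (m : {measure set (borel E) -> \bar R}).
Implicit Types (e : dform E) (phi psi : E -> R).

Lemma borel_compact (C : set E) : compact C -> measurable (C : set (borel E)).
Proof.
move=> /closed_compact cC; rewrite -[X in measurable X]setCK; apply: measurableC.
by apply: sub_sigma_algebra; exact: closed_openC.
Qed.

Lemma suppf_out phi x : ~ suppf phi x -> phi x = 0.
Proof. by move=> h; apply: contrapT => /eqP x0; apply: h; apply: subset_closure. Qed.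

Variables (K : nat -> set E) (K_exh : exhaustion K).

(** The height 2 leaves room for the approximation with error 1 in [core_bump]: the approximant
    exceeds 1 on [K n], so that truncating it at 1 gives exactly 1 there. Urysohn's lemma is used in
    the one-point compactification, which is compact Hausdorff, hence normal. *)
Lemma compact_urysohn n : exists f : E -> R,
  [/\ C0 f, forall x, K n x -> f x = 2 & forall x, 0 <= f x <= 2].
Proof.
have [Kc Ki KT] := K_exh.
pose A : set (opc E) := ~` (Some @` interior (K n.+1)).
pose B : set (opc E) := Some @` K n.
have normal : normal_space (opc E).
  by apply: compact_normal; [exact: opc_hausdorff | exact: one_point_compactification_compact].
have [|||f [cf fA fB f01]] := @urysohn_ext_itv _ R normal A B 0 2 _ _ _ ltac:(by []).
- apply: open_closedC; apply: one_point_compactification_open_some; exact: open_interior.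
- apply: compact_closed; first exact: opc_hausdorff.
  apply: continuous_compact; last exact: Kc.
  by apply: continuous_subspaceT; exact: one_point_compactification_some_continuous.
- apply/seteqP; split => // y [nA [a Ka ya]]; apply: nA; exists a => //.
  exact: Ki.
exists (f \o Some); split.
- split.
    move=> x; apply: continuous_comp; last exact: cf.
    exact: one_point_compactification_some_continuous.
  have cK := closed_compact (Kc n.+1).
  apply: (subclosed_compact _ (Kc n.+1)); first exact: closed_closure.
  rewrite [X in _ `<=` X](closure_id _).1 //; apply: closureS => x /= /eqP fx.
  apply: contrapT => nK; apply: fx; apply: fA; exists (Some x) => //= -[a ia [ax]].
  by apply: nK; rewrite -ax; exact: interior_subset.
- by move=> x Kx; apply: fB; exists (Some x) => //; exists x.
- move=> x; have /f01 /= : range f (f (Some x)) by exists (Some x).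
  by rewrite in_itv.
Qed.

Lemma core_bump e n : dirichlet_form m e -> regular_form m e ->
  exists psi, [/\ dom e psi, C0 psi, forall x, 0 <= psi x <= 1 & forall x, K n x -> psi x = 1].
Proof.
move=> de [_ re]; have [f [Cf f2 f02]] := compact_urysohn n.
have [v [dv Cv] fv] := re f Cf 1 ltr01.
have [dpsi _] := df_markov de dv.
exists (fun x => Num.min (Num.max (v x) 0) 1); split => //.
- case: Cv => cv Kv; split.
    move=> x; suff : {for x, continuous ((v \max cst 0) \min cst 1)} by [].
    apply: continuous_min; last exact: cvg_cst.
    by apply: continuous_max; [exact: cv | exact: cvg_cst].
  apply: (subclosed_compact _ Kv); first exact: closed_closure.
  apply: closureS => x /=.
  by apply: contraNN => /eqP ->; rewrite maxxx min_l.
- by move=> x; rewrite le_min ge_min lexx orbT ler01 le_max lexx orbT.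
- move=> x Kx; rewrite min_r // le_max; apply/orP; left.
  by have := fv x; rewrite (f2 x Kx) ltr_norml => /andP[_]; lra.
Qed.

End CoreFunctions.

Section NoKillingEnergy.
Context {R : realType} {E : pmetricType R}.
Hypothesis E_lc : locally_compact [set: E].
Variables (m k : {measure set (borel E) -> \bar R}) (e eres : dform E).
Hypotheses (e_dir : dirichlet_form m e) (e_reg : regular_form m e).
Hypotheses (k_killing : killing_measure e k) (eres_res : resurrected_form m k e eres).
Variables (K : nat -> set E) (K_exh : exhaustion K).
Implicit Types (phi psi : E -> R).

Lemma sym_form00 (D : set (E -> R)) a : sym_form D a -> a (fun=> 0) (fun=> 0) = 0.
Proof.
move=> sa; have := sf_linear sa 1 (sf_zero sa) (sf_zero sa) (sf_zero sa).
rewrite (_ : (fun x => _) = fun=> 0); last by apply/funext => x; ring.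
by rewrite mul1r => h; lra.
Qed.

Lemma continuous_qc_version phi : continuous phi -> qc_version m eres phi phi.
Proof.
move=> cphi; split; [exact: continuous_borel_fun| |exact: aeW].
move=> eps eps0; exists set0; split; [exact: open0| |exact: continuous_subspaceT].
have sd := df_form (rf_dirichlet eres_res).
apply: (@le_lt_trans _ _ 0%E); last by rewrite lte_fin.
apply: ereal_inf_lbound; exists (fun=> 0); first by split; [exact: sf_zero sd | exact: aeW].
rewrite /energy1 (sym_form00 sd) add0r /inner; congr EFin.
by under eq_Rintegral do rewrite mulr0; rewrite Rintegral_cst // mul0r.
Qed.

(** Since psi = 1 near the support of phi, strong locality removes the local part. Where phi(x) is
    nonzero psi(x) = 1, so the product of increments takes the stated form, which is nonnegative and
    decreasing in psi. *)
Lemma resurrected_energyE : exists J : {measure set (borel E * borel E)%type -> \bar R},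
  forall phi psi (U : set E), dom e phi -> C0 phi -> dom e psi -> C0 psi ->
  (forall x, 0 <= phi x) -> (forall x, 0 <= psi x <= 1) ->
  open U -> suppf phi `<=` U -> (forall x, U x -> psi x = 1) ->
  (energy eres phi psi)%:E =
    (\int[J]_z (phi z.1 * (1 - psi z.2) + phi z.2 * (1 - psi z.1))%:E)%E.
Proof.
have [_ [ec [J [_ sl _ He]]]] := k_killing.
exists J => phi psi U dphi Cphi dpsi Cpsi phi0 psi01 oU phiU psi1.
have := He phi psi (conj dphi Cphi) (conj dpsi Cpsi).
rewrite sl //; last by exists 1, U.
rewrite add0e (eq_integral (fun z : borel E * borel E =>
    (phi z.1 * (1 - psi z.2) + phi z.2 * (1 - psi z.1))%:E)); last first.
  move=> [x y] _ /=; congr EFin.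
  have psiE a : phi a != 0 -> psi a = 1 by move=> a0; apply/psi1/phiU/subset_closure.
  have [px|/psiE ->] := eqVneq (phi x) 0; have [py|/psiE ->] := eqVneq (phi y) 0;
    rewrite ?px ?py; ring.
set IJ := (\int[J]_z _)%E; set Ik := (\int[k]_x _)%E => eE.
have IJ0 : (0 <= IJ)%E.
  apply: integral_ge0 => z _; rewrite lee_fin.
  have /andP[a b] := psi01 z.1; have /andP[c d] := psi01 z.2.
  by rewrite addr_ge0 // mulr_ge0 // subr_ge0.
have Ik0 : (0 <= Ik)%E.
  by apply: integral_ge0 => x _; rewrite lee_fin mulr_ge0 //; case/andP: (psi01 x).
have := rf_energy eres_res dphi dpsi (continuous_qc_version Cphi.1) (continuous_qc_version Cpsi.1).
rewrite /inner /Rintegral -/Ik => eE'.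
(* The jump and killing integrals are nonnegative with a finite sum, hence both finite, and the
   killing integral can be cancelled. *)
move: eE IJ0 Ik0; rewrite eE'; clear eE'.
case: IJ => [a| |]; case: Ik => [b| |] //= [h] _ _; congr EFin; lra.
Qed.

Lemma resurrected_energy_small phi eps : dom e phi -> C0 phi -> (forall x, 0 <= phi x) ->
  0 < eps -> exists psi, [/\ dom e psi, C0 psi, forall x, 0 <= psi x <= 1,
    forall x, phi x != 0 -> psi x = 1 & energy eres phi psi < eps].
Proof.
move=> dphi Cphi phi0 eps0.
have /choice[psi hpsi] : forall n, exists psi,
  [/\ dom e psi, C0 psi, forall x, 0 <= psi x <= 1 & forall x, K n x -> psi x = 1].
  by move=> n; exact: (core_bump E_lc K_exh n e_dir e_reg).
have [J HJ] := resurrected_energyE.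
have [n0 hn0] := exhaustion_compact K_exh Cphi.2.
have [_ Cpsi0 _ _] := hpsi n0.
have [n2 hn2] := exhaustion_compact K_exh Cpsi0.2.
(* From n0 on, psi_n is 1 near the support of phi; from n2 on, it is 1 on the support of psi_n0,
   hence psi_n >= psi_n0. The integrand at n0 then dominates, and it is integrable because its
   integral is an energy. *)
pose n1 := maxn n0 n2.
pose I n (z : borel E * borel E) := phi z.1 * (1 - psi n z.2) + phi z.2 * (1 - psi n z.1).
have eI n : (n0 <= n)%N -> (energy eres phi (psi n))%:E = (\int[J]_z (I n z)%:E)%E.
  move=> nn; have [d c b o] := hpsi n.
  apply: (HJ phi (psi n) (interior (K n))) => //; [exact: open_interior|exact: hn0|].
  by move=> x /interior_subset /o.
have I0 n z : 0 <= I n z.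
  have [_ _ b _] := hpsi n; have /andP[h1 h2] := b z.1; have /andP[h3 h4] := b z.2.
  by rewrite addr_ge0 // mulr_ge0 // subr_ge0.
have mI n : measurable_fun setT (I n).
  have [_ [cpsi _] _ _] := hpsi n.
  have mphi : borel_fun phi by apply: continuous_borel_fun; case: Cphi.
  have mpsi : borel_fun (psi n) by exact: continuous_borel_fun.
  apply: measurable_funD; apply: measurable_funM; try apply: measurable_funB => //.
  - exact: (measurableT_comp mphi measurable_fst).
  - exact: (measurableT_comp mpsi measurable_snd).
  - exact: (measurableT_comp mphi measurable_snd).
  - exact: (measurableT_comp mpsi measurable_fst).
have domI n z : (n1 <= n)%N -> I n z <= I n0 z.
  move=> nn; have [_ _ b o] := hpsi n.
  have le a : psi n0 a <= psi n a.
    have [sa|/suppf_out ->] := pselect (suppf (psi n0) a); last by case/andP: (b a).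
    rewrite o; last by apply: interior_subset; apply: hn2 sa; exact: leq_trans (leq_maxr _ _) nn.
    by have [_ _ b0 _] := hpsi n0; case/andP: (b0 a).
  by rewrite lerD // ler_wpM2l // lerB.
have Ioo : (\int[J]_z (I n0 z)%:E < +oo)%E by rewrite -eI // ltry.
have [|||||_ _ h] := @dominated_convergence _ _ _ J setT measurableT
   (fun n z => (I (n1 + n)%N z)%:E) (cst 0%E) (EFin \o I n0).
- by move=> n; exact/measurable_EFinP.
- exact: measurable_cst.
- apply: aeW => -[x y] _ /=.
  have [nx hx] := exhaustion_interior K_exh x.
  have [ny hy] := exhaustion_interior K_exh y.
  apply: cvg_near_cst; exists (maxn nx ny) => // n /= nn.
  have [_ _ _ o] := hpsi (n1 + n)%N.
  have one a na : interior (K na) a -> (na <= maxn nx ny)%N -> psi (n1 + n)%N a = 1.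
    move=> /interior_subset Ka nle; apply: o; apply: (exhaustion_le K_exh _ Ka).
    by rewrite (leq_trans nle) // (leq_trans nn) // leq_addl.
  rewrite /I /= (one x nx) ?leq_maxl // (one y ny) ?leq_maxr //.
  by rewrite subrr !mulr0 addr0.
- apply/integrableP; split; first exact/measurable_EFinP.
  by under eq_integral do rewrite gee0_abs ?lee_fin //.
- by apply: aeW => z n _ /=; rewrite lee_fin ger0_norm // domI // leq_addr.
rewrite /= integral0 in h.
have nN N : (n0 <= n1 + N)%N by rewrite (leq_trans (leq_maxl n0 n2)) // leq_addr.
have hE : energy eres phi (psi (n1 + n)%N) @[n --> \oo] --> 0.
  rewrite (_ : (fun n => _) = fine \o (fun n => (\int[J]_z (I (n1 + n)%N z)%:E)%E)).
    by apply: fine_cvg; exact: h.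
  by apply/funext => n; rewrite /= -eI.
have [N _ /(_ N (leqnn N)) /= small] := cvgr_lt _ hE _ eps0.
exists (psi (n1 + N)%N); have [d c b o] := hpsi (n1 + N)%N.
split => // x x0; apply: o; apply: interior_subset; apply: hn0 => //.
exact: subset_closure.
Qed.

End NoKillingEnergy.

(** * Left limits at the lifetime for a form without killing part *)

Section NoKilling.
Context {R : realType} {E : pmetricType R}.
Variables (M : process E) (hM : hunt M).
Local Notation Om := (Omega M).
Local Notation X := (traj M).
Local Notation P := (Pr M).
Implicit Types (s t r u : R) (w : Om) (x y : opc E) (B Lam : set Om).
Hypothesis E_lc : locally_compact [set: E].

Lemma measurable_Some : measurable_fun [set: borel E] (Some : borel E -> borel (opc E)).
Proof.
move=> _; pose H := [set Y : set (opc E) | @measurable _ (borel E) (Some @^-1` Y)].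
suff h : <<s @open (opc E) >> `<=` H by move=> Y mY; rewrite setTI; exact: h.
apply: smallest_sub; last first.
  move=> U oU; apply: sub_sigma_algebra.
  by move: oU; apply: open_comp => a _; exact: one_point_compactification_some_continuous.
split; rewrite /H /=.
- by rewrite preimage_set0; exact: measurable0.
- by move=> Y mY; rewrite setTD preimage_setC; exact: measurableC.
- by move=> F mF; rewrite preimage_bigcup; exact: bigcupT_measurable.
Qed.

Lemma ext0_01 (f : E -> R) (y : opc E) : (forall a, 0 <= f a <= 1) -> 0 <= ext0 f y <= 1.
Proof. by move=> f01; case: y => [a|] /=; rewrite ?lexx ?ler01 //; exact: f01. Qed.

Lemma ext0_traj_None u (f : E -> R) : 0 <= u -> borel_fun f ->
  \int[P None]_w ext0 f (X u w) = 0.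
Proof.
move=> u0 mf; rewrite -[RHS](Rintegral_probability1 (P None)).
apply: ae_eq_Rintegral => //; first exact: measurable_ext0_traj.
by apply: filterS (ae_start hM None) => w XN _; rewrite (traj_None_le hM (lexx 0) u0 XN).
Qed.

Lemma borel_transition t (f : E -> R) : 0 <= t -> borel_fun f -> (forall a, 0 <= f a) ->
  borel_fun (transition M t f).
Proof.
move=> t0 mf f0; rewrite (_ : transition M t f =
  (fun y : opc E => \int[P y]_v ext0 f (X t v)) \o Some); last first.
  by apply/funext => z; rewrite transitionE.
apply: (measurableT_comp _ measurable_Some).
apply: (measurable_Rint_Pr hM t0 (measurable_ext0 mf)) => y.
by case: y => //=.
Qed.

Lemma transition_01 t (f : E -> R) z : 0 <= t -> borel_fun f -> (forall a, 0 <= f a <= 1) ->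
  0 <= transition M t f z <= 1.
Proof.
move=> t0 mf f01; rewrite transitionE //; apply: Rintegral_ge0_le1.
  exact: measurable_ext0_traj.
by move=> w; exact: ext0_01.
Qed.

Lemma transition_le t (f g : E -> R) z : 0 <= t -> borel_fun f -> borel_fun g ->
  (forall a, 0 <= f a <= 1) -> (forall a, 0 <= g a <= 1) -> (forall a, f a <= g a) ->
  transition M t f z <= transition M t g z.
Proof.
move=> t0 mf mg f01 g01 fg; rewrite !transitionE //.
have bd h : borel_fun h -> (forall a, 0 <= h a <= 1) -> bounded_mfun (fun w => ext0 h (X t w) : R).
  move=> mh h01; apply: bounded_mfun01; first exact: measurable_ext0_traj.
  by move=> w; exact: ext0_01.
apply: ler_Rintegral_ae; [exact: bd|exact: bd|].
by apply: aeW => w; case: (X t w) => [a|] //=.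
Qed.

Lemma transition0 (f : E -> R) z : borel_fun f -> transition M 0 f z = f z.
Proof.
move=> mf; rewrite transitionE // -[RHS](Rintegral_probability1 (P (Some z))).
apply: ae_eq_Rintegral => //; first exact: measurable_ext0_traj.
by apply: filterS (ae_start hM (Some z)) => w -> _.
Qed.

Variables (m : {measure set (borel E) -> \bar R}) (m_radon : radon m).
Variables (e : dform E) (e_dir : dirichlet_form m e) (M_assoc : associated M m e).
Variables (K : nat -> set E) (K_exh : exhaustion K).
Implicit Types (phi f : E -> R).

Lemma compact_support_integrable f (C : set E) : compact C -> borel_fun f ->
  (forall a, 0 <= f a <= 1) -> (forall a, ~ C a -> f a = 0) -> m.-integrable setT (EFin \o f).
Proof.
move=> cC mf f01 f0; apply: (@bounded_support_integrable _ _ _ m f 1 C) => //.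
- exact: (borel_compact cC).
- exact: m_radon.
- by move=> a; case/andP: (f01 a) => h1 h2; rewrite ger0_norm.
Qed.

Lemma compact_support_L2 f (C : set E) : compact C -> borel_fun f ->
  (forall a, 0 <= f a <= 1) -> (forall a, ~ C a -> f a = 0) -> L2 m f.
Proof.
move=> cC mf f01 f0; apply: (@bounded_support_Lfun2 _ _ _ m f 1 C) => //.
- exact: (borel_compact cC).
- exact: m_radon.
- by move=> a; case/andP: (f01 a) => h1 h2; rewrite ger0_norm.
Qed.

(** Symmetry moves p_s onto the constant 1, where p_s 1 <= 1. As 1 need not be in L^2, the
    indicators of the [K n] take its place and monotone convergence removes them. *)
Lemma transition_subinvariant s f (C : set E) : 0 <= s -> compact C -> borel_fun f ->
  (forall a, 0 <= f a <= 1) -> (forall a, ~ C a -> f a = 0) ->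
  (\int[m]_z (transition M s f z)%:E <= \int[m]_z (f z)%:E)%E.
Proof.
move=> s0 cC mf f01 f0; have [Kc Ki KT] := K_exh.
move: s0; rewrite le_eqVlt => /predU1P[<-|s0].
  by rewrite le_eqVlt; apply/orP; left; apply/eqP; apply: eq_integral => z _; rewrite transition0.
have s0' := ltW s0; have f0' a : 0 <= f a by case/andP: (f01 a).
have mp := borel_transition s0' mf f0'.
have p01 z := transition_01 z s0' mf f01.
pose one n : E -> R := \1_(K n).
have mone n : borel_fun (one n) by apply: measurable_indic; exact: (borel_compact (Kc n)).
have one01 n a : 0 <= one n a <= 1 by rewrite /one indicE; case: (_ \in _); rewrite ?lexx ?ler01.
have oneout n a : ~ K n a -> one n a = 0 by move=> h; rewrite /one indicE memNset.
pose g n z := (transition M s f z * one n z)%:E.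
have -> : (\int[m]_z (transition M s f z)%:E = \int[m]_z limn (g^~ z))%E.
  apply: eq_integral => z _; apply/esym/cvg_lim => //; apply: cvg_near_cst.
  have [n0 hn0] := exhaustion_interior K_exh z.
  exists n0 => // n /= nn; rewrite /g /one indicE mem_set ?mulr1 //.
  by apply: (exhaustion_le K_exh nn); exact: interior_subset.
have ndg z n n' : (n <= n')%N -> (g n z <= g n' z)%E.
  move=> nn; rewrite lee_fin ler_wpM2l //; first by case/andP: (p01 z).
  rewrite /one !indicE; have [h|//] := boolP (z \in K n).
  rewrite mem_set //; apply: (exhaustion_le K_exh nn); exact: set_mem h.
have g0 n z : (0 <= g n z)%E.
  have /andP[h1 _] := p01 z; have /andP[h2 _] := one01 n z.
  by rewrite lee_fin mulr_ge0.
have mg n : measurable_fun [set: borel E] (g n : borel E -> \bar R).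
  by apply/measurable_EFinP; apply: measurable_funM; [exact: mp|exact: mone].
rewrite monotone_convergence //; last by move=> z _ n n'; exact: ndg.
apply: lime_le.
  apply: ereal_nondecreasing_is_cvgn => n n' nn; apply: ge0_le_integral => //.
  by move=> z _; exact: ndg.
apply: nearW => n.
have [sg _] := M_assoc.
have L2f := compact_support_L2 cC mf f01 f0.
have L2o := compact_support_L2 (Kc n) (mone n) (one01 n) (oneout n).
have := sg_sym sg s0 L2f L2o; rewrite /inner /Rintegral => eS.
have po01 z := transition_01 z s0' (mone n) (one01 n).
have mpo : borel_fun (transition M s (one n)).
  by apply: borel_transition => // a; case/andP: (one01 n a).
have int1 : m.-integrable setT (EFin \o (fun z => transition M s f z * one n z)).
  apply: (compact_support_integrable (Kc n)).
  - by apply: measurable_funM; [exact: mp|exact: mone].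
  - by move=> a; exact: ge0_le1M.
  - by move=> a h; rewrite oneout // mulr0.
have int2 : m.-integrable setT (EFin \o (fun z => f z * transition M s (one n) z)).
  apply: (compact_support_integrable cC).
  - exact: measurable_funM.
  - by move=> a; exact: ge0_le1M.
  - by move=> a h; rewrite f0 // mul0r.
have -> : (\int[m]_z g n z = \int[m]_z (f z * transition M s (one n) z)%:E)%E.
  have f1 := integrable_fin_num measurableT int1.
  have f2 := integrable_fin_num measurableT int2.
  by rewrite -[RHS]fineK ?f2 // -eS fineK ?f1.
apply: ge0_le_integral => //.
- by move=> z _; rewrite lee_fin mulr_ge0 //; case/andP: (po01 z).
- by apply/measurable_EFinP; exact: measurable_funM.
- exact/measurable_EFinP.
- by move=> z _; rewrite lee_fin ler_piMr //; case/andP: (po01 z).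
Qed.

Variables (phi : E -> R) (dphi : dom e phi) (Cphi : C0 phi) (phi01 : forall a, 0 <= phi a <= 1).
(* The form has no killing part, as seen by [phi]. *)
Hypothesis phi_small : forall eps : R, 0 < eps -> exists psi, [/\ dom e psi, C0 psi,
  forall a, 0 <= psi a <= 1, forall a, phi a != 0 -> psi a = 1 & energy e phi psi < eps].

(** phi(a) P_a(zeta <= d): the conditional mean of one term of [rsum] of mesh d, given the position
    a at the left endpoint. *)
Definition killed d (a : E) : R := phi a * (1 - transition M d (fun=> 1) a).

Let mphi : borel_fun phi. Proof. by apply: continuous_borel_fun; case: Cphi. Qed.

Let m1 : @borel_fun R E (fun=> 1). Proof. exact: measurable_cst. Qed.

Let one01 (a : E) : 0 <= (fun=> 1 : R) a <= 1. Proof. by rewrite lexx ler01. Qed.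

Lemma killed_01 d a : 0 <= d -> 0 <= killed d a <= 1.
Proof.
move=> d0; apply: ge0_le1M => //; have /andP[h1 h2] := transition_01 a d0 m1 one01.
by rewrite subr_ge0 h2 /= lerBlDr lerDl.
Qed.

Lemma borel_killed d : 0 <= d -> borel_fun (killed d).
Proof.
move=> d0; apply: measurable_funM => //; apply: measurable_funB => //.
exact: borel_transition.
Qed.

Lemma killed_out d a : ~ suppf phi a -> killed d a = 0.
Proof. by move=> /suppf_out h; rewrite /killed h mul0r. Qed.

Lemma killed_integrable d : 0 <= d -> m.-integrable setT (EFin \o killed d).
Proof.
move=> d0; apply: (compact_support_integrable Cphi.2); first exact: borel_killed.
  by move=> a; exact: killed_01.
by move=> a; exact: killed_out.
Qed.

(** As psi = 1 where phi is nonzero and p_d psi <= p_d 1, one has phi (1 - p_d 1) <= phi (psi - p_d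
    psi). Integrated against m and divided by d, the right side tends to the energy of psi against
    phi. *)
Lemma killing_rate_small eps : 0 < eps ->
  \forall d \near 0^'+, d^-1 * \int[m]_a killed d a < eps.
Proof.
move=> eps0; have [psi [dpsi Cpsi psi01 psi1 small]] := phi_small eps0.
have [_ [_ fE]] := M_assoc.
have mpsi : borel_fun psi by apply: continuous_borel_fun; case: Cpsi.
have psi0 a : 0 <= psi a by case/andP: (psi01 a).
rewrite (sf_sym (df_form e_dir) dphi dpsi) in small.
have gt0 : \forall d \near 0^'+, 0 < (d : R) by exact: nbhs_right_gt.
apply: filterS2 gt0 (cvgr_lt _ (fE psi phi dpsi dphi) _ small) => d d0 h.
apply: le_lt_trans h; rewrite ler_pM2l ?invr_gt0 //; have d0' := ltW d0.
have phi0 a : 0 <= phi a by case/andP: (phi01 a).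
apply: le_Rintegral => //; first exact: killed_integrable.
  apply: (@bounded_support_integrable _ _ _ m _ 1 (suppf phi)).
  - exact: (borel_compact Cphi.2).
  - exact: m_radon Cphi.2.
  - by apply: measurable_funM => //; apply: measurable_funB => //; exact: borel_transition.
  - move=> a; rewrite normrM -[leRHS]mulr1 ler_pM //.
      have /andP[h1 h2] := transition_01 a d0' mpsi psi01; have /andP[h3 h4] := psi01 a.
      by rewrite ler_norml /=; apply/andP; split; lra.
    by rewrite ger0_norm //; case/andP: (phi01 a).
  - by move=> a /suppf_out ->; rewrite mulr0.
move=> a _; rewrite /killed mulrC /=; have [->|/psi1 ->] := eqVneq (phi a) 0.
  by rewrite !mulr0.
rewrite ler_wpM2r // lerB //; apply: transition_le => // b.
by case/andP: (psi01 b).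
Qed.

Definition jump_end s t w : R :=
  ext0 phi (left_end w) * (alive s w - alive (s + t) w).

Lemma rsum_mean (z : E) s t N : 0 <= s -> 0 < t ->
  \int[P (Some z)]_w rsum (@alive R E M) phi s t N w =
  \sum_(i < N.+1) \int[P (Some z)]_w ext0 (killed (t / N.+1%:R)) (X (grid s t N i) w).
Proof.
move=> s0 t0; have t0' := ltW t0; set d := t / N.+1%:R.
have d0 : 0 <= d by rewrite divr_ge0.
have g0 i : 0 <= grid s t N i by exact: grid_ge0.
have mtr : borel_fun (transition M d (fun=> 1)) by exact: borel_transition.
have bphi i : bounded_mfun (fun w => ext0 phi (X (grid s t N i) w)).
  apply: bounded_mfun01; first exact: measurable_ext0_traj.
  by move=> w; exact: ext0_01.
have bal u : 0 <= u -> bounded_mfun (@alive R E M u).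
  by move=> u0; apply: bounded_mfun01; [exact: measurable_alive|exact: alive_ge0_le1].
rewrite /rsum (@Rintegral_sum _ _ _ _ (fun i w => ext0 phi (X (grid s t N i) w) *
    (alive (grid s t N i) w - alive (grid s t N i.+1) w))) //; last first.
  by move=> i; apply: bounded_mfunM => //; apply: bounded_mfunB; exact: bal.
apply: eq_bigr => i _.
transitivity (\int[P (Some z)]_w (ext0 phi (X (grid s t N i) w) -
    ext0 phi (X (grid s t N i) w) * alive (grid s t N i + d) w)).
  apply: eq_Rintegral => w _; rewrite gridS mulrBr; congr (_ - _).
  by rewrite alive_traj; case: (X _ w) => [a|] /=; rewrite ?mulr1 ?mulr0.
have bda : bounded_mfun (fun w => ext0 phi (X (grid s t N i) w) * alive (grid s t N i + d) w).
  by apply: bounded_mfunM => //; apply: bal; rewrite addr_ge0.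
rewrite RintegralB //; [|exact: bounded_mfun_integrable..].
rewrite markov_alive //.
have bk : bounded_mfun (fun w => ext0 (fun a => phi a * transition M d (fun=> 1) a) (X (grid s t N i) w)).
  apply: bounded_mfun01.
    by apply: measurable_ext0_traj => //; exact: measurable_funM.
  by move=> w; apply: ext0_01 => a; apply: ge0_le1M => //; exact: transition_01.
rewrite -RintegralB //; [|exact: bounded_mfun_integrable..].
apply: eq_Rintegral => w _; case: (X _ w) => [a|] /=; last by rewrite subr0.
by rewrite /killed mulrBr mulr1.
Qed.

Lemma jump_end_measurable s t : 0 <= s -> 0 < t -> measurable_fun setT (jump_end s t).
Proof.
move=> s0 t0; apply: (@measurable_fun_cvg _ _ _ setT (rsum (@alive R E M) phi s t)).
  move=> N; apply: measurable_rsum => //; [exact: ltW|exact: measurable_alive].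
by move=> w _; apply: rsum_alive_cvg => //; exact: ext0_continuous.
Qed.

Lemma jump_end_01 s t w : 0 <= s -> 0 <= t -> 0 <= jump_end s t w <= 1.
Proof.
move=> s0 t0; apply: ge0_le1M; first exact: ext0_01.
have /andP[a0 a1] := alive_ge0_le1 s w; have /andP[b0 b1] := alive_ge0_le1 (s + t) w.
by rewrite subr_ge0 (alive_le hM) ?lerDl //= lerBlDr (le_trans a1) // lerDl.
Qed.

Lemma rsum_mean_cvg (z : E) s t : 0 <= s -> 0 < t ->
  \int[P (Some z)]_w rsum (@alive R E M) phi s t N w @[N --> \oo] -->
    \int[P (Some z)]_w jump_end s t w.
Proof.
move=> s0 t0; apply: (@cvg_Rintegral_bounded _ _ _ _ _ _ 1).
- move=> N; apply: measurable_rsum => //; [exact: ltW|exact: measurable_alive].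
- exact: jump_end_measurable.
- move=> N w; have /andP[h1 h2] := rsum_alive_ge0_le hM N w s0 (ltW t0) phi01.
  by rewrite ger0_norm.
- by apply: aeW => w; apply: rsum_alive_cvg => //; exact: ext0_continuous.
Qed.

(** By subinvariance of m each of the N+1 terms contributes at most the integral of [killed d], with
    d = t/(N+1); as N+1 = t/d, the total is at most t times the killing rate, which tends to 0.
    Fatou's lemma passes to the limit of the sums. *)
Lemma jump_end_mean_null t : 0 < t ->
  {ae m, forall z, \int[P (Some z)]_w jump_end 0 t w = 0}.
Proof.
move=> t0; have t0' := ltW t0.
pose r N (z : E) := \int[P (Some z)]_w rsum (@alive R E M) phi 0 t N w.
pose d N := t / N.+1%:R : R.
have d0 N : 0 < d N by rewrite divr_gt0.
have d0' N := ltW (d0 N).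
have g0 N i : 0 <= grid 0 t N i by exact: grid_ge0.
have k0 N a : 0 <= killed (d N) a by case/andP: (killed_01 a (d0' N)).
have rE N z : r N z = \sum_(i < N.+1) transition M (grid 0 t N i) (killed (d N)) z.
  by rewrite /r rsum_mean //; apply: eq_bigr => i _; rewrite transitionE.
have mtr N i : borel_fun (transition M (grid 0 t N i) (killed (d N))).
  by apply: borel_transition => //; exact: borel_killed.
have mr N : borel_fun (r N).
  rewrite (_ : r N = fun z => \sum_(i < N.+1) transition M (grid 0 t N i) (killed (d N)) z).
    by apply: measurable_sum => i; exact: mtr.
  by apply/funext => z; rewrite rE.
have r0 N z : 0 <= r N z.
  apply: Rintegral_ge0 => w _.
  by have /andP[] := rsum_alive_ge0_le hM N w (lexx 0) t0' phi01.
have rint N : (\int[m]_z (r N z)%:E <= (t * ((d N)^-1 * \int[m]_a killed (d N) a))%:E)%E.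
  have fin := integrable_fin_num measurableT (killed_integrable (d0' N)).
  have -> : t * ((d N)^-1 * \int[m]_a killed (d N) a) = \sum_(i < N.+1) \int[m]_a killed (d N) a.
    rewrite sumr_const card_ord -mulr_natl mulrA; congr (_ * _).
    by rewrite /d invf_div mulrCA divff ?mulr1 // gt_eqF.
  under eq_integral do rewrite rE -sumEFin.
  rewrite ge0_integral_sum //; first last.
  - by move=> i z _; rewrite lee_fin; case/andP: (transition_01 z (g0 N i) (borel_killed (d0' N)) (fun a => killed_01 a (d0' N))).
  - by move=> i; apply/measurable_EFinP; exact: mtr.
  rewrite -sumEFin; apply: lee_sum => i _.
  rewrite /Rintegral fineK //.
  apply: (transition_subinvariant (g0 N i) Cphi.2); first exact: borel_killed.
    by move=> a; exact: killed_01.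
  by move=> a; exact: killed_out.
pose h (z : E) := \int[P (Some z)]_w jump_end 0 t w.
have rh z : r N z @[N --> \oo] --> h z by exact: rsum_mean_cvg.
have mh : borel_fun h by apply: (measurable_fun_cvg mr) => z _; exact: rh.
have h0 z : 0 <= h z.
  by apply: Rintegral_ge0 => w _; case/andP: (jump_end_01 w (lexx 0) t0').
have ih : (\int[m]_z (h z)%:E = 0)%E.
  apply/eqP; rewrite eq_le; apply/andP; split; last first.
    by apply: integral_ge0 => z _; rewrite lee_fin.
  apply/lee_addgt0Pr => eps eps0; rewrite add0e.
  have -> : (\int[m]_z (h z)%:E = \int[m]_z limn_einf (fun N => (r N z)%:E))%E.
    apply: eq_integral => z _; have hz : (r N z)%:E @[N --> \oo] --> (h z)%:E.
      apply: cvg_EFin; [by apply: nearW | exact: rh].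
    rewrite is_cvg_limn_einfE; last by apply/cvg_ex; exists (h z)%:E.
    by apply/esym/cvg_lim.
  apply: le_trans (fatou _ _ _ _) _ => //.
  - by move=> N; apply/measurable_EFinP; exact: mr.
  - by move=> N z _; rewrite lee_fin.
  have epst : 0 < eps / t by rewrite divr_gt0.
  have [dl /= dl0 hdl] := killing_rate_small epst.
  have : \forall N \near \oo, (\int[m]_z (r N z)%:E <= eps%:E)%E.
    have := near_infty_natSinv_lt (PosNum (divr_gt0 dl0 t0)).
    apply: filterS => N /= hN; apply: le_trans (rint N) _.
    rewrite lee_fin -ler_pdivlMl // [leRHS]mulrC ltW //; apply: hdl => //=.
    by rewrite sub0r normrN gtr0_norm // /d mulrC -ltr_pdivlMr.
  move=> [N0 _ hN]; rewrite limn_einf_lim; apply: lime_le; first exact: is_cvg_einfs.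
  apply: nearW => n; apply: ge_ereal_inf.
  exists (\int[m]_z (r (maxn n N0) z)%:E)%E; first by exists (maxn n N0) => //=; exact: leq_maxl.
  by apply: hN => /=; exact: leq_maxr.
have /ae_eq_integral_abs : measurable_fun [set: borel E] (EFin \o h : borel E -> \bar R).
  by apply/measurable_EFinP; exact: mh.
move=> /(_ m measurableT) [H _]; have : (\int[m]_z `|(EFin \o h) z| = 0)%E.
  by rewrite -ih; apply: eq_integral => z _; rewrite gee0_abs // lee_fin.
by move=> /H; apply: filterS => z /(_ I) [].
Qed.

Hypothesis M_ac : forall (B : set (borel E)) s z, measurable B -> m B = 0%E -> 0 < s ->
  {ae P (Some z), forall w, ~ (Some @` B) (X s w)}.

(* The smoothing of [jump_end_mean_null] by the absolute continuity of the
   transition function removes the exceptional set of starting points. *)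
Lemma jump_end_null_pos (z : E) s t : 0 < s -> 0 < t ->
  \int[P (Some z)]_w jump_end s t w = 0.
Proof.
move=> s0 t0; have t0' := ltW t0; have s0' := ltW s0.
pose r N (a : E) := \int[P (Some a)]_w rsum (@alive R E M) phi 0 t N w.
pose h (a : E) := \int[P (Some a)]_w jump_end 0 t w.
have r01 N a : 0 <= r N a <= 1.
  apply: Rintegral_ge0_le1.
    by apply: measurable_rsum => //; exact: measurable_alive.
  by move=> w; exact: (rsum_alive_ge0_le hM N w (lexx 0) t0' phi01).
have d0 N : 0 <= t / N.+1%:R by rewrite divr_ge0.
have rE N a : r N a = \sum_(i < N.+1) \int[P (Some a)]_w ext0 (killed (t / N.+1%:R)) (X (grid 0 t N i) w).
  by rewrite /r rsum_mean.
have mr N : borel_fun (r N).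
  rewrite (_ : r N = fun a => \sum_(i < N.+1) transition M (grid 0 t N i) (killed (t / N.+1%:R)) a).
    apply: measurable_sum => i; apply: borel_transition; [exact: grid_ge0|exact: borel_killed|].
    by move=> a; case/andP: (killed_01 a (d0 N)).
  by apply/funext => a; rewrite rE; apply: eq_bigr => i _; rewrite transitionE // grid_ge0.
(* The Markov property at time s moves the origin of the grid to 0, so that the null set of
   [jump_end_mean_null] is met by the law of X_s, which does not charge it. *)
have shift N : \int[P (Some z)]_w rsum (@alive R E M) phi s t N w =
    \int[P (Some z)]_w ext0 (r N) (X s w).
  have gE i : grid s t N i = s + grid 0 t N i by rewrite /grid add0r.
  rewrite rsum_mean //; under eq_bigr do rewrite gE.
  have mk := borel_killed (d0 N); have k01 a := killed_01 a (d0 N).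
  have me := measurable_ext0 mk.
  transitivity (\sum_(i < N.+1) \int[P (Some z)]_w (\int[P (X s w)]_v
      ext0 (killed (t / N.+1%:R)) (X (grid 0 t N i) v))).
    apply: eq_bigr => i _.
    have := @markov_fun _ _ _ hM (Some z) (ext0 (killed (t / N.+1%:R))) (grid 0 t N i) s setT.
    apply => //; [exact: grid_ge0|exact: filtrationT|].
    by move=> y; exact: ext0_01.
  have bi i : bounded_mfun (fun w => \int[P (X s w)]_v
      ext0 (killed (t / N.+1%:R)) (X (grid 0 t N i) v)).
    apply: bounded_mfun01.
      have e0 y : 0 <= ext0 (killed (t / N.+1%:R)) y by case/andP: (ext0_01 y k01).
      have mR := measurable_Rint_Pr hM (@grid_ge0 R 0 t N i (lexx 0) t0') me e0.
      exact: (measurableT_comp mR (measurable_traj hM s0')).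
    move=> w; apply: Rintegral_ge0_le1.
      by apply: measurable_ext0_traj => //; exact: grid_ge0.
    by move=> v; exact: ext0_01.
  rewrite -(@Rintegral_sum _ _ _ _ (fun i w => \int[P (X s w)]_v
      ext0 (killed (t / N.+1%:R)) (X (grid 0 t N i) v))) //.
  apply: ae_eq_Rintegral => //.
  - by apply: measurable_sum => i; case: (bi i).
  - exact: measurable_ext0_traj.
  - apply: aeW => w _; case: (X s w) => [a|] /=; first by rewrite rE.
    by apply: big1 => i _; apply: ext0_traj_None; [exact: grid_ge0|exact: mk].
have c1 := @rsum_mean_cvg z s t s0' t0.
have c2 : \int[P (Some z)]_w ext0 (r N) (X s w) @[N --> \oo] --> \int[P (Some z)]_w (0 : R).
  have [B [mB B0 hB]] := jump_end_mean_null t0.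
  apply: (@cvg_Rintegral_bounded _ _ _ _ _ _ 1).
  - by move=> N; exact: measurable_ext0_traj.
  - exact: measurable_cst.
  - move=> N w; have /andP[h1 h2] := ext0_01 (X s w) (r01 N).
    by rewrite ger0_norm.
  - apply: filterS (M_ac z mB B0 s0) => w nB.
    case eX : (X s w) => [a|] /=; last exact: cvg_cst.
    have ha : h a = 0.
      by apply: contrapT => h'; apply: nB; rewrite eX; exists a => //; exact: hB.
    by rewrite -ha; exact: rsum_mean_cvg.
rewrite Rintegral_probability1 in c2.
have E1 : (fun N => \int[P (Some z)]_w rsum (@alive R E M) phi s t N w) =
  (fun N => \int[P (Some z)]_w ext0 (r N) (X s w)) by apply/funext.
rewrite E1 in c1; exact: (cvg_unique _ c1 c2).
Qed.

(** Absolute continuity needs a positive time s. A path started in E has zeta > 0, so a lifetime in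
    ]0, t] also lies in ]1/(n+1), 1/(n+1) + t] for large n. *)
Lemma jump_end_null (z : E) t : 0 < t ->
  {ae P (Some z), forall w, jump_end 0 t w = 0}.
Proof.
move=> t0.
have : {ae P (Some z), forall w, forall n : nat, jump_end n.+1%:R^-1 t w = 0}.
  apply: ae_foralln => n; have n0 : 0 < n.+1%:R^-1 :> R by rewrite invr_gt0.
  apply: Rintegral_eq0_ae.
  - apply: bounded_mfun01; first by apply: jump_end_measurable => //; exact: ltW.
    by move=> w; apply: jump_end_01; exact: ltW.
  - by move=> w; have /andP[] := jump_end_01 w (ltW n0) (ltW t0).
  - exact: jump_end_null_pos.
apply: filterS2 (ae_start hM (Some z)) => w X0 hn.
have z0 : (0 < zeta w)%E by apply/(zeta_gtP hM) => //; rewrite X0.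
rewrite /jump_end add0r !alive_traj X0; case et : (X t w) => [a|]; first by rewrite subrr mulr0.
have := (zeta_leP hM w (ltW t0)).2 et.
case ez : (zeta w) z0 => [zz| |] //; rewrite lte_fin lee_fin => zz0 zt.
have [n _ /(_ n (leqnn n)) /= hnz] := near_infty_natSinv_lt (PosNum zz0).
have := hn n; rewrite /jump_end !alive_traj.
have -> : X (n.+1%:R^-1 + t) w = None.
  by apply: (hunt_cemetery hM); rewrite ?addr_ge0 ?(ltW t0) // ez lee_fin (le_trans zt) // lerDr.
case eX : (X n.+1%:R^-1 w) => [a|] //.
have n0 : 0 <= n.+1%:R^-1 :> R by rewrite invr_ge0.
by have := (zeta_leP hM w n0).2 eX; rewrite ez lee_fin leNgt hnz.
Qed.

End NoKilling.

(** * Integration against the additive functional *)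

Section ExpStieltjes.
Context {R : realType} (F : R -> R) (r : R).
Hypotheses (r0 : 0 <= r) (F_le : {homo F : x y / x <= y}) (F_cont : continuous F) (F0 : F 0 = 0).
Variable nu : {measure set (measurableTypeR R) -> \bar R}.
Hypothesis nuE : forall a b : R, a <= b -> nu `]a, b]%classic = (F b - F a)%:E.

Let Phi b : R := \int[nu]_(s in `]0, b]) expR (- F s).

Let mexp (D : set (measurableTypeR R)) : measurable D ->
  measurable_fun D (fun s : measurableTypeR R => (expR (- F s))%:E).
Proof.
move=> mD; apply/measurable_EFinP; apply: measurable_funTS.
apply: continuous_measurable_fun => x; apply: continuous_comp; last exact: continuous_expR.
by apply: continuousN; exact: F_cont.
Qed.

Lemma integral_exp_bounds (a b : R) : a <= b ->
  ((expR (- F b) * (F b - F a))%:E <= \int[nu]_(s in `]a, b]) (expR (- F s))%:E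
     <= (expR (- F a) * (F b - F a))%:E)%E.
Proof.
move=> ab; apply/andP; split.
  rewrite EFinM -nuE // -integral_cst //; apply: ge0_le_integral => //.
  - by move=> s _; rewrite lee_fin expR_ge0.
  - exact: mexp.
  - move=> s /=; rewrite in_itv /= => /andP[_ sb].
    by rewrite lee_fin ler_expR lerN2 F_le.
rewrite EFinM -nuE // -integral_cst //; apply: ge0_le_integral => //.
- exact: mexp.
- move=> s /=; rewrite in_itv /= => /andP[sa _].
  by rewrite lee_fin ler_expR lerN2 F_le // ltW.
Qed.

Let fin_int (a b : R) : a <= b ->
  (\int[nu]_(s in `]a, b]) (expR (- F s))%:E)%E \is a fin_num.
Proof.
move=> ab; rewrite ge0_fin_numE; last by apply: integral_ge0 => s _; rewrite lee_fin expR_ge0.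
by case/andP: (integral_exp_bounds ab) => _ h; apply: le_lt_trans h (ltry _).
Qed.

Lemma exp_increment (u v : R) : u <= v ->
  expR (- v) * (v - u) <= expR (- u) - expR (- v) <= expR (- u) * (v - u).
Proof.
move=> uv; apply/andP; split.
  have := expR_ge1Dx (v - u); rewrite -(ler_pM2l (expR_gt0 (- v))).
  rewrite -expRD mulrDr mulr1 => h.
  have e : - v + (v - u) = - u by ring.
  by rewrite e in h; lra.
have := expR_ge1Dx (u - v); rewrite -(ler_pM2l (expR_gt0 (- u))).
rewrite -expRD mulrDr mulr1 => h.
have e : - u + (u - v) = - v by ring.
by rewrite e in h; lra.
Qed.

Let Psi b := Phi b - (1 - expR (- F b)).

(* Both the integral of [exp (- F)] and the decrement of [exp (- F)] lie
   between [exp (- F b) (F b - F a)] and [exp (- F a) (F b - F a)]. *)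
Lemma integral_exp_defect (a b : R) : 0 <= a -> a <= b ->
  `|Psi b - Psi a| <= (F b - F a) ^+ 2.
Proof.
move=> a0 ab; have Fa0 : 0 <= F a by rewrite -F0 F_le.
have Fab : F a <= F b by exact: F_le.
have split : Phi b = Phi a + fine (\int[nu]_(s in `]a, b]) (expR (- F s))%:E)%E.
  rewrite /Phi /Rintegral -fineD; [|exact: fin_int..].
  have abU : (`]0, b]%classic = `]0, a] `|` `]a, b])%classic by apply: itv_bndbnd_setU; rewrite bnd_simp.
  congr fine; rewrite abU ge0_integral_setU //.
  - by rewrite -abU; exact: mexp.
  - apply/disj_set2P/seteqP; split => // s [] /=; rewrite !in_itv /= => /andP[_ h1] /andP[h2 _].
    by move: (lt_le_trans h2 h1); rewrite ltxx.
have := integral_exp_bounds ab; rewrite -[(\int[nu]_(s in `]a, b]) _)%E]fineK ?fin_int //.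
rewrite !lee_fin; set I := fine _ in split *; move=> /andP[lo hi].
have /andP[lo' hi'] := exp_increment Fab.
have -> : Psi b - Psi a = I - (expR (- F a) - expR (- F b)).
  by rewrite /Psi split; ring.
have ea : expR (- F a) <= 1 by rewrite -expR0 ler_expR oppr_le0.
have d0 : 0 <= F b - F a by rewrite subr_ge0.
have H : (expR (- F a) - expR (- F b)) * (F b - F a) <= (F b - F a) ^+ 2.
  rewrite expr2 ler_wpM2r //; apply: le_trans hi' _.
  by rewrite -[leRHS]mul1r ler_wpM2r.
have mB : (expR (- F a) - expR (- F b)) * (F b - F a) =
   expR (- F a) * (F b - F a) - expR (- F b) * (F b - F a) by ring.
by rewrite ler_norml; apply/andP; split; lra.
Qed.

(** F need not be differentiable, so the chain rule is replaced by the quadratic bound of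
    [integral_exp_defect]. Cutting the range of F, rather than the interval, into n+1 equal parts
    bounds the total defect by F(r)^2/(n+1). *)
Lemma integral_exp_stieltjes :
  (\int[nu]_(s in `]0%R, r]) (expR (- F s))%:E = (1 - expR (- F r))%:E)%E.
Proof.
rewrite -[LHS]fineK ?fin_int //; congr EFin.
suff : Psi r = 0 by rewrite /Psi /Phi /Rintegral => /eqP; rewrite subr_eq0 => /eqP.
have Psi0 : Psi 0 = 0.
  by rewrite /Psi /Phi set_itvoc0 Rintegral_set0 F0 oppr0 expR0 subrr subr0.
have Fr0 : 0 <= F r by rewrite -F0 F_le.
have defect (a b : R) : 0 <= a -> 0 <= b -> `|Psi b - Psi a| <= (F b - F a) ^+ 2.
  move=> a0 b0; have [ab|/ltW ba] := leP a b; first exact: integral_exp_defect.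
  rewrite distrC (_ : (F b - F a) ^+ 2 = (F a - F b) ^+ 2); first exact: integral_exp_defect.
  by rewrite -sqrrN; congr (_ ^+ 2); ring.
suff key (n : nat) : `|Psi r| <= F r ^+ 2 * n.+1%:R^-1.
  by apply/eqP; rewrite -normr_le0; exact: le_of_invS (sqr_ge0 _) key.
(* Continuity of F yields points at which it takes equally spaced values. Nothing orders these
   points, which is why [defect] is stated for both orders. *)
have /choice[s hs] : forall i : nat, exists s : R, (i <= n.+1)%N ->
    0 <= s /\ F s = i%:R * (F r / n.+1%:R).
  move=> i; have [ni|ni] := leqP i n.+1; last by exists 0.
  have [|||c] := @IVT R F 0 r (i%:R * (F r / n.+1%:R)) => //.
  - exact: continuous_subspaceT.
  - rewrite F0 min_l // max_r // mulr_ge0 ?divr_ge0 //=.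
    by rewrite mulrCA ler_piMr // ler_pdivrMr // mul1r ler_nat.
  by rewrite in_itv /= => /andP[c0 _] Fc; exists c.
have step i : (i <= n.+1)%N -> `|Psi (s i)| <= i%:R * (F r / n.+1%:R) ^+ 2.
  elim: i => [_|i IH ni].
    have [s0 Fs] := hs 0 (leq0n _).
    have := defect 0 (s 0) (lexx 0) s0; rewrite Psi0 subr0 Fs F0 mul0r subr0 expr0n /=.
    by rewrite mul0r.
  have [si0 Fsi] := hs i (ltnW ni); have [sj0 Fsj] := hs i.+1 ni.
  have := defect (s i) (s i.+1) si0 sj0.
  rewrite Fsi Fsj -mulrBl -natrB ?leqnSn // subSnn mul1r => h.
  have -> : Psi (s i.+1) = Psi (s i.+1) - Psi (s i) + Psi (s i) by ring.
  apply: le_trans (ler_normD _ _) _.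
  have -> : i.+1%:R * (F r / n.+1%:R) ^+ 2 = (F r / n.+1%:R) ^+ 2 + i%:R * (F r / n.+1%:R) ^+ 2.
    by rewrite -addn1 natrD mulrDl mul1r addrC.
  by apply: lerD => //; apply: IH; exact: ltnW.
have [sn0 Fsn] := hs n.+1 (leqnn _).
(* The last point may differ from r, but F takes the same value at both, so the defect between them
   is 0. *)
have -> : Psi r = Psi (s n.+1).
  apply/eqP; rewrite -subr_eq0 -normr_le0; apply: le_trans (defect _ _ sn0 r0) _.
  by rewrite Fsn mulrCA divff ?gt_eqF // mulr1 subrr expr0n.
apply: le_trans (step n.+1 (leqnn _)) _.
rewrite expr_div_n mulrCA; apply: ler_wpM2l; first exact: sqr_ge0.
by rewrite expr2 invfM mulrA divff ?gt_eqF // mul1r.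
Qed.

End ExpStieltjes.

Lemma lebesgue_stieltjes_measure_itvoc (R : realType) (F : cumulative R R) (a b : R) :
  a <= b -> lebesgue_stieltjes_measure F `]a, b]%classic = (F b - F a)%:E.
Proof.
move=> ab; rewrite /lebesgue_stieltjes_measure/= /measure_extension/=.
by rewrite measurable_mu_extE/=; [rewrite wlength_itv_bnd | exact: is_ocitv].
Qed.

Lemma stieltjesE (R : realType) (F : R -> R) (a b : R) :
  {homo F : x y / x <= y} -> right_continuous F -> a <= b ->
  stieltjes F `]a, b]%classic = (F b - F a)%:E.
Proof.
move=> F_le Frc ab; rewrite /stieltjes; case: pselect => [h|nh]; last by exfalso; exact: nh.
exact: lebesgue_stieltjes_measure_itvoc.
Qed.


(** * The integral of exp(- A) dA along a path as a countable supremum *)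

Section PathIntegral.
Context {R : realType} {E : pmetricType R}.
Variables (M : process E) (hM : hunt M).
Local Notation Om := (Omega M).
Local Notation F0 := (@natural_filtration R E M).
Implicit Types (s t r u : R) (w : Om) (x y : opc E) (B Lam : set Om).
Variables (A : R -> Om -> \bar R) (w : Om) (rw : regular_path A w).

Let clamp (r s : R) : R := Num.min (Num.max s 0) r.

Let clamp_itv r s : 0 <= r -> 0 <= clamp r s <= r.
Proof. by move=> r0; rewrite /clamp le_min ge_min lexx orbT r0 !andbT le_max lexx orbT. Qed.

Let A_fin r s : (r%:E < zeta w)%E -> 0 <= s -> s <= r -> A s w \is a fin_num.
Proof.
move=> rz s0 sr; rewrite ge0_fin_numE; last exact: regular_path_ge0.
by apply: (rp_fin rw) => //; apply: le_lt_trans rz; rewrite lee_fin.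
Qed.

Lemma stopped_le r : 0 <= r -> (r%:E < zeta w)%E ->
  {homo stopped (A ^~ w) r : x y / x <= y}.
Proof.
move=> r0 rz x y xy; rewrite /stopped -/(clamp r x) -/(clamp r y).
have /andP[x0 xr] := clamp_itv x r0; have /andP[y0 yr] := clamp_itv y r0.
apply: fine_le; [exact: A_fin xr|exact: A_fin yr|].
apply: (rp_le rw) => //; rewrite /clamp le_min; apply/andP; split; rewrite ge_min.
  by rewrite ge_max !le_max xy lexx !orbT.
by rewrite lexx orbT.
Qed.

Lemma stopped_continuous r : 0 <= r -> (r%:E < zeta w)%E ->
  continuous (stopped (A ^~ w) r).
Proof.
move=> r0 rz s; rewrite /stopped /continuous_at -/(clamp r s).
have /andP[c0 cr] := clamp_itv s r0.
apply: fine_cvg; rewrite fineK; last exact: A_fin cr.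
have cl : clamp r x @[x --> s] --> clamp r s.
  suff : {for s, continuous ((id \max cst 0) \min cst r)} by [].
  apply: continuous_min; last exact: cvg_cst.
  by apply: continuous_max; [exact: cvg_id | exact: cvg_cst].
have /subspace_continuousP /(_ (clamp r s)) h := rp_cont rw.
have {}h : A u w @[u --> within `[0%R, +oo[ (nbhs (clamp r s))] --> A (clamp r s) w.
  by apply: h => /=; rewrite in_itv /= c0.
move=> V /h hV.
have cV : \forall x \near s, `[0%R, +oo[%classic (clamp r x) -> V (A (clamp r x) w) := cl _ hV.
apply: filterS cV => x; apply => /=.
by rewrite in_itv /= andbT; case/andP: (clamp_itv x r0).
Qed.

Lemma path_integral_stopped r : 0 <= r -> (r%:E < zeta w)%E ->
  (\int[stieltjes (stopped (A ^~ w) r)]_(s in `]0%R, r]) expeR (- A s w) =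
   (1 - expN (A r w))%:E)%E.
Proof.
move=> r0 rz; pose F := stopped (A ^~ w) r.
have FE s : 0 <= s -> s <= r -> A s w = (F s)%:E.
  move=> s0 sr; rewrite /F /stopped max_l // min_l // fineK //; exact: A_fin sr.
have F0 : F 0 = 0.
  by have := FE 0 (lexx 0) r0; rewrite (rp_0 rw) => -[].
have Fr0 : 0 <= F r by rewrite -F0; apply: stopped_le.
transitivity (\int[stieltjes F]_(s in `]0%R, r]) (expR (- F s))%:E)%E.
  apply: eq_integral => s /set_mem /=; rewrite in_itv /= => /andP[s0 sr].
  by rewrite FE // ltW.
rewrite integral_exp_stieltjes //.
- by rewrite FE // expN_fin.
- exact: stopped_le.
- exact: stopped_continuous.
- move=> a b ab; apply: stieltjesE => //; first exact: stopped_le.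
  by apply: right_continuousW; exact: stopped_continuous.
Qed.

Lemma path_integral_expE t : path_integral (A ^~ w) (zeta w) (fun s => expeR (- A s w)%E) t =
  maxe 0%E (ereal_sup [set (1 - expN (A r w))%:E | r in
    [set r | [/\ 0 <= r, r <= t & (r%:E < zeta w)%E]]]).
Proof.
rewrite /path_integral; congr (maxe _ (ereal_sup _)).
by apply: eq_imagel => r [r0 _ rz]; exact: path_integral_stopped.
Qed.

End PathIntegral.

Section PathFunctional.
Context {R : realType} {E : pmetricType R}.
Variables (M : process E) (hM : hunt M).
Local Notation Om := (Omega M).
Local Notation X := (traj M).
Local Notation P := (Pr M).
Implicit Types (s t r u : R) (w : Om) (x y : opc E) (B Lam : set Om).
Hypothesis E_lc : locally_compact [set: E].
Variables (A : R -> Om -> \bar R) (pA : pcaf A).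
Variables (K : nat -> set E) (K_exh : exhaustion K).
Variables (t : R) (t0 : 0 < t).

Let t0' : 0 <= t := ltW t0.

(** A countable set of times sufficient for the supremum over [0, t]. The endpoint t is listed
    separately because it may be irrational and cannot be approached from above within [0, t];
    rationals outside [0, t] are replaced by 0. *)
Definition time_seq k : R :=
  if k is k'.+1 then
    (if 0 <= @rational_seq R k' <= t then rational_seq k' else 0)
  else t.

Lemma time_seq_itv k : 0 <= time_seq k <= t.
Proof. by case: k => [|k] /=; [rewrite lexx andbT | case: ifP => // _; rewrite lexx]. Qed.

(** On a regular path started in E, the integral of exp(- A) dA over ]0, r] if the path is alive at
    r, and 0 otherwise. *)
Definition kill_mass r w : R := (1 - expN (A r w)) * alive r w.

(** A countable supremum, hence measurable. With D constantly the whole space it is the full path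
    integral; with D the event that the time precedes the exit from [K n], it is the part
    accumulated inside [K n]. *)
Definition kill_sup (D : nat -> set Om) w : R :=
  sups (fun k => kill_mass (time_seq k) w * \1_(D k) w) 0.

Lemma kill_mass_01 r w : 0 <= kill_mass r w <= 1.
Proof.
apply: ge0_le1M; last exact: alive_ge0_le1.
by have /andP[a b] := expN_ge0_le1 (A r w); rewrite subr_ge0 b lerBlDr lerDl.
Qed.

Let term_01 (D : nat -> set Om) k w : 0 <= kill_mass (time_seq k) w * \1_(D k) w <= 1.
Proof.
apply: ge0_le1M; first exact: kill_mass_01.
by rewrite indicE; case: (_ \in _); rewrite ?lexx ?ler01.
Qed.

Lemma kill_sup_ub D k w : kill_mass (time_seq k) w * \1_(D k) w <= kill_sup D w.
Proof.
apply: ub_le_sup; last by exists k.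
by exists 1 => _ [n _ <-]; case/andP: (term_01 D n w).
Qed.

Lemma kill_sup_le D w c : (forall k, kill_mass (time_seq k) w * \1_(D k) w <= c) ->
  kill_sup D w <= c.
Proof.
move=> h; apply: ge_sup; last by move=> _ [k _ <-].
by exists (kill_mass (time_seq 0) w * \1_(D 0%N) w); exists 0%N.
Qed.

Lemma kill_sup_01 D w : 0 <= kill_sup D w <= 1.
Proof.
apply/andP; split.
  by apply: le_trans (kill_sup_ub D 0 w); case/andP: (term_01 D 0 w).
by apply: kill_sup_le => k; case/andP: (term_01 D k w).
Qed.

Lemma measurable_kill_sup D : (forall k, measurable (D k)) ->
  measurable_fun setT (kill_sup D).
Proof.
move=> mD; apply: measurable_fun_sups.
  by move=> w _; exists 1 => _ [n _ <-]; case/andP: (term_01 D n w).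
move=> k; apply: measurable_funM; last exact: measurable_indic.
have /andP[k0 _] := time_seq_itv k.
apply: measurable_funM; last exact: measurable_alive.
apply: measurable_funB; first exact: measurable_cst.
exact: (measurableT_comp measurable_expN (measurable_pcaf hM pA k0)).
Qed.

(** 1 - exp(- A) is nondecreasing, so a listed rational slightly after r, still before t and zeta,
    gives at least as much; r = t is listed itself. *)
Lemma kill_mass_le_sup w r : regular_path A w -> 0 <= r -> r <= t -> X r w <> None ->
  1 - expN (A r w) <= kill_sup (fun=> setT) w.
Proof.
move=> rw r0; rewrite le_eqVlt => /predU1P[->|rt] Xr.
  have := kill_sup_ub (fun=> setT) 0 w.
  rewrite /= indicT mulr1 /kill_mass alive_traj; case: (X t w) Xr => // a _.
  by rewrite mulr1.
have zr : (r%:E < zeta w)%E by apply/(zeta_gtP hM).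
have [k /andP[rk kt] kz] : exists2 k, r < @rational_seq R k < t & ((rational_seq k : R)%:E < zeta w)%E.
  case ez : (zeta w) zr => [z| |] // zr; last first.
    by have [k kk] := rational_seq_dense rt; exists k => //; rewrite ltry.
  have [|k /andP[rk]] := @rational_seq_dense R r (Num.min t z); first by rewrite lt_min rt.
  by rewrite lt_min => /andP[kt kz]; exists k => //; rewrite rk.
have k0 : 0 <= @rational_seq R k by apply: le_trans r0 _; exact: ltW.
have := kill_sup_ub (fun=> setT) k.+1 w.
rewrite /= indicT mulr1 k0 (ltW kt) /=; apply: le_trans.
have := (zeta_gtP hM w k0).1 kz.
rewrite /kill_mass alive_traj; case: (X _ w) => // a _; rewrite mulr1 lerB //.
apply: expN_le; first exact: (regular_path_ge0 rw).
by apply: (rp_le rw) => //; exact: ltW.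
Qed.

Lemma path_integral_kill_sup w : regular_path A w -> X 0 w <> None ->
  path_integral (A ^~ w) (zeta w) (fun s => expeR (- A s w)%E) t =
  (kill_sup (fun=> setT) w)%:E.
Proof.
move=> rw X0; rewrite (path_integral_expE rw).
have z0 : (0 < zeta w)%E by apply/(zeta_gtP hM).
set S := [set _ | _ in _].
have S0 : S 0%E.
  by exists 0 => //; rewrite (rp_0 rw) expN_fin // oppr0 expR0 subrr.
rewrite max_r; last exact: ereal_sup_ubound.
apply/eqP; rewrite eq_le; apply/andP; split.
  apply: ge_ereal_sup => _ [r [r0 rt rz] <-]; rewrite lee_fin.
  by apply: kill_mass_le_sup => //; exact/(zeta_gtP hM).
have Sk k : ((kill_mass (time_seq k) w)%:E <= ereal_sup S)%E.
  have /andP[k0 kt] := time_seq_itv k.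
  rewrite /kill_mass alive_traj; case eX : (X (time_seq k) w) => [a|]; last first.
    by rewrite mulr0; exact: ereal_sup_ubound.
  rewrite mulr1; apply: ereal_sup_ubound; exists (time_seq k) => //; split => //.
  by apply/(zeta_gtP hM) => //; rewrite eX.
have sup1 : (ereal_sup S <= 1%:E)%E.
  apply: ge_ereal_sup => _ [r _ <-]; rewrite lee_fin lerBlDr lerDl.
  by case/andP: (expN_ge0_le1 (A r w)).
have sup0 : (0 <= ereal_sup S)%E by exact: ereal_sup_ubound.
have fin : ereal_sup S \is a fin_num by rewrite ge0_fin_numE // (le_lt_trans sup1) // ltry.
rewrite -(fineK fin) lee_fin; apply: kill_sup_le => k.
by rewrite indicT mulr1 -lee_fin fineK.
Qed.

Lemma kill_sup_cvg (z : E) : {ae P (Some z), forall w,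
  kill_sup (fun k => [set v : Om | (time_seq k)%:E < exit_time (K n) v]%E) w @[n --> \oo] -->
    kill_sup (fun=> setT) w}.
Proof.
apply: filterS (exit_times_exhaust_ae hM E_lc K_exh (Some z)) => w hw.
apply/cvgrPdist_le => eps eps0.
have [k hk] : exists k, kill_sup (fun=> setT) w - eps <= kill_mass (time_seq k) w.
  apply: contrapT => h; suff : kill_sup (fun=> setT) w <= kill_sup (fun=> setT) w - eps.
    by rewrite lerBrDr gerDl leNgt eps0.
  apply: kill_sup_le => k; rewrite indicT mulr1 leNgt; apply/negP => /ltW h'.
  by apply: h; exists k.
have /andP[k0 kt] := time_seq_itv k.
have le n : kill_sup (fun k => [set v : Om | (time_seq k)%:E < exit_time (K n) v]%E) w <=
    kill_sup (fun=> setT) w.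
  apply: kill_sup_le => j; apply: le_trans (kill_sup_ub _ j w).
  rewrite indicT mulr1; apply: ler_piMr; first by case/andP: (kill_mass_01 (time_seq j) w).
  by rewrite indicE; case: (_ \in _); rewrite ?ler01.
have [n0 hn0] : exists n0, forall n, (n0 <= n)%N -> kill_sup (fun=> setT) w - eps <=
    kill_sup (fun k => [set v : Om | (time_seq k)%:E < exit_time (K n) v]%E) w.
  case eX : (X (time_seq k) w) => [a|]; last first.
    exists 0%N => n _; apply: le_trans hk _; rewrite /kill_mass alive_traj eX mulr0.
    by case/andP: (kill_sup_01 (fun k => [set v : Om | (time_seq k)%:E < exit_time (K n) v]%E) w).
  have zk : ((time_seq k)%:E < zeta w)%E by apply/(zeta_gtP hM) => //; rewrite eX.
  have [n0 hn0] := hw _ k0 zk.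
  exists n0 => n nn; apply: le_trans hk _; apply: le_trans (kill_sup_ub _ k w).
  rewrite indicE mem_set ?mulr1 //=; apply: lt_le_trans hn0 _.
  apply: ereal_inf_le_tmp => _ [u [u0 h] <-]; exists u => //; split => // -[b Kb eb].
  by apply: h; exists b => //; exact: (exhaustion_le K_exh nn).
exists n0 => // n /= nn; rewrite ger0_norm ?subr_ge0 //.
by rewrite lerBlDr -lerBlDl hn0.
Qed.

(** Over an interval that the path survives, phi <= 1 leaves the decrement of exp(- A), and these
    telescope. Over the interval in which it dies, exp(- A) <= 1 leaves the corresponding term of
    the sum for [alive]. *)
Lemma rsum_survival_le w (phi : E -> R) N : regular_path A w -> X 0 w <> None ->
  (forall a, 0 <= phi a <= 1) ->
  rsum (survival A) phi 0 t N w <= kill_sup (fun=> setT) w + rsum (@alive R E M) phi 0 t N w.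
Proof.
move=> rw X0 phi01; set J := kill_sup _ w.
pose g := grid 0 t N.
have g0 i : 0 <= g i by exact: grid_ge0.
have gS i : g i <= g i.+1 by exact: grid_le.
have J0 : 0 <= J by case/andP: (kill_sup_01 (fun=> setT) w).
have M0 : survival A (g 0%N) w = 1.
  rewrite /g grid0 /survival alive_traj (rp_0 rw) expN_fin // oppr0 expR0.
  by case: (X 0 w) X0 => // a _; rewrite mulr1.
(* The factor [alive (g i.+1)] keeps the intervals that the path survives; as long as the path is
   alive their sum is 1 - M, and it stays constant afterwards. *)
pose S n := \sum_(i < n) (survival A (g i) w - survival A (g i.+1) w) * alive (g i.+1) w.
have hS n : (n <= N.+1)%N -> S n <= J /\ (X (g n) w <> None -> S n = 1 - survival A (g n) w).
  elim: n => [_|n IH nN]; first by rewrite /S big_ord0 M0 subrr.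
  have [Sn Sn'] := IH (ltnW nN).
  rewrite /S big_ord_recr /= -/(S n) alive_traj.
  case eX : (X (g n.+1) w) => [a|]; last by rewrite mulr0 addr0.
  have Xn : X (g n) w <> None.
    by move=> h; have := traj_None_le hM (g0 n) (gS n) h; rewrite eX.
  rewrite mulr1 (Sn' Xn).
  have -> : 1 - survival A (g n) w + (survival A (g n) w - survival A (g n.+1) w) =
    1 - survival A (g n.+1) w by ring.
  split => //; rewrite {1}/survival alive_traj eX mulr1.
  apply: kill_mass_le_sup => //; last by rewrite eX.
  by rewrite -[leRHS](add0r t) -(grid_last 0 t N) grid_le.
apply: (@le_trans _ _ (S N.+1 + rsum (@alive R E M) phi 0 t N w)); last first.
  by rewrite lerD2r; case: (hS N.+1 (leqnn _)).
rewrite /S /rsum -big_split /=; apply: ler_sum => i _; rewrite -/(g i) -/(g i.+1).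
have dec := survival_le hM rw (g0 i) (gS i).
have /andP[p0 p1] := @ext0_01 R E phi (X (g i) w) phi01.
rewrite !(alive_traj (g i.+1)); case eX : (X (g i.+1) w) => [a|].
  rewrite mulr1; have : ext0 phi (X (g i) w) * (survival A (g i) w - survival A (g i.+1) w) <=
     survival A (g i) w - survival A (g i.+1) w by rewrite ler_piMl // subr_ge0.
  move=> h; apply: le_trans h _; rewrite lerDl mulr_ge0 // subr_ge0.
  rewrite alive_traj; case eg : (X (g i) w) => [b|] //.
  by have := traj_None_le hM (g0 i) (gS i) eg; rewrite eX.
rewrite mulr0 add0r subr0 ler_wpM2l //.
have -> : survival A (g i.+1) w = 0 by rewrite /survival alive_traj eX mulr0.
rewrite subr0 /survival ler_piMl //; first by case/andP: (alive_ge0_le1 (g i) w).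
by case/andP: (expN_ge0_le1 (A (g i) w)).
Qed.

(** Up to a time r before the exit from [K n] all factors phi(X) are 1 and the sum telescopes; the
    later terms are nonnegative. *)
Lemma rsum_survival_ge w (phi : E -> R) n N (z : E) : regular_path A w -> X 0 w = Some z ->
  (forall a, 0 <= phi a <= 1) -> (forall a, K n a -> phi a = 1) -> K n z ->
  kill_sup (fun k => [set v : Om | (time_seq k)%:E < exit_time (K n) v]%E) w <=
    rsum (survival A) phi 0 t N w.
Proof.
move=> rw X0 phi01 phi1 Kz.
pose g := grid 0 t N.
have g0 i : 0 <= g i by exact: grid_ge0.
have gS i : g i <= g i.+1 by exact: grid_le.
have dec i : 0 <= survival A (g i) w - survival A (g i.+1) w.
  by rewrite subr_ge0; exact: (survival_le hM rw).
have e01 i := @ext0_01 R E phi (X (g i) w) phi01.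
have R0 : 0 <= rsum (survival A) phi 0 t N w.
  by apply: sumr_ge0 => i _; rewrite mulr_ge0 //; case/andP: (e01 i).
apply: kill_sup_le => k; rewrite indicE; case: (boolP (w \in _)) => [/set_mem /= rk|_]; last by rewrite mulr0.
rewrite mulr1; set r := time_seq k in rk *.
have /andP[r0 rt] := time_seq_itv k; rewrite -/r in r0 rt.
(* [exit_time] ignores time 0, which is covered by z being in [K n]. *)
have one i : g i <= r -> ext0 phi (X (g i) w) = 1.
  move=> gr; have := g0 i; rewrite le_eqVlt => /predU1P[<-|gi0].
    by rewrite X0 /= phi1.
  have [|a Ka <-] := @exit_time_gtP _ _ M (K n) w (g i) _ gi0.
    by apply: le_lt_trans rk; rewrite lee_fin.
  by rewrite /= phi1.
have Mr : kill_mass r w <= 1 - survival A r w.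
  rewrite /kill_mass /survival alive_traj; case: (X r w) => [a|]; rewrite ?mulr1 // !mulr0 subr0.
  exact: ler01.
apply: le_trans Mr _.
have M0 : survival A (g 0%N) w = 1.
  by rewrite /g grid0 /survival alive_traj X0 (rp_0 rw) expN_fin // oppr0 expR0 mulr1.
(* The maximum covers the grid interval that straddles r: up to r the bound is the telescoped 1 - M
   at the grid point, and beyond r it stays at 1 - M_r. *)
have step j : (j <= N.+1)%N -> 1 - Num.max (survival A (g j) w) (survival A r w) <=
   \sum_(i < j) ext0 phi (X (g i) w) * (survival A (g i) w - survival A (g i.+1) w).
  elim: j => [_|j IH jN].
    by rewrite big_ord0 M0 subr_le0 le_max lexx.
  rewrite big_ord_recr /=; have {}IH := IH (ltnW jN).
  have [gr|rg] := leP (g j) r.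
    rewrite (one j gr) mul1r.
    have Mjr : survival A r w <= survival A (g j) w by exact: (survival_le hM rw).
    rewrite max_l // in IH.
    have : survival A (g j.+1) w <= Num.max (survival A (g j.+1) w) (survival A r w) by rewrite le_max lexx.
    lra.
  have Mjr : survival A (g j) w <= survival A r w by apply: (survival_le hM rw) => //; exact: ltW.
  have Mjr' : survival A (g j.+1) w <= survival A r w.
    by apply: le_trans Mjr; rewrite -subr_ge0.
  rewrite max_r // in IH; rewrite max_r //; apply: le_trans IH _.
  by rewrite lerDl mulr_ge0 //; case/andP: (e01 j).
have := step N.+1 (leqnn _); rewrite max_r //.
apply: (survival_le hM rw) => //.
by rewrite /g grid_last add0r.
Qed.

End PathFunctional.

(** * The killed and the exploding part of the lifetime *)

Section Completeness.
Context {R : realType} {E : pmetricType R}.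
Variables (E_lc : locally_compact [set: E]) (m : {measure set (borel E) -> \bar R}).
Variables (m_radon : radon m) (m_supp : full_support m).
Variables (e : dform E) (e_dir : dirichlet_form m e) (e_reg : regular_form m e).
Variables (X : process E) (X_hunt : hunt X) (X_assoc : associated X m e) (X_sf : strong_feller X).
Variables (k : {measure set (borel E) -> \bar R}) (k_killing : killing_measure e k).
Variables (eres : dform E) (eres_res : resurrected_form m k e eres).
Variables (Xres : process E) (Xres_hunt : hunt Xres) (Xres_assoc : associated Xres m eres).
Variables (A : R -> Omega Xres -> \bar R) (A_pcaf : pcaf A) (X_sub : subprocess X A).
Variables (K : nat -> set E) (K_exh : exhaustion K).
Implicit Types (z : E) (s t : R).

(** 1_B is the zero class of L^2, so p_s 1_B vanishes m-almost everywhere; being continuous by the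
    strong Feller property, it vanishes everywhere, as m charges every nonempty open set. *)
Lemma transition_null (B : set (borel E)) s z : measurable B -> m B = 0%E -> 0 < s ->
  transition X s \1_B z = 0.
Proof.
move=> mB B0 s0.
have m1 : borel_fun (\1_B : E -> R) by exact: measurable_indic.
have b01 a : 0 <= (\1_B : E -> R) a <= 1 by rewrite indicE; case: (_ \in _); rewrite ?lexx ?ler01.
have b1 : bounded_borel (\1_B : E -> R).
  by split => //; exists 1 => a; case/andP: (b01 a) => ? ?; rewrite ger0_norm.
have L2B : L2 m (\1_B : E -> R).
  apply: (@bounded_support_Lfun2 _ _ _ m _ 1 B) => //; first by rewrite B0 ltry.
    by move=> a; case/andP: (b01 a) => ? ?; rewrite ger0_norm.
  by move=> a Ba; rewrite indicE memNset.
have L20 : L2 m (fun _ : E => 0 : R).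
  apply: (@bounded_support_Lfun2 _ _ _ m _ 0 set0) => //; first by rewrite measure0 ltry.
  by move=> a; rewrite normr0.
have ae0 : (\1_B : E -> R) = (fun=> 0) %[ae m].
  exists B; split => // a /= h; apply: contrapT => Ba; apply: h => _.
  by rewrite indicE memNset.
have [sg _] := X_assoc.
have [N [mN N0 hN]] := sg_ae sg s0 L2B L20 ae0.
have s0' := ltW s0.
have T0 a : transition X s (fun=> 0) a = 0.
  rewrite transitionE // -[RHS](Rintegral_probability1 (Pr X (Some a))).
  by apply: eq_Rintegral => w _; case: (traj X s w).
have cT : continuous (transition X s (\1_B : E -> R)) := (X_sf s0 b1).1.
have /andP[Tz _] := transition_01 X_hunt z s0' m1 b01.
apply: contrapT => /eqP Tn0.
have Tpos : 0 < transition X s \1_B z by rewrite lt_neqAle eq_sym Tn0.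
pose U : set E := transition X s \1_B @^-1` `]0, +oo[%classic.
have oU : open U.
  by apply: open_comp; [move=> a _; exact: cT | exact: interval_open].
have mU : (m U <= m N)%E.
  apply: le_measure; rewrite ?inE //; first exact: sub_sigma_algebra.
  move=> a; rewrite /U /= in_itv /= andbT => Ta; apply: hN => /= /(_ I).
  by rewrite T0 => h; move: Ta; rewrite h ltxx.
have : (0 < m U)%E by apply: m_supp => //; exists z; rewrite /U /= in_itv /= Tpos.
by rewrite ltNge; apply/negP; rewrite negbK -N0.
Qed.

(* [X^res] inherits absolute continuity from the strong Feller property of [X],
   because [exp (- A)] does not vanish before the lifetime. *)
Lemma resurrected_absolutely_continuous (B : set (borel E)) s z :
  measurable B -> m B = 0%E -> 0 < s ->
  {ae Pr Xres (Some z), forall w, ~ (Some @` B) (traj Xres s w)}.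
Proof.
move=> mB B0 s0; have s0' := ltW s0.
have m1 : borel_fun (\1_B : E -> R) by exact: measurable_indic.
have b01 a : 0 <= (\1_B : E -> R) a <= 1 by rewrite indicE; case: (_ \in _); rewrite ?lexx ?ler01.
have b1 : bounded_borel (\1_B : E -> R).
  by split => //; exists 1 => a; case/andP: (b01 a) => ? ?; rewrite ger0_norm.
have := transition_null z mB B0 s0.
rewrite (subprocessE Xres_hunt A_pcaf X_sub) //.
have f01 w : 0 <= ext0 \1_B (traj Xres s w) * survival A s w <= 1.
  by apply: ge0_le1M; [exact: ext0_01 | exact: survival_ge0_le1].
move=> /Rintegral_eq0_ae H.
have {}H := H _ (fun w => (andP (f01 w)).1).
have {}H : {ae Pr Xres (Some z), forall w, ext0 \1_B (traj Xres s w) * survival A s w = 0}.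
  apply: H; apply: bounded_mfun01 => //.
  by apply: measurable_funM; [exact: measurable_ext0_traj | exact: measurable_survival].
apply: filterS2 H (regular_path_ae Xres_hunt A_pcaf z) => w + rw [a Ba eX].
rewrite -eX /= indicE mem_set // mul1r /survival alive_traj -eX mulr1.
have zs : (s%:E < zeta w)%E by apply/(zeta_gtP Xres_hunt) => //; rewrite -eX.
have := rp_fin rw s0' zs; have := regular_path_ge0 rw s0'.
case: (A s w) => // r; rewrite lee_fin => r0 _; rewrite expN_fin // => h.
by have := expR_gt0 (- r); rewrite h ltxx.
Qed.

Section Bump.
Variables (phi : E -> R) (dphi : dom e phi) (Cphi : C0 phi) (phi01 : forall a, 0 <= phi a <= 1).

Lemma rsum_mean_link z t N : 0 < t ->
  \int[Pr X (Some z)]_w rsum (@alive R E X) phi 0 t N w =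
  \int[Pr Xres (Some z)]_w rsum (survival A) phi 0 t N w.
Proof.
move=> t0; have t0' := ltW t0; have mphi : borel_fun phi by apply: continuous_borel_fun; case: Cphi.
have g0 i : 0 <= grid 0 t N i by exact: grid_ge0.
have bX u : 0 <= u -> bounded_mfun (@alive R E X u).
  by move=> u0; apply: bounded_mfun01; [exact: measurable_alive|exact: alive_ge0_le1].
have bS u : 0 <= u -> bounded_mfun (survival A u).
  by move=> u0; apply: bounded_mfun01; [exact: measurable_survival|exact: survival_ge0_le1].
have bphi (M : process E) (hM : hunt M) u : 0 <= u -> bounded_mfun (fun w => ext0 phi (traj M u w)).
  move=> u0; apply: bounded_mfun01; first exact: measurable_ext0_traj.
  by move=> w; exact: ext0_01.
have bpX := bphi X X_hunt; have bpr := bphi Xres Xres_hunt.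
rewrite /rsum (@Rintegral_sum _ _ _ _ (fun i w => ext0 phi (traj X (grid 0 t N i) w) *
    (alive (grid 0 t N i) w - alive (grid 0 t N i.+1) w))) //; last first.
  by move=> i; apply: bounded_mfunM; [exact: bpX | apply: bounded_mfunB; exact: bX].
rewrite (@Rintegral_sum _ _ _ _ (fun i w => ext0 phi (traj Xres (grid 0 t N i) w) *
    (survival A (grid 0 t N i) w - survival A (grid 0 t N i.+1) w))) //; last first.
  by move=> i; apply: bounded_mfunM; [exact: bpr | apply: bounded_mfunB; exact: bS].
apply: eq_bigr => i _.
transitivity (\int[Pr X (Some z)]_w (ext0 phi (traj X (grid 0 t N i) w) -
    ext0 phi (traj X (grid 0 t N i) w) * alive (grid 0 t N i + t / N.+1%:R) w)).
  apply: eq_Rintegral => w _; rewrite gridS mulrBr; congr (_ - _).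
  by rewrite alive_traj; case: (traj X _ w) => [a|] /=; rewrite ?mulr1 ?mulr0.
transitivity (\int[Pr Xres (Some z)]_w (ext0 phi (traj Xres (grid 0 t N i) w) * survival A (grid 0 t N i) w -
    ext0 phi (traj Xres (grid 0 t N i) w) * survival A (grid 0 t N i + t / N.+1%:R) w)); last first.
  by apply: eq_Rintegral => w _; rewrite gridS mulrBr.
have d0 : 0 < t / N.+1%:R by rewrite divr_gt0.
have gd0 : 0 <= grid 0 t N i + t / N.+1%:R by rewrite -gridS.
rewrite !RintegralB //; try (apply: bounded_mfun_integrable => //).
- by rewrite (one_time_marginal X_hunt Xres_hunt A_pcaf X_sub) //
    (two_time_marginal X_hunt Xres_hunt A_pcaf X_sub).
- by apply: bounded_mfunM; [exact: bpr | exact: bS].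
- by apply: bounded_mfunM; [exact: bpr | exact: bS].
- exact: bpX.
- by apply: bounded_mfunM; [exact: bpX | exact: bX].
Qed.

Lemma resurrected_rsum_mean_cvg0 z t : 0 < t ->
  \int[Pr Xres (Some z)]_w rsum (@alive R E Xres) phi 0 t N w @[N --> \oo] --> 0.
Proof.
move=> t0; have dres := rf_dirichlet eres_res.
have [dphi' _] := (rf_core eres_res phi).2 (conj dphi Cphi).
have phi0 a : 0 <= phi a by case/andP: (phi01 a).
have small eps : 0 < eps -> exists psi, [/\ dom eres psi, C0 psi,
    forall a, 0 <= psi a <= 1, forall a, phi a != 0 -> psi a = 1 & energy eres phi psi < eps].
  move=> eps0; have [psi [d c b o en]] := resurrected_energy_small E_lc e_dir e_reg
    k_killing eres_res K_exh dphi Cphi phi0 eps0.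
  by exists psi; split => //; have [] := (rf_core eres_res psi).2 (conj d c).
have c := rsum_mean_cvg Xres_hunt E_lc Cphi phi01 (z:=z) (lexx 0) t0.
suff e0 : \int[Pr Xres (Some z)]_w jump_end phi 0 t w = 0 by rewrite e0 in c.
rewrite -[RHS](Rintegral_probability1 (Pr Xres (Some z))); apply: ae_eq_Rintegral => //.
  exact: (jump_end_measurable Xres_hunt E_lc Cphi (lexx 0) t0).
have := jump_end_null Xres_hunt E_lc m_radon dres Xres_assoc K_exh dphi' Cphi phi01 small
  resurrected_absolutely_continuous z t0.
by apply: filterS => w -> _.
Qed.

End Bump.

(* The indicator of [0 < zeta <= t, X_{zeta-} = Delta]; for [killed_inside] the
   last condition is [X_{zeta-} <> Delta]. *)
Definition explode t (w : Omega X) : R :=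
  (alive 0 w - alive (0 + t) w) * (1 - ext0 (fun=> 1) (left_end w)).

Definition killed_inside t (w : Omega X) : R :=
  ext0 (fun=> 1) (left_end w) * (alive 0 w - alive (0 + t) w).

(** The indicator of E need not be continuous at the cemetery, so the grid sums are taken with
    cutoffs phi_n. For fixed n the limit in N squeezes the mean of phi_n(X_{zeta-}) between [Jn n]
    and [J], the lower bound as soon as z is in [K n]; then n tends to infinity. Measurability comes
    from the same limit. *)
Lemma killed_inside_mean z t : 0 < t ->
  measurable_fun setT (killed_inside t) /\
  \int[Pr X (Some z)]_w killed_inside t w =
  \int[Pr Xres (Some z)]_w kill_sup A t (fun=> setT) w.
Proof.
move=> t0; have t0' := ltW t0.
have /choice[phi hphi] : forall n, exists psi,
  [/\ dom e psi, C0 psi, forall x, 0 <= psi x <= 1 & forall x, K n x -> psi x = 1].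
  by move=> n; exact: (core_bump E_lc K_exh n e_dir e_reg).
have cvgL w : jump_end (phi n) 0 t w @[n --> \oo] --> killed_inside t w.
  apply: cvgM; last exact: cvg_cst.
  case: (left_end w) => [a|] /=; last exact: cvg_cst.
  apply: cvg_near_cst; have [n0 hn0] := exhaustion_interior K_exh a.
  exists n0 => // n /= nn; have [_ _ _ ->] := hphi n => //.
  by apply: (exhaustion_le K_exh nn); exact: interior_subset.
have mj n : measurable_fun setT (jump_end (M := X) (phi n) 0 t).
  by have [_ C _ _] := hphi n; exact: (jump_end_measurable X_hunt E_lc C (lexx 0) t0).
have mL : measurable_fun setT (killed_inside t) by exact: (measurable_fun_cvg mj).
split => //.
have c1 : \int[Pr X (Some z)]_w jump_end (phi n) 0 t w @[n --> \oo] -->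
    \int[Pr X (Some z)]_w killed_inside t w.
  apply: (@cvg_Rintegral_bounded _ _ _ _ _ _ 1) => //; last by apply: aeW => w; exact: cvgL.
  move=> n w; have [_ _ b _] := hphi n.
  by have /andP[h1 h2] := jump_end_01 X_hunt b w (lexx 0) t0'; rewrite ger0_norm.
pose J := kill_sup A t (fun=> setT).
pose Jn n := kill_sup A t (fun k => [set v : Omega Xres | (time_seq t k)%:E < exit_time (K n) v]%E).
have bsup D : (forall k, measurable (D k)) -> bounded_mfun (kill_sup A t D).
  move=> mD; apply: bounded_mfun01; first exact: (measurable_kill_sup Xres_hunt A_pcaf t0).
  by move=> w; exact: (kill_sup_01 A t).
have bJ : bounded_mfun J by apply: bsup.
have [Kc _ _] := K_exh.
have bJn n : bounded_mfun (Jn n).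
  apply: bsup => j; have /andP[j0 _] := time_seq_itv t0 j.
  rewrite (_ : [set v | _] = ~` [set v : Omega Xres | exit_time (K n) v <= (time_seq t j)%:E]%E).
    apply: measurableC; have [_ /(_ _ j0)] := exit_time_stopping Xres_hunt (Kc n).
    exact: (filtration_measurable Xres_hunt).
  by apply/seteqP; split => v /=; rewrite ltNge => /negP.
have upper n : \int[Pr X (Some z)]_w jump_end (phi n) 0 t w <= \int[Pr Xres (Some z)]_w J w.
  have [d C b _] := hphi n.
  have cX := rsum_mean_cvg X_hunt E_lc C b (z:=z) (lexx 0) t0.
  have cr := resurrected_rsum_mean_cvg0 d C b z t0.
  have cJ : \int[Pr Xres (Some z)]_w J w + \int[Pr Xres (Some z)]_w rsum (@alive R E Xres) (phi n) 0 t N w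
      @[N --> \oo] --> \int[Pr Xres (Some z)]_w J w + 0 by apply: cvgD => //; exact: cvg_cst.
  rewrite addr0 in cJ; apply: (ler_cvg_to cX cJ); apply: nearW => N.
  have mphi : borel_fun (phi n) by apply: continuous_borel_fun; case: C.
  have br : bounded_mfun (rsum (@alive R E Xres) (phi n) 0 t N).
    apply: bounded_mfun01.
      by apply: measurable_rsum => //; exact: measurable_alive.
    by move=> w; exact: rsum_alive_ge0_le.
  have bs : bounded_mfun (rsum (survival A) (phi n) 0 t N).
    rewrite /rsum; apply: (@bounded_mfun_sum _ _ _ (fun i w => ext0 (phi n) (traj Xres (grid 0 t N i) w) *
      (survival A (grid 0 t N i) w - survival A (grid 0 t N i.+1) w))) => i.
    apply: bounded_mfunM.
      apply: bounded_mfun01; first by apply: measurable_ext0_traj => //; exact: grid_ge0.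
      by move=> w; exact: ext0_01.
    by apply: bounded_mfunB; apply: bounded_mfun01;
      try (by move=> w; exact: survival_ge0_le1); apply: measurable_survival => //; exact: grid_ge0.
  rewrite (rsum_mean_link C b) // -RintegralD //; [|exact: bounded_mfun_integrable..].
  apply: ler_Rintegral_ae => //; first exact: bounded_mfunD.
  apply: filterS2 (regular_path_ae Xres_hunt A_pcaf z) (ae_start Xres_hunt (Some z)) => w rw X0.
  by apply: (rsum_survival_le Xres_hunt t0) => //; rewrite X0.
have lower : \forall n \near \oo, \int[Pr Xres (Some z)]_w Jn n w <= \int[Pr X (Some z)]_w jump_end (phi n) 0 t w.
  have [n0 hn0] := exhaustion_interior K_exh z.
  exists n0 => // n /= nn; have [d C b o] := hphi n.
  have Kz : K n z by apply: (exhaustion_le K_exh nn); exact: interior_subset.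
  have cX := rsum_mean_cvg X_hunt E_lc C b (z:=z) (lexx 0) t0.
  apply: (ler_cvg_to (cvg_cst _) cX); apply: nearW => N.
  have mphi : borel_fun (phi n) by apply: continuous_borel_fun; case: C.
  have bs : bounded_mfun (rsum (survival A) (phi n) 0 t N).
    rewrite /rsum; apply: (@bounded_mfun_sum _ _ _ (fun i w => ext0 (phi n) (traj Xres (grid 0 t N i) w) *
      (survival A (grid 0 t N i) w - survival A (grid 0 t N i.+1) w))) => i.
    apply: bounded_mfunM.
      apply: bounded_mfun01; first by apply: measurable_ext0_traj => //; exact: grid_ge0.
      by move=> w; exact: ext0_01.
    by apply: bounded_mfunB; apply: bounded_mfun01;
      try (by move=> w; exact: survival_ge0_le1); apply: measurable_survival => //; exact: grid_ge0.
  rewrite (rsum_mean_link C b) //.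
  apply: ler_Rintegral_ae => //.
  apply: filterS2 (regular_path_ae Xres_hunt A_pcaf z) (ae_start Xres_hunt (Some z)) => w rw X0.
  exact: (rsum_survival_ge Xres_hunt t0 N rw X0).
have c2 : \int[Pr Xres (Some z)]_w Jn n w @[n --> \oo] --> \int[Pr Xres (Some z)]_w J w.
  apply: (@cvg_Rintegral_bounded _ _ _ _ _ _ 1).
  - by move=> n; case: (bJn n).
  - by case: bJ.
  - by move=> n w; have /andP[h1 h2] := kill_sup_01 A t (fun k => [set v : Omega Xres | (time_seq t k)%:E < exit_time (K n) v]%E) w; rewrite ger0_norm.
  - exact: (kill_sup_cvg Xres_hunt E_lc A K_exh t0 z).
apply/eqP; rewrite eq_le; apply/andP; split.
  by apply: (ler_cvg_to c1 (cvg_cst _)); exact: nearW.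
exact: (ler_cvg_to c2 c1).
Qed.

(** Almost surely 1 is the sum of [alive t], [killed_inside t] and [explode t]. The means of the
    first two are the two terms of the completeness identity, so that identity says that the
    nonnegative [explode t] has mean 0. *)
Lemma completenessE z t : 0 < t ->
  (1 = \int[Pr Xres (Some z)]_(w in [set w | (t%:E < zeta w)%E]) expeR (- A t w)
       + \int[Pr Xres (Some z)]_w
           path_integral (A ^~ w) (zeta w) (fun s => expeR (- A s w)) t)%E <->
  {ae Pr X (Some z), forall w, explode t w = 0}.
Proof.
move=> t0; have t0' := ltW t0.
have [mL LE] := killed_inside_mean z t0.
pose J := kill_sup A t (fun=> setT).
have -> : (\int[Pr Xres (Some z)]_(w in [set w | (t%:E < zeta w)%E]) expeR (- A t w) =
    (\int[Pr X (Some z)]_w alive t w)%:E)%E.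
  rewrite -(transition_alive X_hunt) // (transition1E Xres_hunt A_pcaf X_sub) //.
  have bs : bounded_mfun (survival A t).
    by apply: bounded_mfun01; [exact: measurable_survival|exact: survival_ge0_le1].
  rewrite /Rintegral fineK; last first.
    by apply: integrable_fin_num => //; exact: bounded_mfun_integrable.
  rewrite [LHS]integral_mkcond; apply: ge0_ae_eq_integral_nonmeasurable.
  - by move=> w; rewrite patchE; case: ifP => // _; exact: expeR_ge0.
  - by move=> w; rewrite lee_fin; case/andP: (survival_ge0_le1 A t w).
  - by apply/measurable_EFinP; case: bs.
  apply: filterS (regular_path_ae Xres_hunt A_pcaf z) => w rw.
  rewrite patchE /survival alive_traj; case: ifPn => [/set_mem /= | /negP h].
    move=> /(zeta_gtP Xres_hunt w t0'); case: (traj Xres t w) => // a _.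
    by rewrite mulr1 expNE // (regular_path_ge0 rw).
  case eX : (traj Xres t w) => [a|]; last by rewrite mulr0.
  by exfalso; apply: h; apply/mem_set/(zeta_gtP Xres_hunt w t0'); rewrite eX.
have bJ : bounded_mfun J.
  apply: bounded_mfun01; first exact: (measurable_kill_sup Xres_hunt A_pcaf t0).
  by move=> w; exact: (kill_sup_01 A t).
have -> : (\int[Pr Xres (Some z)]_w path_integral (A ^~ w) (zeta w) (fun s => expeR (- A s w)) t =
    (\int[Pr X (Some z)]_w killed_inside t w)%:E)%E.
  rewrite LE /Rintegral fineK; last first.
    by apply: integrable_fin_num => //; exact: bounded_mfun_integrable.
  (* The path integral coincides with the measurable [kill_sup] on almost every path only, and its
     own measurability is not known beforehand. *)
  apply: ge0_ae_eq_integral_nonmeasurable.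
  - by move=> w; rewrite /path_integral le_max lexx.
  - by move=> w; rewrite lee_fin; case/andP: (kill_sup_01 A t (fun=> setT) w).
  - by apply/measurable_EFinP; case: bJ.
  apply: filterS2 (regular_path_ae Xres_hunt A_pcaf z) (ae_start Xres_hunt (Some z)) => w rw X0.
  by rewrite (path_integral_kill_sup Xres_hunt t0 rw) // X0.
have bal u : 0 <= u -> bounded_mfun (@alive R E X u).
  by move=> u0; apply: bounded_mfun01; [exact: measurable_alive|exact: alive_ge0_le1].
have one01 (y : opc E) : 0 <= ext0 (fun=> 1 : R) y <= 1 by case: y => [a|] /=; rewrite ?lexx ?ler01.
have dec w : 0 <= @alive R E X 0 w - alive (0 + t) w <= 1.
  have /andP[a b] := alive_ge0_le1 0 w; have /andP[c d] := alive_ge0_le1 (0 + t) w.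
  by rewrite subr_ge0 (alive_le X_hunt) ?lerDl //= lerBlDr (le_trans b) // lerDl.
have bL : bounded_mfun (killed_inside t).
  by apply: bounded_mfun01 => // w; exact: ge0_le1M.
have exE w : explode t w = alive 0 w - (alive t w + killed_inside t w).
  by rewrite /explode /killed_inside add0r; ring.
have ex0 w : 0 <= explode t w.
  by rewrite mulr_ge0 //; [case/andP: (dec w) | rewrite subr_ge0; case/andP: (one01 (left_end w))].
have bs := bounded_mfunD (bal t t0') bL.
have bex : bounded_mfun (explode t).
  rewrite (_ : explode t = fun w => alive 0 w - (alive t w + killed_inside t w)).
    exact: bounded_mfunB (bal 0 (lexx 0)) bs.
  exact/funext.
have al0 : \int[Pr X (Some z)]_w alive 0 w = 1.
  rewrite -[RHS](Rintegral_probability1 (Pr X (Some z))); apply: ae_eq_Rintegral => //.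
    exact: measurable_alive.
  by apply: filterS (ae_start X_hunt (Some z)) => w X0 _; rewrite alive_traj X0.
have exI : \int[Pr X (Some z)]_w explode t w =
    1 - (\int[Pr X (Some z)]_w alive t w + \int[Pr X (Some z)]_w killed_inside t w).
  have i0 := bounded_mfun_integrable (Pr X (Some z)) measurableT (bal 0 (lexx 0)).
  have it := bounded_mfun_integrable (Pr X (Some z)) measurableT (bal t t0').
  have iL := bounded_mfun_integrable (Pr X (Some z)) measurableT bL.
  have iS := bounded_mfun_integrable (Pr X (Some z)) measurableT bs.
  rewrite -al0 -RintegralD // -RintegralB //.
  by apply: eq_Rintegral => w _; rewrite exE.
rewrite -EFinD; split => [[h]|h].
  apply: (Rintegral_eq0_ae bex ex0); rewrite exI -h subrr //.
congr EFin; apply/eqP; rewrite -subr_eq0 -exI; apply/eqP.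
rewrite -[RHS](Rintegral_probability1 (Pr X (Some z))); apply: ae_eq_Rintegral => //.
  by case: bex.
by apply: filterS h => w -> _.
Qed.

(** A finite lifetime is at most some integer, so countably many horizons t detect every
    explosion. *)
Lemma explode_Omega_p z : (forall t, 0 < t -> {ae Pr X (Some z), forall w, explode t w = 0}) <->
  Pr X (Some z) (Omega_p K) = 0%E.
Proof.
have mO := Omega_p_measurable X_hunt K_exh.
have aeO := Omega_p_left_end_ae X_hunt E_lc K_exh z.
split => [h|O0 t t0].
  apply/(negligibleP _ mO).
  have : {ae Pr X (Some z), forall w, forall n : nat, explode n.+1%:R w = 0}.
    by apply: ae_foralln => n; exact: h.
  move=> h'; suff : {ae Pr X (Some z), forall w, ~ Omega_p K w}.
    by apply: negligibleS => w Ow /(_ Ow).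
  move: h' aeO (ae_start X_hunt (Some z)); apply: filterS3 => w hw Ow X0 /Ow [zoo el].
  have z0 : (0 <= zeta w)%E by apply: le_ereal_inf_tmp => _ [t [t0 _] <-]; rewrite lee_fin.
  case ez : (zeta w) z0 zoo => [r| |] //; rewrite lee_fin => r0 _.
  have := hw (Num.bound r); rewrite /explode el /= subr0 mulr1 add0r !alive_traj X0.
  rewrite (hunt_cemetery X_hunt) ?subr0; first by move=> /eqP; rewrite oner_eq0.
    by [].
  by rewrite ez lee_fin (le_trans (ltW (archi_boundP r0))) // ler_nat.
have : {ae Pr X (Some z), forall w, ~ Omega_p K w}.
  by exists (Omega_p K); split => // w /= /contrapT.
apply: filterS2 aeO => w Ow nO; rewrite /explode add0r.
case el : (left_end w) => [a|] /=; first by rewrite subrr mulr0.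
rewrite subr0 mulr1 !alive_traj; case X0 : (traj X 0 w) => [a|]; last first.
  by rewrite (traj_None_le X_hunt (lexx 0) (ltW t0) X0) subrr.
case Xt : (traj X t w) => [b|]; first by rewrite subrr.
exfalso; apply: nO; apply/Ow; split => //.
by apply: le_lt_trans ((zeta_leP X_hunt w (ltW t0)).2 Xt) _; rewrite ltry.
Qed.

Lemma zeta_p_Omega_p : [set w | zeta w = zeta_p K w /\ (zeta w < +oo)%E] = @Omega_p R E X K.
Proof.
apply/seteqP; split => w /=.
  by move=> [+ zoo]; rewrite /zeta_p; case: (pselect (Omega_p K w)) => // nO zE; rewrite zE in zoo.
move=> Ow; split; first by rewrite /zeta_p; case: (pselect (Omega_p K w)).
by have [] := Ow 0%N I.
Qed.

End Completeness.

Theorem mainTheorem3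
  (R : realType) (E : pmetricType R)
  (E_lc : locally_compact [set: E]) (E_sep : separable E)
  (m : {measure set (borel E) -> \bar R})
  (m_radon : radon m) (m_supp : full_support m)
  (e : dform E) (e_dir : dirichlet_form m e) (e_reg : regular_form m e)
  (X : process E) (X_hunt : hunt X) (X_assoc : associated X m e)
  (X_irr : irreducible X m) (X_sf : strong_feller X)
  (k : {measure set (borel E) -> \bar R}) (k_killing : killing_measure e k)
  (eres : dform E) (eres_res : resurrected_form m k e eres)
  (Xres : process E) (Xres_hunt : hunt Xres)
  (Xres_assoc : associated Xres m eres)
  (A : R -> Omega Xres -> \bar R) (A_pcaf : pcaf A) (A_revuz : revuz m k A)
  (X_sub : subprocess X A)
  (K : nat -> set E) (K_exh : exhaustion K) :
  stoch_complete_at_infinity A <->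
  (forall x : E, Pr X (Some x)
     [set w | zeta w = zeta_p K w /\ (zeta w < +oo)%E] = 0%E).
Proof.
split => h x.
  rewrite zeta_p_Omega_p.
  apply/explode_Omega_p => // t t0.
  by apply/(completenessE E_lc m_radon m_supp e_dir e_reg X_hunt X_assoc X_sf k_killing
    eres_res Xres_hunt Xres_assoc A_pcaf X_sub K_exh x t0); exact: h.
move=> t t0.
apply/(completenessE E_lc m_radon m_supp e_dir e_reg X_hunt X_assoc X_sf k_killing
    eres_res Xres_hunt Xres_assoc A_pcaf X_sub K_exh x t0).
have := h x; rewrite zeta_p_Omega_p => O0.
by apply: ((explode_Omega_p E_lc X_hunt K_exh x).2 O0).
Qed.
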